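(* Let $M$ be a smooth manifold and $r\ge2$ an integer. There exists a Lie $r$-algebra structure on the complex $$C^\infty(M)\xrightarrow{d}\cdots\xrightarrow{d}\Omega^{r-2}(M)\xrightarrow{d}\Gamma(E^{r-1})=\chi(M)\oplus\Omega^{r-1}(M),$$ concentrated in degrees $-r+1,\dots,0$, whose only non-vanishing brackets (up to permutations of the entries) are the following. (1) Unary bracket: the de Rham differential in negative degrees. (2) Binary bracket: for $e_1,e_2\in\Gamma(E^{r-1})$, $[e_1,e_2]=[\![e_1,e_2]\!]_{Cou}$; for $e=(X,\alpha)\in\Gamma(E^{r-1})$ and $\xi\in\Omega^{\bullet<r-1}(M)$, $[e,\xi]=\frac12\mathcal{L}_X\xi$. (3) Trinary bracket: for $e_i\in\Gamma(E^{r-1})$, $$[e_0,e_1,e_2]=-\tfrac16\big(\langle[\![e_0,e_1]\!]_{Cou},e_2\rangle+\text{cyclic permutations}\big);$$ for $\xi\in\Omega^{\bullet<r-1}(M)$ and $e_i=(X_i,\alpha_i)\in\Gamma(E^{r-1})$, $$[\xi,e_1,e_2]=-\tfrac16\Big(\tfrac12(\iota_{X_1}\mathcal{L}_{X_2}-\iota_{X_2}\mathcal{L}_{X_1})+\iota_{[X_1,X_2]}\Big)\xi.$$ (4) $n$-ary bracket for $n\ge3$ an odd integer: for $e_i=(X_i,\alpha_i)\in\Gamma(E^{r-1})$, $$[e_0,\dots,e_{n-1}]=\sum_i[X_0,\dots,\alpha_i,\dots,X_{n-1}],$$ with $$[\alpha,X_1,\dots,X_{n-1}]=\frac{(-1)^{\frac{n+1}2}12B_{n-1}}{(n-1)(n-2)}\sum_{1\le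 i<j\le n-1}(-1)^{i+j+1}\iota_{X_{n-1}}\cdots\widehat{\iota_{X_j}}\cdots\widehat{\iota_{X_i}}\cdots\iota_{X_1}[\alpha,X_i,X_j];$$ and for $\xi\in\Omega^{\bullet<r-1}(M)$ and $e_i=(X_i,\alpha_i)\in\Gamma(E^{r-1})$, $$[\xi,e_1,\dots,e_{n-1}]=\frac{(-1)^{\frac{n+1}2}12B_{n-1}}{(n-1)(n-2)}\sum_{1\le i<j\le n-1}(-1)^{i+j+1}\iota_{X_{n-1}}\cdots\widehat{\iota_{X_j}}\cdots\widehat{\iota_{X_i}}\cdots\iota_{X_1}[\xi,X_i,X_j].$$ Here the $B$'s denote the Bernoulli numbers.
   Context: $\chi(M)$ is the space of vector fields. $E^{r-1}=TM\oplus\wedge^{r-1}T^*M$ carries the pairing $\langle X+\alpha,Y+\beta\rangle=\iota_X\beta+\iota_Y\alpha$ and the Courant bracket $[\![X+\alpha,Y+\beta]\!]_{Cou}=[X,Y]+\mathcal{L}_X\beta-\mathcal{L}_Y\alpha-\frac12d(\iota_X\beta-\iota_Y\alpha)$. The space $\Gamma(E^{r-1})$ has degree $0$, and $\Omega^k(M)$, $0\le k\le r-2$, has degree $k-r+1$; the last differential sends $\xi\in\Omega^{r-2}(M)$ to $(0,d\xi)$. Inside brackets, a vector field $X$ stands for $(X,0)$ and an $(r-1)$-form $\alpha$ for $(0,\alpha)$. A hat denotes omission, and $[X_0,\dots,\alpha_i,\dots,X_{n-1}]$ has $\alpha_i$ in the $i$-th slot in place of $X_i$; it is obtained from $[\alpha,X_1,\dots,X_{n-1}]$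 by skew-symmetry. In the formulas of (4), $[\alpha,X_i,X_j]$ and $[\xi,X_i,X_j]$ are the trinary brackets of (3). Brackets on permuted entries are determined by graded skew-symmetry. An $L_\infty$-algebra is a graded vector space $V=\bigoplus_{i\in\mathbb Z}V_i$ with multilinear maps $l_n$ ($n\ge1$; here written $[\cdot,\dots,\cdot]$) in $n$ arguments, of degree $2-n$, which are graded skew-symmetric, $l_n(\dots,v_k,v_{k+1},\dots)=-(-1)^{|v_k||v_{k+1}|}l_n(\dots,v_{k+1},v_k,\dots)$, and satisfy for each $n\ge1$ $$\sum_{i+j=n+1}\ \sum_{\sigma\in Sh(i,n-i)}\chi(\sigma)(-1)^{i(j-1)}l_j\big(l_i(v_{\sigma(1)},\dots,v_{\sigma(i)}),v_{\sigma(i+1)},\dots,v_{\sigma(n)}\big)=0,$$ where $Sh(i,n-i)$ is the set of permutations preserving the order of the first $i$ and of the last $n-i$ elements, and $\chi(\sigma)$ is the sign of $\sigma$ times the Koszul sign of the permutation of $v_1,\dots,v_n$. A Lie $r$-algebra is an $L_\infty$-algebra concentrated in degrees $-r+1,\dots,0$. *)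

(* Defs.v *)
From HB Require Import structures.
From mathcomp Require Import all_boot all_order all_fingroup all_algebra.
From mathcomp Require Import all_classical reals topology normedtype derive.
From mathcomp Require Import ring.

Set Implicit Arguments.
Unset Strict Implicit.
Unset Printing Implicit Defensive.

Import Order.TTheory GRing.Theory Num.Theory numFieldNormedType.Exports.
Local Open Scope classical_set_scope.
Local Open Scope ring_scope.

Section EuclideanSmooth.
Context {R : realType} {m : nat}.
Implicit Types (U : set 'rV[R]_m) (f g : 'rV[R]_m -> R).

(* Meaningful for open [U] only: all iterated partial derivatives of order at
   most [k] exist and are continuous at the points of [U]. *)
Fixpoint Ck_on (k : nat) U f : Prop :=
  (forall x, U x -> {for x, continuous f}) /\
  if k is k'.+1 then
    forall i : 'I_m, (forall x, U x -> derivable f x (delta_mx 0 i)) /\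
                     Ck_on k' U (fun x => 'D_(delta_mx 0 i) f x)
  else True.

Definition smooth_on U f : Prop := forall k, Ck_on k U f.

Lemma Ck_on_cont k U f : Ck_on k U f -> forall x, U x -> {for x, continuous f}.
Proof. by case: k => [|k] []. Qed.

Lemma Ck_onW k U f : Ck_on k.+1 U f -> Ck_on k U f.
Proof.
elim: k f => [|k IHk] f [cf df]; first by split.
by split=> // i; have [dfi ki] := df i; split=> //; apply: IHk.
Qed.

Lemma eq_on_near U f g x : open U -> (forall x, U x -> f x = g x) -> U x ->
  \forall y \near x, f y = g y.
Proof. by move=> oU fg Ux; exact: filterS fg (open_nbhs_nbhs (conj oU Ux)). Qed.

Lemma eq_on_cont U f g : open U -> (forall x, U x -> f x = g x) ->
  (forall x, U x -> {for x, continuous f}) ->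
  forall x, U x -> {for x, continuous g}.
Proof.
move=> oU fg cf x Ux; have nfg := eq_on_near oU fg Ux.
rewrite /prop_for /continuous_at -(fg x Ux).
exact: cvg_trans (near_eq_cvg (FF := nbhs_filter x) nfg) (cf x Ux).
Qed.

Lemma eq_Ck_on k U f g : open U -> (forall x, U x -> f x = g x) ->
  Ck_on k U f -> Ck_on k U g.
Proof.
move=> oU; elim: k f g => [|k IHk] f g fg.
  by move=> [cf _]; split=> //; exact: eq_on_cont cf.
move=> [cf df]; split; first exact: eq_on_cont cf.
move=> i; have [dfi ki] := df i; split=> [x Ux|].
  exact: near_eq_derivable (eq_on_near oU fg Ux) (dfi x Ux).
apply: IHk ki => x Ux; apply: near_eq_derive; exact: (eq_on_near oU fg Ux).
Qed.

Lemma Ck_on_cst k U c : Ck_on k U (cst c).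
Proof.
have cc c' x : {for x, continuous (cst c' : 'rV[R]_m -> R)}.
  exact: cst_continuous.
elim: k c => [|k IHk] c; split=> // i.
split=> [x _|]; first exact: derivable_cst.
rewrite (_ : (fun x => _) = cst 0); first exact: IHk.
by apply/funext => x; rewrite derive_cst.
Qed.

Lemma Ck_onD k U f g : open U -> Ck_on k U f -> Ck_on k U g ->
  Ck_on k U (f + g).
Proof.
move=> oU; elim: k f g => [|k IHk] f g [cf df] [cg dg].
  by split=> // x Ux; exact: cvgD (cf x Ux) (cg x Ux).
split=> [x Ux|i]; first by exact: cvgD (cf x Ux) (cg x Ux).
have [[dfi kfi] [dgi kgi]] := (df i, dg i); split=> [x Ux|].
  by apply: derivableD; [exact: dfi | exact: dgi].
apply: eq_Ck_on (IHk _ _ kfi kgi) => // x Ux.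
by rewrite deriveD //; [exact: dfi | exact: dgi].
Qed.

Lemma Ck_onM k U f g : open U -> Ck_on k U f -> Ck_on k U g ->
  Ck_on k U (f * g).
Proof.
move=> oU; elim: k f g => [|k IHk] f g kf kg.
  by split=> // x Ux; exact: cvgM (Ck_on_cont kf Ux) (Ck_on_cont kg Ux).
split=> [x Ux|i].
  by exact: cvgM (Ck_on_cont kf Ux) (Ck_on_cont kg Ux).
have [[_ /(_ i)[dfi kfi]] [_ /(_ i)[dgi kgi]]] := (kf, kg).
split=> [x Ux|]; first by apply: derivableM; [exact: dfi | exact: dgi].
have := Ck_onD oU (IHk _ _ (Ck_onW kf) kgi) (IHk _ _ (Ck_onW kg) kfi).
apply: eq_Ck_on => // x Ux.
by rewrite deriveM //; [exact: dfi | exact: dgi].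
Qed.

End EuclideanSmooth.

Record chart (R : realType) (m : nat) (M : topologicalType) := Chart {
  chart_dom : set M;
  chart_map : M -> 'rV[R]_m;
  chart_inv : 'rV[R]_m -> M;
  chart_dom_open : open chart_dom;
  chart_im_open : open (chart_map @` chart_dom);
  chart_mapK : forall p, chart_dom p -> chart_inv (chart_map p) = p;
  chart_map_cont : forall p, chart_dom p -> {for p, continuous chart_map};
  chart_inv_cont : forall x, (chart_map @` chart_dom) x ->
    {for x, continuous chart_inv}
}.

Arguments chart_im_open {R m M} c : rename.

Record manifold (R : realType) (m : nat) := Manifold {
  mfd_space :> topologicalType;
  mfd_hausdorff : hausdorff_space mfd_space;
  mfd_countable : second_countable (T := mfd_space);
  mfd_atlas : set (chart R m mfd_space);
  mfd_cover : forall p, exists2 c, mfd_atlas c & chart_dom c p;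
  mfd_compat : forall c c', mfd_atlas c -> mfd_atlas c' ->
    forall i : 'I_m,
      smooth_on (chart_map c @` (chart_dom c `&` chart_dom c'))
                (fun x => chart_map c' (chart_inv c x) 0 i)
}.

Section SmoothFunctions.
Context {R : realType} {m : nat} (M : manifold R m).

Definition smooth (f : M -> R) : Prop := forall c, mfd_atlas c ->
  smooth_on (chart_map c @` chart_dom c) (f \o chart_inv c).

Definition smooth_pred : {pred M -> R} := fun f => `[< smooth f >].

Lemma smooth_subring_closed : subring_closed smooth_pred.
Proof.
have smN f g : smooth f -> smooth g -> smooth (f - g).
  move=> sf sg c Mc k; have oc := chart_im_open c.
  have := Ck_onD oc (sf c Mc k) (Ck_onM oc (Ck_on_cst k _ (-1)) (sg c Mc k)).
  by apply: eq_Ck_on => // x _; rewrite /= !fctE mulN1r.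
split=> [|f g /asboolP sf /asboolP sg|f g /asboolP sf /asboolP sg].
- by apply/asboolP => c _ k; exact: Ck_on_cst.
- by apply/asboolP; exact: smN.
- apply/asboolP => c Mc k.
  exact: (Ck_onM (chart_im_open c) (sf c Mc k) (sg c Mc k)).
Qed.

HB.instance Definition _ :=
  GRing.isSubringClosed.Build (M -> R) smooth_pred smooth_subring_closed.

Lemma smooth_scaler_closed : scaler_closed smooth_pred.
Proof.
move=> a f /asboolP sf; apply/asboolP => c Mc k.
exact: (Ck_onM (chart_im_open c) (Ck_on_cst k _ a) (sf c Mc k)).
Qed.

HB.instance Definition _ :=
  GRing.isScaleClosed.Build R (M -> R) smooth_pred smooth_scaler_closed.

Record Cinf := MkCinf { Cinf_val :> M -> R; _ : Cinf_val \in smooth_pred }.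

HB.instance Definition _ := [isSub for Cinf_val].
HB.instance Definition _ := [Choice of Cinf by <:].
HB.instance Definition _ := GRing.SubChoice_isSubComPzRing.Build
  (M -> R) smooth_pred Cinf smooth_subring_closed.
HB.instance Definition _ := [SubZmodule_isSubLmodule of Cinf by <:].

Lemma Cinf_scalerAr (a : R) (f g : Cinf) : a *: (f * g) = f * (a *: g).
Proof. by apply/val_inj/funext => p; exact: mulrCA. Qed.

End SmoothFunctions.

Section VectorFields.
Context {R : realType} {m : nat} (M : manifold R m).
Notation C := (Cinf M).

Definition is_derivation (D : C -> C) : Prop :=
  (forall (a : R) (f g : C), D (a *: f + g) = a *: D f + D g) /\
  (forall f g : C, D (f * g) = f * D g + g * D f).

Definition derivation_pred : {pred C -> C} := fun D => `[< is_derivation D >].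

Lemma derivation_submod_closed : submod_closed derivation_pred.
Proof.
split=> [|a D E /asboolP[linD leibD] /asboolP[linE leibE]]; apply/asboolP.
  split=> [b f g|f g].
    by change (0 = b *: 0 + 0 :> C); rewrite scaler0 addr0.
  by change (0 = f * 0 + g * 0 :> C); rewrite !mulr0 addr0.
split=> [b f g|f g].
  change (a *: D (b *: f + g) + E (b *: f + g) =
          b *: (a *: D f + E f) + (a *: D g + E g)).
  rewrite linD linE !scalerDr !scalerA [b * a]mulrC -!addrA; congr (_ + _).
  exact: addrCA.
change (a *: D (f * g) + E (f * g) =
        f * (a *: D g + E g) + g * (a *: D f + E f)).
rewrite leibD leibE scalerDr !Cinf_scalerAr !mulrDr -!addrA; congr (_ + _).
exact: addrCA.
Qed.

HB.instance Definition _ := GRing.isSubmodClosed.Build R (C -> C)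
  derivation_pred derivation_submod_closed.

Record vfield := MkVfield {
  vfield_val :> C -> C; _ : vfield_val \in derivation_pred }.

HB.instance Definition _ := [isSub for vfield_val].
HB.instance Definition _ := [Choice of vfield by <:].
HB.instance Definition _ := [SubChoice_isSubLmodule of vfield by <:].

Implicit Types (X Y Z : vfield) (f g : C).

Lemma vfieldP X Y : X =1 Y -> X = Y.
Proof. by move=> XY; apply/val_inj/funext. Qed.

Lemma vfield_is_derivation X : is_derivation X.
Proof. by case: X => D /= /asboolP. Qed.

Lemma vfieldD X f g : X (f + g) = X f + X g.
Proof.
have [lin _] := vfield_is_derivation X.
by have := lin 1 f g; rewrite !scale1r.
Qed.

Lemma vfieldZ X a f : X (a *: f) = a *: X f.
Proof.
have [lin _] := vfield_is_derivation X.
have X0 : X 0 = 0 by apply: (addIr (X 0)); rewrite -vfieldD !add0r.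
by have := lin a f 0; rewrite !addr0 X0 addr0.
Qed.

Lemma vfieldM X f g : X (f * g) = f * X g + g * X f.
Proof. by have [_] := vfield_is_derivation X; apply. Qed.

Lemma vfieldN X f : X (- f) = - X f.
Proof. by rewrite -scaleN1r vfieldZ scaleN1r. Qed.

Lemma vfield0 X : X 0 = 0.
Proof. by have := vfieldZ X 0 0; rewrite !scale0r. Qed.

Lemma vfield_addE X Y f : (X + Y) f = X f + Y f. Proof. by []. Qed.
Lemma vfield_oppE X f : (- X) f = - X f. Proof. by []. Qed.
Lemma vfield_scaleE a X f : (a *: X) f = a *: X f. Proof. by []. Qed.
Lemma vfield_zeroE f : (0 : vfield) f = 0. Proof. by []. Qed.

Lemma fmul_subproof f X : (fun g => f * X g) \in derivation_pred.
Proof.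
apply/asboolP; split=> [a g h|g h].
  by rewrite vfieldD vfieldZ mulrDr Cinf_scalerAr.
by rewrite vfieldM mulrDr !(mulrCA f).
Qed.

Definition fmul f X : vfield := MkVfield (fmul_subproof f X).

Lemma lie_subproof X Y : (fun f => X (Y f) - Y (X f)) \in derivation_pred.
Proof.
apply/asboolP; split=> [a f g|f g].
  by rewrite !vfieldD !vfieldZ opprD addrACA scalerBr.
rewrite !vfieldM !vfieldD !vfieldM; set a := X (Y g); set b := Y (X g).
set c := X (Y f); set d := Y (X f).
by ring.
Qed.

Definition lie X Y : vfield := MkVfield (lie_subproof X Y).

Lemma lie_anti X Y : lie Y X = - lie X Y.
Proof. by apply: vfieldP => f; exact/esym/opprB. Qed.

Lemma liexx X : lie X X = 0.
Proof. by apply: vfieldP => f; exact: subrr. Qed.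

Lemma lie_fmul X Y Z f :
  lie X (fmul f Y + Z) = fmul (X f) Y + (fmul f (lie X Y) + lie X Z).
Proof.
apply: vfieldP => g.
change (X (f * Y g + Z g) - (f * Y (X g) + Z (X g)) =
        X f * Y g + (f * (X (Y g) - Y (X g)) + (X (Z g) - Z (X g)))).
by rewrite vfieldD vfieldM; ring.
Qed.

Lemma fmulN1 X : fmul (-1) X = - X.
Proof. by apply: vfieldP => f; exact: mulN1r. Qed.

Lemma fmul1 X : fmul 1 X = X.
Proof. by apply: vfieldP => f; exact: mul1r. Qed.

End VectorFields.

Section Forms.
Context {R : realType} {m : nat} (M : manifold R m).
Notation C := (Cinf M).
Notation V := (vfield M).
Implicit Types (f g : C) (X Y Z : V) (s t u : seq V) (w v : seq V -> C).

(* A differential form of mixed degree is evaluated on lists of vector fields: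
   its component of degree [k] is its restriction to the lists of length [k],
   a [Cinf M]-multilinear alternating function of [k] vector fields. *)
Definition is_form w : Prop :=
  (forall s t f X Y, w (s ++ (fmul f X + Y) :: t) =
     f * w (s ++ X :: t) + w (s ++ Y :: t)) /\
  (forall s t u X, w (s ++ X :: t ++ X :: u) = 0).

Definition form_pred : {pred seq V -> C} := fun w => `[< is_form w >].

Lemma form_submod_closed : submod_closed form_pred.
Proof.
split=> [|a w v /asboolP[wl wa] /asboolP[vl va]]; apply/asboolP.
  split=> [s t f X Y|s t u X //].
  by change (0 = f * 0 + 0 :> C); rewrite mulr0 addr0.
split=> [s t f X Y|s t u X].
  change (a *: w (s ++ (fmul f X + Y) :: t) + v (s ++ (fmul f X + Y) :: t) =
    f * (a *: w (s ++ X :: t) + v (s ++ X :: t)) +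
    (a *: w (s ++ Y :: t) + v (s ++ Y :: t))).
  by rewrite wl vl scalerDr Cinf_scalerAr mulrDr addrACA.
change (a *: w (s ++ X :: t ++ X :: u) + v (s ++ X :: t ++ X :: u) = 0).
by rewrite wa va scaler0 addr0.
Qed.

HB.instance Definition _ := GRing.isSubmodClosed.Build R (seq V -> C)
  form_pred form_submod_closed.

Record form := MkForm {
  form_val :> seq V -> C; _ : form_val \in form_pred }.

HB.instance Definition _ := [isSub for form_val].
HB.instance Definition _ := [Choice of form by <:].
HB.instance Definition _ := [SubChoice_isSubLmodule of form by <:].

(* [has_degree k w]: [w] belongs to Omega^k(M), which is 0 for negative [k]. *)
Definition has_degree (k : int) w : Prop :=
  forall s, (size s)%:Z != k -> w s = 0.

Definition omit (i : nat) s := take i s ++ drop i.+1 s.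

Definition iota_fun X w s : C := w (X :: s).

Definition lieD_fun X w s : C :=
  X (w s) - \sum_(i < size s) w (take i s ++ lie X s`_i :: drop i.+1 s).

(* Koszul's formula; as [i < j], [omit i (omit j s)] omits the entries [i] and
   [j] of [s]. *)
Definition extd_fun w s : C :=
  \sum_(i < size s) (-1) ^+ i * s`_i (w (omit i s)) +
  \sum_(j < size s) \sum_(i < j)
    (-1) ^+ (i + j) * w (lie s`_i s`_j :: omit i (omit j s)).

Lemma formP (w : form) : is_form w.
Proof. by case: w => w /= /asboolP. Qed.

Lemma form_in w : is_form w -> w \in form_pred.
Proof. by move=> fw; apply/asboolP. Qed.

Section FormTheory.
Variable w : seq V -> C.
Hypothesis fw : is_form w.

Lemma form_add s t X Y :
  w (s ++ (X + Y) :: t) = w (s ++ X :: t) + w (s ++ Y :: t).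
Proof. by rewrite -{1}(fmul1 X) fw.1 mul1r. Qed.

Lemma form_fmul0 s t : w (s ++ 0 :: t) = 0.
Proof.
by apply: (addIr (w (s ++ 0 :: t))); rewrite -form_add !add0r.
Qed.

Lemma form_opp s t X : w (s ++ (- X) :: t) = - w (s ++ X :: t).
Proof.
by apply: (addrI (w (s ++ X :: t))); rewrite -form_add !subrr form_fmul0.
Qed.

Lemma form_swap s t u X Y :
  w (s ++ X :: t ++ Y :: u) = - w (s ++ Y :: t ++ X :: u).
Proof.
apply/eqP; rewrite -addr_eq0; apply/eqP.
have := fw.2 s t u (X + Y).
rewrite form_add -!cat_cons !catA !form_add -!catA !cat_cons !fw.2.
by rewrite add0r addr0.
Qed.

Lemma form_iota X : is_form (iota_fun X w).
Proof.
by split=> [s t f Y Z|s t u Y];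
  [exact: (fw.1 (X :: s)) | exact: (fw.2 (X :: s))].
Qed.

Lemma iota_iota X s : iota_fun X (iota_fun X w) s = 0.
Proof. exact: (fw.2 [::] [::]). Qed.

End FormTheory.

Lemma form_front w X s t : is_form w ->
  w (s ++ X :: t) = (-1) ^+ size s * w (X :: s ++ t).
Proof.
elim: s w => [|Z s IHs] w fw /=; first by rewrite mul1r.
have -> : w (Z :: s ++ X :: t) = iota_fun Z w (s ++ X :: t) by [].
rewrite IHs; last exact: form_iota.
rewrite exprS mulN1r mulNr -mulrN; congr (_ * _).
exact: (form_swap fw [::] [::]).
Qed.

Lemma eq_lieD w v X : w =1 v -> lieD_fun X w =1 lieD_fun X v.
Proof.
by move=> wv s; rewrite /lieD_fun wv; under eq_bigr do rewrite wv.
Qed.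

Lemma eq_extd w v : w =1 v -> extd_fun w =1 extd_fun v.
Proof.
move=> wv s; rewrite /extd_fun; congr (_ + _); apply: eq_bigr => i _.
  by rewrite wv.
by apply: eq_bigr => j _; rewrite wv.
Qed.

Lemma lieD_fun0 X s : lieD_fun X (fun=> 0) s = 0.
Proof. by rewrite /lieD_fun vfield0 big1 ?subr0. Qed.

Lemma extd_fun0 s : extd_fun (fun=> 0) s = 0.
Proof.
rewrite /extd_fun big1 => [|i _]; last by rewrite vfield0 mulr0.
by rewrite add0r big1 // => j _; rewrite big1 // => i _; rewrite mulr0.
Qed.

Lemma lieD_fun_cons X w Y s :
  lieD_fun X w (Y :: s) = lieD_fun X (iota_fun Y w) s - w (lie X Y :: s).
Proof.
rewrite /lieD_fun /= big_ord_recl /= drop0 opprD addrA addrAC.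
by rewrite /iota_fun.
Qed.

Lemma lieD_fun_lin X w v f s :
  lieD_fun X (fun s => f * w s + v s) s =
  f * lieD_fun X w s + X f * w s + lieD_fun X v s.
Proof.
rewrite /lieD_fun vfieldD vfieldM big_split /= -mulr_sumr mulrBr opprD.
set a := X (w s); set b := \sum_(i < _) _; set c := \sum_(i < _) _; ring.
Qed.

Lemma lieD_fun_alt X v t u Y : (forall t u, v (t ++ Y :: u) = 0) ->
  lieD_fun X v (t ++ Y :: u) = - v (t ++ lie X Y :: u).
Proof.
elim: t v => [|Z t IHt] v vY /=.
  rewrite lieD_fun_cons (@eq_lieD _ (fun=> 0)).
    by rewrite lieD_fun0 sub0r.
  by move=> s; exact: (vY [::]).
rewrite lieD_fun_cons IHt; last by move=> t' u'; exact: (vY (Z :: t')).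
by have := vY (lie X Z :: t) u; rewrite /= => ->; rewrite subr0.
Qed.

Lemma lieD_form X w : is_form w -> is_form (lieD_fun X w).
Proof.
move=> fw; split.
  move=> s; elim: s w fw => [|Z s IHs] w fw t f Y Y' /=.
    rewrite !lieD_fun_cons.
    rewrite (@eq_lieD _ (fun s => f * iota_fun Y w s + iota_fun Y' w s)).
      have lin0 f' Z Z' :
          w (fmul f' Z + Z' :: t) = f' * w (Z :: t) + w (Z' :: t).
        exact: (fw.1 [::]).
      by rewrite lieD_fun_lin lie_fmul !lin0 /iota_fun; ring.
    by move=> s; exact: (fw.1 [::]).
  rewrite !lieD_fun_cons (IHs _ (form_iota fw Z)) (fw.1 (_ :: s)) /=; ring.
move=> s; elim: s w fw => [|Z s IHs] w fw t u Y /=.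
  rewrite lieD_fun_cons lieD_fun_alt; last by move=> t' u'; exact: (fw.2 [::]).
  by rewrite /iota_fun -(form_swap fw [::]) subrr.
rewrite lieD_fun_cons (IHs _ (form_iota fw Z)) sub0r.
by rewrite (fw.2 (lie X Z :: s)) oppr0.
Qed.

Lemma extd_funD w v s :
  extd_fun (fun s => w s + v s) s = extd_fun w s + extd_fun v s.
Proof.
rewrite /extd_fun addrACA; congr (_ + _); rewrite -big_split;
  apply: eq_bigr => i _; first by rewrite vfieldD mulrDr.
by rewrite -big_split; apply: eq_bigr => j _; exact: mulrDr.
Qed.

Lemma omit_cons Z s i : omit i.+1 (Z :: s) = Z :: omit i s.
Proof. by []. Qed.

Lemma omit0 Z s : omit 0 (Z :: s) = s.
Proof. exact: drop0. Qed.

(* Cartan's formula [L_X w = iota_X (d w) + d (iota_X w)]. *)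
Lemma cartan_fun w X s : is_form w ->
  extd_fun w (X :: s) = lieD_fun X w s - extd_fun (iota_fun X w) s.
Proof.
move=> fw; rewrite /extd_fun /lieD_fun /= !big_ord_recl big_ord0 add0r.
rewrite expr0 mul1r omit0 /= -!addrA; congr (_ + _).
have E1 : \sum_(i < size s) (-1) ^+ i.+1 * s`_i (w (omit i.+1 (X :: s))) =
    - \sum_(i < size s) (-1) ^+ i * s`_i (iota_fun X w (omit i s)).
  rewrite -sumrN; apply: eq_bigr => i _.
  by rewrite exprS mulN1r mulNr omit_cons.
have E2 : \sum_(j < size s) \sum_(i < j.+1) (-1) ^+ (i + j.+1) *
      w (lie (X :: s)`_i s`_j :: omit i (omit j.+1 (X :: s))) =
    - \sum_(i < size s) w (take i s ++ lie X s`_i :: drop i.+1 s) -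
    \sum_(j < size s) \sum_(i < j)
      (-1) ^+ (i + j) * iota_fun X w (lie s`_i s`_j :: omit i (omit j s)).
  rewrite -!sumrN -big_split; apply: eq_bigr => j _.
  rewrite big_ord_recl add0n !omit_cons omit0 -sumrN; apply: congr2.
    rewrite (form_front _ _ _ fw) size_takel ?(ltnW (ltn_ord j)) //.
    by rewrite exprS mulN1r mulNr.
  apply: eq_bigr => i _; rewrite lift0 /=.
  rewrite addSn addnS 2!exprS !mulN1r opprK omit_cons -mulrN.
  by congr (_ * _); exact: (form_swap fw [::] [::]).
apply: etrans (congr2 +%R E1 E2) _.
by rewrite opprD; exact: addrCA.
Qed.

Lemma extd_swap w X Y s : is_form w ->
  extd_fun w (X :: Y :: s) = - extd_fun w (Y :: X :: s).
Proof.
move=> fw.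
have E X' Y' : extd_fun w (X' :: Y' :: s) =
    lieD_fun X' (iota_fun Y' w) s - w (lie X' Y' :: s) -
    (lieD_fun Y' (iota_fun X' w) s - extd_fun (iota_fun Y' (iota_fun X' w)) s).
  rewrite (cartan_fun _ _ fw) lieD_fun_cons.
  by rewrite (cartan_fun _ _ (form_iota fw X')).
rewrite !E lie_anti (form_opp fw [::]) /=.
have -> : extd_fun (iota_fun Y (iota_fun X w)) s =
          - extd_fun (iota_fun X (iota_fun Y w)) s.
  apply/eqP; rewrite -addr_eq0; apply/eqP.
  rewrite -extd_funD (eq_extd (v := fun=> 0)) ?extd_fun0 // => u.
  by rewrite /iota_fun (form_swap fw [::] [::]) addNr.
ring.
Qed.

Lemma extd_form w : is_form w -> is_form (extd_fun w).
Proof.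
move=> fw; split.
  suff: forall s t f Y Y' v, is_form v ->
      extd_fun v (s ++ (fmul f Y + Y') :: t) =
      f * extd_fun v (s ++ Y :: t) + extd_fun v (s ++ Y' :: t).
    by move=> lin s t f Y Y'; exact: lin.
  have cons_lin X s t f Y Y' :
      (forall v, is_form v -> extd_fun v (s ++ (fmul f Y + Y') :: t) =
        f * extd_fun v (s ++ Y :: t) + extd_fun v (s ++ Y' :: t)) ->
      forall v, is_form v -> extd_fun v (X :: s ++ (fmul f Y + Y') :: t) =
        f * extd_fun v (X :: s ++ Y :: t) + extd_fun v (X :: s ++ Y' :: t).
    move=> IHs v fv; rewrite !(cartan_fun _ _ fv) IHs; last exact: form_iota.
    rewrite (lieD_form X fv).1; ring.
  have nil_lin t f Y Y' v : is_form v -> extd_fun v ((fmul f Y + Y') :: t) =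
      f * extd_fun v (Y :: t) + extd_fun v (Y' :: t).
    elim: t v => [|Z t IHt] v fv.
      have E Z : extd_fun v [:: Z] = Z (v [::]).
        rewrite /extd_fun /= !big_ord_recl !big_ord0 /= omit0.
        by rewrite expr0 mul1r !addr0.
      by rewrite !E.
    rewrite !(extd_swap _ Z _ fv) (cons_lin Z [::] t f Y Y' IHt v fv) /=.
    by rewrite opprD mulrN.
  by elim=> [|X s IHs] t f Y Y'; [exact: nil_lin|exact: cons_lin (IHs _ _ _ _)].
have cons_alt X s t u Y :
    (forall v, is_form v -> extd_fun v (s ++ Y :: t ++ Y :: u) = 0) ->
    forall v, is_form v -> extd_fun v (X :: s ++ Y :: t ++ Y :: u) = 0.
  move=> IHs v fv; rewrite (cartan_fun _ _ fv) IHs; last exact: form_iota.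
  by rewrite (lieD_form X fv).2 subr0.
suff: forall s t u Y v, is_form v -> extd_fun v (s ++ Y :: t ++ Y :: u) = 0.
  by move=> alt s t u Y; exact: alt.
elim=> [|X s IHs] t u Y; last exact: cons_alt (IHs _ _ _).
elim: t => [|Z t IHt] v fv /=.
  rewrite (cartan_fun _ _ fv) lieD_fun_cons (cartan_fun _ _ (form_iota fv Y)).
  rewrite liexx (form_fmul0 fv [::]) subr0.
  rewrite (eq_extd (v := fun=> 0)) ?extd_fun0 ?subr0 ?subrr //.
  exact: iota_iota.
by rewrite (extd_swap _ _ _ fv) (cons_alt Z [::] _ _ _ IHt) ?oppr0.
Qed.

End Forms.

Section CartanOperations.
Context {R : realType} {m : nat} {M : manifold R m}.
Implicit Types (X : vfield M) (w : form M) (e : vfield M * form M).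

Definition contract X w : form M := MkForm (form_in (form_iota (formP w) X)).

Definition lieD X w : form M := MkForm (form_in (lieD_form X (formP w))).

Definition extd w : form M := MkForm (form_in (extd_form (formP w))).

Definition pairing e1 e2 : form M := contract e1.1 e2.2 + contract e2.1 e1.2.

Definition courant e1 e2 : vfield M * form M :=
  (lie e1.1 e2.1,
   lieD e1.1 e2.2 - lieD e2.1 e1.2
   - 2^-1 *: extd (contract e1.1 e2.2 - contract e2.1 e1.2)).

End CartanOperations.

Section LInfinity.
Context {K : fieldType}.
Variable V : int -> lmodType K.

(* Homogeneous elements; [tag x] is the degree of [x]. *)
Definition homog := {i : int & V i}.

Definition permuted (s : seq homog) (sigma : 'S_(size s)) : seq homog :=
  [seq tnth (in_tuple s) (sigma k) | k <- enum 'I_(size s)].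

Definition shuffle n (i : nat) (sigma : 'S_n) : bool :=
  [forall a : 'I_n, forall b : 'I_n,
    ((a < b) && ((b < i) || (i <= a)))%N ==> (sigma a < sigma b)%N].

(* Sign of [sigma] times its Koszul sign on the entries of [s]: every
   inversion of [sigma] exchanges two entries. *)
Definition antisym_sign (s : seq homog) (sigma : 'S_(size s)) : K :=
  (-1) ^+ sigma *
  \prod_(a < size s) \prod_(b < size s | ((a < b) && (sigma b < sigma a))%N)
    (-1) ^ (tag (tnth (in_tuple s) (sigma a)) *
            tag (tnth (in_tuple s) (sigma b))).

Definition bracket_degree (s : seq homog) : int :=
  \sum_(x <- s) tag x + 2 - (size s)%:Z.

(* [lbr s e] is the component of degree [e] of [l_n(s)], [n = size s]. Only the
   component of degree [bracket_degree s] can be nonzero, and there is no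
   bracket with [n = 0] entries. *)
Record Linfty_algebra := LinftyAlgebra {
  lbr : seq homog -> forall e : int, V e;
  lbr_nil : forall e, lbr [::] e = 0;
  lbr_degree : forall s e, e != bracket_degree s -> lbr s e = 0;
  lbr_linear : forall (s t : seq homog) (i : int) (a : K) (x y : V i) (e : int),
    lbr (s ++ Tagged V (a *: x + y) :: t) e =
    a *: lbr (s ++ Tagged V x :: t) e + lbr (s ++ Tagged V y :: t) e;
  lbr_skew : forall (s t : seq homog) (x y : homog) (e : int),
    lbr (s ++ x :: y :: t) e =
    (- (-1) ^ (tag x * tag y)) *: lbr (s ++ y :: x :: t) e;
  lbr_jacobi : forall (s : seq homog) (e : int), (0 < size s)%N ->
    \sum_(1 <= i < (size s).+1) \sum_(sigma : 'S_(size s) | shuffle i sigma)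
      (let j := ((size s).+1 - i)%N in
       let u := take i (permuted sigma) in
       (antisym_sign sigma * (-1) ^+ (i * (j - 1))) *:
         lbr (Tagged V (lbr u (bracket_degree u)) :: drop i (permuted sigma)) e)
    = 0
}.

Record Lie_algebra (r : nat) := LieAlgebra {
  Lie_Linfty :> Linfty_algebra;
  Lie_concentrated : forall (i : int) (x : V i),
    ~~ (1 - r%:Z <= i <= 0) -> x = 0
}.

End LInfinity.

Section Complex.
Context {R : realType} {m : nat} (M : manifold R m) (r : nat).

(* All components are realized inside the pairs of a vector field and a mixed
   form; [xi] in Omega^k(M), [k <= r - 2], is represented by [(0, xi)]. *)
Definition in_component (i : int) (e : vfield M * form M) : Prop :=
  if i == 0 then has_degree (r%:Z - 1) e.2
  else if i < 0 then e.1 = 0 /\ has_degree (r%:Z - 1 + i) e.2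
  else e = 0.

Definition component_pred (i : int) : {pred vfield M * form M} :=
  fun e => `[< in_component i e >].

Lemma component_submod_closed i : submod_closed (component_pred i).
Proof.
have hd0 k : has_degree k (0 : form M) by [].
have hdl k a (v w : form M) :
    has_degree k v -> has_degree k w -> has_degree k (a *: v + w).
  move=> hv hw s sk; change (a *: v s + w s = 0).
  by rewrite hv // hw // scaler0 addr0.
split=> [|a [X v] [Y w] /asboolP ev /asboolP ew]; apply/asboolP.
  by rewrite /in_component; case: eqP => // _; case: ifP.
move: ev ew; rewrite /in_component /=; case: eqP => _; first exact: hdl.
case: ifP => _ /=.
  by move=> [-> hv] [-> hw]; split; [rewrite scaler0 addr0|exact: hdl].
by move=> -> ->; rewrite scaler0 addr0.
Qed.

HB.instance Definition _ i := GRing.isSubmodClosed.Build R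
  (vfield M * form M)%type (component_pred i) (component_submod_closed i).

Record component (i : int) := MkComponent {
  component_val :> vfield M * form M;
  _ : component_val \in component_pred i }.

HB.instance Definition _ i := [isSub for @component_val i].
HB.instance Definition _ i := [Choice of component i by <:].
HB.instance Definition _ i := [SubChoice_isSubLmodule of component i by <:].

Definition courant_complex (i : int) : lmodType R := component i.

Definition elt (i : int) (x : component i) : homog courant_complex :=
  Tagged courant_complex x.

Definition bracket (L : Lie_algebra courant_complex r)
    (s : seq (homog courant_complex)) (e : int) : vfield M * form M :=
  component_val (lbr L s e).

Lemma vec_part_subproof (e : component 0) : (e.1, 0) \in component_pred 0.
Proof. exact/asboolP. Qed.

Lemma form_part_subproof (e : component 0) : (0, e.2) \in component_pred 0.
Proof. by case: e => e /= /asboolP he; apply/asboolP. Qed.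

Definition vec_part (e : component 0) : component 0 :=
  MkComponent (vec_part_subproof e).

Definition form_part (e : component 0) : component 0 :=
  MkComponent (form_part_subproof e).

End Complex.

Arguments elt {R m M r i} x.

Section Bernoulli.
Context (K : fieldType).

Fixpoint bernoulli_seq (n : nat) : seq K :=
  if n is n'.+1 then
    let s := bernoulli_seq n' in
    rcons s (- (\sum_(k < n) 'C(n.+1, k)%:R * s`_k) / n.+1%:R)
  else [:: 1].

Definition bernoulli (n : nat) : K := (bernoulli_seq n)`_n.

End Bernoulli.

Section NaryBracket.
Context {R : realType} {m : nat} {M : manifold R m}.

(* [iota_(X (n-1)) ... iota_(X 1) w] with the factors [i] and [j] omitted;
   [iota_(X 1)] is applied first. *)
Definition contract_omit (n i j : nat) (X : nat -> vfield M) (w : form M) :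
    form M :=
  foldl (fun w k => contract (X k) w) w
    [seq k <- index_iota 1 n | (k != i) && (k != j)].

Definition nary_coef (n : nat) : R :=
  (-1) ^+ (n.+1)./2 * 12 * bernoulli R n.-1 / (n.-1 * n.-2)%:R.

(* [tri i j] is the trinary bracket of the form with [X i] and [X j]. *)
Definition nary_bracket (n : nat) (X : nat -> vfield M)
    (tri : nat -> nat -> form M) : form M :=
  nary_coef n *: \sum_(1 <= j < n) \sum_(1 <= i < j)
    (-1) ^+ (i + j + 1) *: contract_omit n i j X (tri i j).

End NaryBracket.

(* The shapes of the lists of homogeneous entries, up to permutation, on which
   a bracket of the Lie r-algebra may be nonzero. *)
Definition allowed_entries (K : fieldType) (V : int -> lmodType K)
    (s : seq (homog V)) : bool :=
  let k := count (fun x => tag x != 0) s in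
  [|| (size s == 1) && (k == 1), (size s == 2) && (k <= 1)
    | [&& odd (size s), 3 <= size s & k <= 1]]%N.

(* Main.v *)
From HB Require Import structures.
From mathcomp Require Import all_boot all_order all_fingroup all_algebra.
From mathcomp Require Import all_classical reals topology normedtype derive.
From mathcomp Require Import ring zify.
Require Import Defs.

(** Apart from the Lie bracket of the Lie algebra V of vector fields, every
    bracket is a sum of terms in which one entry enters through its form and all
    others through their vector fields.  Such brackets are the action of V on a
    module up to homotopy, here the forms of degree less than r, and they are
    encoded by one alternating cochain Phi on V with values in linear
    endomorphisms of forms,
      l_n (w, X_1, ..., X_(n-1)) = Phi (X_1, ..., X_(n-1)) w,
    and the L-infinity identities become the Jacobi identity of V and the
    Maurer-Cartan equation
      twist Phi * Phi + ce Phi = 0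
    for the signed shuffle product of cochains, the Chevalley-Eilenberg
    differential ce and the parity automorphism twist ([sbr_jacobi]).  If two
    entries have nonzero degree, neither has a vector component and every term
    vanishes ([sbr_sbr_zero]), so that Koszul signs never contribute
    ([antisym_sign_le1]); the sums over unshuffles are sums over decompositions
    of a list ([sum_shuffles]).

    Vector fields act strictly on the truncated de Rham complex by Lie
    derivatives L.  Write P for the projection to degrees less than r.  By
    Cartan calculus the cochain [strict], P d - L, solves the Maurer-Cartan
    equation.  It is the gauge transform of this solution by an invertible
    cochain that gives the Courant bracket.  The invertible cochain is a power
    series f (iota) in the interior product, iota being an odd operator-valued
    1-cochain, and the Bernoulli numbers enter through
      f (x) = (e^x - 1) / x,   h (x) = 1 / f (x) = sum of B_n x^n / n!.
    A gauge transform solves the equation again ([gauge_maurer_cartan]); the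
    transform is Phi = twist (h (iota)) ((P d - L) f (iota) - ce (f (iota))).

    To read off the brackets, the operators are moved to the right of the
    series.  With kappa (X, Y) = iota_[X,Y], and up to signs recorded by twist,
    Cartan calculus yields
      d f (iota) = f (iota) d + f' (iota) L + f'' (iota) kappa,
      L f (iota) = f (iota) L + 2 f' (iota) kappa,
      ce (f (iota)) = - f' (iota) kappa
    ([d_ser], [L_ser], [ce_ser]), while (1 - P) d f (iota) P = (1 - P) d P,
    since interior products lower the degree ([top_ser]).  The
    coefficients are computed from x f' + f = x f + 1, which gives
    h f' = 1 + (h - 1) / x and h (f'' - f') = (1 - 2 h f') / x, and from
    h (- x) = h (x) + x.  On forms of degree less than r the result is
      Phi = P d - L / 2 - iota (1 - P) d / 2 + b (iota) T,
      T = - (iota L / 2 + kappa + iota iota (1 - P) d / 2) / 6,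
      b_n = 12 B_(n+2) / ((n+2) (n+1))
    ([gauged_bracketE]).  The first terms are the differential, the half Lie
    derivative and the Courant bracket, T is the trinary bracket, and the
    series b (iota) expresses every longer bracket through T by the asserted
    formula ([courant_nary]); the vanishing of B_n for odd n > 1 removes the
    brackets of even arity greater than 2. *)

Set Implicit Arguments.
Unset Strict Implicit.
Unset Printing Implicit Defensive.

Import Order.TTheory GRing.Theory Num.Theory numFieldNormedType.Exports.
Local Open Scope ring_scope.

(** * Linear identities in abelian groups *)

Section TrivialExtension.
Variable A : zmodType.

(** The square-zero extension of the integers by [A]: it embeds the abelian
    group in a commutative ring, where [ring] decides linear identities. *)
Definition triv_ext := (int * A)%type.
HB.instance Definition _ := GRing.Zmodule.on triv_ext.

Definition triv_mul (x y : triv_ext) : triv_ext :=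
  (x.1 * y.1, y.2 *~ x.1 + x.2 *~ y.1).

Lemma triv_mulC : commutative triv_mul.
Proof. by move=> x y; rewrite /triv_mul mulrC addrC. Qed.
Lemma triv_mul1 : left_id ((1, 0) : triv_ext) triv_mul.
Proof. by case=> m a; rewrite /triv_mul /= mul1r mul0rz addr0. Qed.
Lemma triv_mulDl : left_distributive triv_mul +%R.
Proof.
case=> m a [n b] [p c]; rewrite /triv_mul /=; congr pair; first exact: mulrDl.
by rewrite mulrzDr mulrzDl addrACA.
Qed.
Lemma triv_mulA : associative triv_mul.
Proof.
case=> m a [n b] [p c]; rewrite /triv_mul /=; congr pair; first exact: mulrA.
by rewrite !mulrzDl -!mulrzA addrA (mulrC n m) (mulrC p m).
Qed.

HB.instance Definition _ := GRing.Zmodule_isComPzRing.Build triv_ext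
  triv_mulA triv_mulC triv_mul1 triv_mulDl.

Definition triv (a : A) : triv_ext := (0, a).
Lemma triv_inj : injective triv. Proof. by move=> a b []. Qed.
Lemma trivD a b : triv (a + b) = triv a + triv b. Proof. by []. Qed.
Lemma trivN a : triv (- a) = - triv a. Proof. by []. Qed.
Lemma triv0 : triv 0 = 0. Proof. by []. Qed.
End TrivialExtension.

Ltac abel := apply: triv_inj; rewrite ?(trivD, trivN, triv0); ring.

Lemma half_sum (K : numFieldType) (U : lmodType K) (u : U) :
  2^-1 *: u + 2^-1 *: u = u.
Proof.
by rewrite -scalerDl -mulr2n -[X in X *: _]mulr_natr mulVf ?pnatr_eq0 // scale1r.
Qed.

(** * Cochains with values in linear endomorphisms *)

Section LinearEndomorphisms.
Context {K : comPzRingType} (U : lmodType K).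

Definition lend_pred : {pred U -> U} := fun f => `[< linear f >].

Lemma lend_submod_closed : submod_closed lend_pred.
Proof.
split=> [|a f g /asboolP lf /asboolP lg]; apply/asboolP => b u v.
  by change (0 = b *: 0 + 0 :> U); rewrite scaler0 addr0.
change (a *: f (b *: u + v) + g (b *: u + v) =
        b *: (a *: f u + g u) + (a *: f v + g v)).
by rewrite lf lg !scalerDr !scalerA (mulrC b) addrACA.
Qed.

HB.instance Definition _ := GRing.isSubmodClosed.Build K (U -> U)
  lend_pred lend_submod_closed.

(** Linear endomorphisms form a ring under composition only as a subtype of
    functions; this is the coefficient ring of the cochains. *)
Record lend := MkLend { lend_val :> U -> U; _ : lend_val \in lend_pred }.

HB.instance Definition _ := [isSub for lend_val].
HB.instance Definition _ := [Choice of lend by <:].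
HB.instance Definition _ := [SubChoice_isSubLmodule of lend by <:].

Lemma lend_linear (f : lend) : linear f.
Proof. by case: f => f /= /asboolP. Qed.

HB.instance Definition _ (f : lend) :=
  GRing.isLinear.Build K U U *:%R (lend_val f) (lend_linear f).

Definition mk_lend (f : U -> U) (lf : linear f) : lend :=
  MkLend (introT (asboolP _) lf).

Lemma lendP (f g : lend) : f =1 g -> f = g.
Proof. by move=> fg; apply/val_inj/funext. Qed.

Lemma lend_one_linear : linear (fun u : U => u). Proof. by []. Qed.
Definition lend_one := mk_lend lend_one_linear.

Lemma lend_comp_linear (f g : lend) : linear (fun u => f (g u)).
Proof. by move=> a u v /=; rewrite !linearP. Qed.
Definition lend_mul f g := mk_lend (lend_comp_linear f g).

Lemma lend_mulA : associative lend_mul. Proof. by move=> f g h; apply: lendP. Qed.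
Lemma lend_mul1l : left_id lend_one lend_mul.
Proof. by move=> f; apply: lendP. Qed.
Lemma lend_mul1r : right_id lend_one lend_mul.
Proof. by move=> f; apply: lendP. Qed.
Lemma lend_mulDl : left_distributive lend_mul +%R.
Proof. by move=> f g h; apply: lendP. Qed.
Lemma lend_mulDr : right_distributive lend_mul +%R.
Proof.
by move=> f g h; apply: lendP => u; exact: (linearD f).
Qed.

HB.instance Definition _ := GRing.Zmodule_isPzRing.Build lend
  lend_mulA lend_mul1l lend_mul1r lend_mulDl lend_mulDr.

Lemma lendM (f g : lend) u : (f * g) u = f (g u). Proof. by []. Qed.
Lemma lend1 u : (1 : lend) u = u. Proof. by []. Qed.
Lemma lend0 u : (0 : lend) u = 0. Proof. by []. Qed.
Lemma lendD (f g : lend) u : (f + g) u = f u + g u. Proof. by []. Qed.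
Lemma lendN (f : lend) u : (- f) u = - f u. Proof. by []. Qed.
Lemma lendZ a (f : lend) u : (a *: f) u = a *: f u. Proof. by []. Qed.
Lemma lend_scalerAl a (f g : lend) : a *: (f * g) = (a *: f) * g.
Proof. by apply: lendP. Qed.
Lemma lend_scalerAr a (f g : lend) : a *: (f * g) = f * (a *: g).
Proof. by apply: lendP => u; rewrite lendM !lendZ linearZ. Qed.

End LinearEndomorphisms.

Section Cochains.
Context {K : comPzRingType} (V : Type) (U : lmodType K).

(** A cochain is indexed by lists, so that it has components of all arities at
    once; multilinearity and antisymmetry are separate predicates. *)
Definition cochain := seq V -> lend U.
HB.instance Definition _ := GRing.Lmodule.on cochain.

Implicit Types (F G H : cochain) (s t : seq V) (x y z : V).

Lemma cochainP F G : F =1 G -> F = G. Proof. exact: funext. Qed.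

Lemma cochainD F G s : (F + G) s = F s + G s. Proof. by []. Qed.
Lemma cochainN F s : (- F) s = - F s. Proof. by []. Qed.
Lemma cochainZ a F s : (a *: F) s = a *: F s. Proof. by []. Qed.
Lemma cochain0 s : (0 : cochain) s = 0. Proof. by []. Qed.

(** Fixing the first argument is an odd derivation of the product below; since
    cochains are determined by their value on the empty list and by their
    shifts, most identities are proved by induction through [shift]. *)
Definition shift x F : cochain := fun s => F (x :: s).
Definition twist F : cochain := fun s => (-1) ^+ size s *: F s.

Lemma cochain_ext F G : F [::] = G [::] ->
  (forall x, shift x F = shift x G) -> F = G.
Proof.
move=> e0 eS; apply: cochainP => -[//|x s].
by rewrite -[LHS]/(shift x F s) eS.
Qed.

Lemma shiftD x F G : shift x (F + G) = shift x F + shift x G. Proof. by []. Qed.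
Lemma shiftN x F : shift x (- F) = - shift x F. Proof. by []. Qed.
Lemma shiftZ x a F : shift x (a *: F) = a *: shift x F. Proof. by []. Qed.

Lemma twist_linear : linear twist.
Proof.
move=> a F G; apply: cochainP => s.
by rewrite /twist !cochainD !cochainZ scalerDr !scalerA mulrC.
Qed.
HB.instance Definition _ :=
  GRing.isLinear.Build K cochain cochain *:%R twist twist_linear.

Lemma twistD F G : twist (F + G) = twist F + twist G. Proof. exact: linearD. Qed.
Lemma twistN F : twist (- F) = - twist F. Proof. exact: linearN. Qed.
Lemma twistZ a F : twist (a *: F) = a *: twist F. Proof. exact: linearZ. Qed.

Lemma twistK F : twist (twist F) = F.
Proof.
by apply: cochainP => s; rewrite /twist scalerA -exprD addnn -mul2n exprM
  sqrrN !expr1n scale1r.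
Qed.

Lemma shift_twist x F : shift x (twist F) = - twist (shift x F).
Proof.
by apply: cochainP => s; rewrite /shift /twist /= exprS mulN1r scaleNr.
Qed.

(** The signed shuffle product.  The first argument goes either to the left
    factor or to the right one, where it passes the arguments of the left
    factor; the sign of that passage is what [twist] records. *)
Fixpoint conv F G s : lend U :=
  if s is x :: s' then conv (shift x F) G s' + conv (twist F) (shift x G) s'
  else F [::] * G [::].

Lemma shift_conv x F G :
  shift x (conv F G) = (conv (shift x F) G + conv (twist F) (shift x G) : cochain).
Proof. by []. Qed.

Lemma conv_linearl s G a F F' :
  conv (a *: F + F') G s = a *: conv F G s + conv F' G s.
Proof.
elim: s F F' G => [|x s IHs] F F' G /=.
  by rewrite cochainD cochainZ mulrDl lend_scalerAl.
by rewrite shiftD shiftZ twistD twistZ !IHs scalerDr addrACA.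
Qed.

Lemma conv_linearr s F a G G' :
  conv F (a *: G + G') s = a *: conv F G s + conv F G' s.
Proof.
elim: s F G G' => [|x s IHs] F G G' /=.
  by rewrite cochainD cochainZ mulrDr lend_scalerAr.
by rewrite shiftD shiftZ !IHs scalerDr addrACA.
Qed.

Lemma conv_mulDl : left_distributive (conv : cochain -> cochain -> cochain) +%R.
Proof.
move=> F F' G; apply: cochainP => s.
by have := conv_linearl s G 1 F F'; rewrite !scale1r.
Qed.

Lemma conv_mulDr : right_distributive (conv : cochain -> cochain -> cochain) +%R.
Proof.
move=> F G G'; apply: cochainP => s.
by have := conv_linearr s F 1 G G'; rewrite !scale1r.
Qed.

Lemma conv0l G s : conv 0 G s = 0.
Proof. by have := conv_linearl s G (-1) 0 0; rewrite !scaleN1r !addNr. Qed.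

Lemma conv0r F s : conv F 0 s = 0.
Proof. by have := conv_linearr s F (-1) 0 0; rewrite !scaleN1r !addNr. Qed.

Lemma convZl a F G : (conv (a *: F) G : cochain) = a *: (conv F G : cochain).
Proof.
apply: cochainP => s.
by have := conv_linearl s G a F 0; rewrite conv0l !addr0.
Qed.

Lemma convZr a F G : (conv F (a *: G) : cochain) = a *: (conv F G : cochain).
Proof.
apply: cochainP => s.
by have := conv_linearr s F a G 0; rewrite conv0r !addr0.
Qed.

Lemma twist_conv F G : twist (conv F G) = conv (twist F) (twist G).
Proof.
apply: cochainP => s; elim: s F G => [|x s IHs] F G.
  by rewrite /twist /= !expr0 !scale1r.
rewrite -[LHS]/(shift x (twist (conv F G)) s) shift_twist shift_conv twistD.
rewrite cochainN cochainD !IHs /= !shift_twist -!scaleN1r.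
rewrite (convZl _ _ _ : conv (_ *: _) _ = _) (convZr _ _ _ : conv _ (_ *: _) = _).
by rewrite !scaleN1r cochainN opprD.
Qed.

Lemma conv_mulA : associative (conv : cochain -> cochain -> cochain).
Proof.
move=> F G H; apply: cochainP => s; elim: s F G H => [|x s IHs] F G H.
  by rewrite /= mulrA.
rewrite -[RHS]/(shift x (conv (conv F G) H) s) -[LHS]/(shift x (conv F (conv G H)) s).
rewrite !shift_conv conv_mulDl conv_mulDr !cochainD !IHs twist_conv addrA.
by [].
Qed.

Definition arity0 (e : lend U) : cochain := fun s => if s is [::] then e else 0.

Lemma shift_arity0 x e : shift x (arity0 e) = 0. Proof. by []. Qed.

Lemma twist_arity0 e : twist (arity0 e) = arity0 e.
Proof. by apply: cochainP => -[|x s]; rewrite /twist ?scale1r ?scaler0. Qed.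

Lemma conv_cstl e G s : conv (arity0 e) G s = e * G s.
Proof.
elim: s G => [//|x s IHs] G /=; rewrite twist_arity0 IHs shift_arity0.
by rewrite conv0l add0r.
Qed.

Lemma conv_cstr F e s : conv F (arity0 e) s = F s * e.
Proof.
elim: s F => [//|x s IHs] F /=; rewrite IHs shift_arity0.
by rewrite conv0r addr0.
Qed.

Lemma conv_mul1l : left_id (arity0 1) (conv : cochain -> cochain -> cochain).
Proof. by move=> G; apply: cochainP => s; rewrite conv_cstl mul1r. Qed.
Lemma conv_mul1r : right_id (arity0 1) (conv : cochain -> cochain -> cochain).
Proof. by move=> G; apply: cochainP => s; rewrite conv_cstr mulr1. Qed.

HB.instance Definition _ := GRing.Zmodule_isPzRing.Build cochain
  conv_mulA conv_mul1l conv_mul1r conv_mulDl conv_mulDr.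

Lemma cochainM_nil F G : (F * G) [::] = F [::] * G [::]. Proof. by []. Qed.
Lemma cochainM_cons F G x s :
  (F * G) (x :: s) = (shift x F * G) s + (twist F * shift x G) s.
Proof. by []. Qed.
Lemma shiftM x F G : shift x (F * G) = shift x F * G + twist F * shift x G.
Proof. by []. Qed.
Lemma twistM F G : twist (F * G) = twist F * twist G.
Proof. exact: twist_conv. Qed.
Lemma twist1 : twist 1 = 1. Proof. exact: twist_arity0. Qed.
Lemma cochain_scalerAl a F G : a *: (F * G) = (a *: F) * G.
Proof. by rewrite [RHS]convZl. Qed.
Lemma cochain_scalerAr a F G : a *: (F * G) = F * (a *: G).
Proof. by rewrite [RHS]convZr. Qed.
Lemma arity0M_apply e G s : (arity0 e * G) s = e * G s.
Proof. exact: conv_cstl. Qed.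
Lemma Marity0_apply F e s : (F * arity0 e) s = F s * e.
Proof. exact: conv_cstr. Qed.

Lemma arity0_linear : linear arity0.
Proof.
move=> a e e'; apply: cochainP => -[//|x s].
by rewrite cochainD cochainZ /= scaler0 addr0.
Qed.
HB.instance Definition _ :=
  GRing.isLinear.Build K (lend U) cochain *:%R arity0 arity0_linear.
Lemma arity0D e e' : arity0 (e + e') = arity0 e + arity0 e'.
Proof. exact: linearD. Qed.
Lemma arity0B e e' : arity0 (e - e') = arity0 e - arity0 e'.
Proof. exact: linearB. Qed.
Lemma arity0M e e' : arity0 (e * e') = arity0 e * arity0 e'.
Proof.
apply: cochainP => s; rewrite arity0M_apply; case: s => //= *; exact/esym/mulr0.
Qed.

Definition arity1 (p : V -> lend U) : cochain := fun s =>
  if s is [:: x] then p x else 0.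
Definition arity2 (p : V -> V -> lend U) : cochain := fun s =>
  if s is [:: x; y] then p x y else 0.

Lemma shift_arity1 x p : shift x (arity1 p) = arity0 (p x).
Proof. by apply: cochainP => -[]. Qed.
Lemma shift_arity2 x p : shift x (arity2 p) = arity1 (p x).
Proof. by apply: cochainP => -[|? []]. Qed.
Lemma twist_arity1 p : twist (arity1 p) = - arity1 p.
Proof.
apply: cochain_ext => [|x]; first by rewrite /twist cochainN oppr0 scaler0.
by rewrite shift_twist shiftN shift_arity1 twist_arity0.
Qed.

End Cochains.

(** * The Chevalley-Eilenberg differential and gauge transformations *)

Section ChevalleyEilenberg.
Context {K : comPzRingType} {V U : lmodType K} (br : V -> V -> V).
Notation C := (cochain V U).
Implicit Types (F G : C) (s t : seq V) (x y z : V).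

Fixpoint theta_fun x F s : lend U :=
  if s is y :: s' then F (br x y :: s') + theta_fun x (shift y F) s' else 0.
(** Up to sign, the Lie derivative of a cochain along [x]: [br x] is applied to
    each argument in turn. *)
Definition theta x F : C := theta_fun x F.

Fixpoint ce_fun F s : lend U :=
  if s is x :: s' then - ce_fun (shift x F) s' - theta x F s' else 0.
(** The Chevalley-Eilenberg differential for trivial action on the coefficients,
    determined recursively by Cartan's formula [shift_ce].  On a skew cochain it
    is, up to sign, the sum over pairs of arguments of the terms where the pair
    is replaced by its bracket ([ceE]). *)
Definition ce F : C := ce_fun F.

Lemma shift_theta x y F :
  shift y (theta x F) = shift (br x y) F + (theta x (shift y F)).
Proof. by []. Qed.

Lemma shift_ce x F : shift x (ce F) = - (ce (shift x F)) - (theta x F).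
Proof. by []. Qed.

Lemma ce_cons x F s : ce F (x :: s) = - ce (shift x F) s - theta x F s.
Proof. by []. Qed.

Lemma theta_linear x : linear (theta x).
Proof.
move=> a F G; apply: cochainP => s.
elim: s F G => [|y s IHs] F G; first by rewrite [RHS]cochainD cochainZ scaler0 addr0.
rewrite -[LHS]/(shift y _ s) -[RHS]/(shift y _ s).
rewrite !(shiftD, shiftZ, shift_theta) !(cochainD, cochainZ) IHs.
by rewrite !(cochainD, cochainZ) scalerDr; abel.
Qed.
HB.instance Definition _ x :=
  GRing.isLinear.Build K C C *:%R (theta x) (theta_linear x).

Lemma thetaD x F G : theta x (F + G) = theta x F + (theta x G).
Proof. exact: linearD. Qed.
Lemma thetaN x F : theta x (- F) = - (theta x F).
Proof. exact: linearN. Qed.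
Lemma theta0 x : theta x (0 : C) = 0.
Proof. exact: linear0. Qed.

Lemma ce_linear : linear ce.
Proof.
move=> a F G; apply: cochainP => s.
elim: s F G => [|y s IHs] F G; first by rewrite [RHS]cochainD cochainZ scaler0 addr0.
rewrite -[LHS]/(shift y _ s) -[RHS]/(shift y _ s).
rewrite !(shiftD, shiftZ, shift_ce) (linearP (theta y)).
rewrite !(cochainD, cochainN, cochainZ) IHs.
by rewrite !(cochainD, cochainZ) scalerBr scalerN; abel.
Qed.
HB.instance Definition _ :=
  GRing.isLinear.Build K C C *:%R ce ce_linear.

Lemma ceD F G : ce (F + G) = ce F + (ce G). Proof. exact: linearD. Qed.
Lemma ceN F : ce (- F) = - (ce F). Proof. exact: linearN. Qed.
Lemma ce0 : ce (0 : C) = 0. Proof. exact: linear0. Qed.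

Lemma theta_arity0 x e : theta x (arity0 e : C) = 0.
Proof.
apply: cochain_ext => [//|y]; rewrite shift_theta.
by rewrite !shift_arity0 theta0 addr0.
Qed.

Lemma ce_arity0 e : ce (arity0 e : C) = 0.
Proof.
apply: cochain_ext => [//|x].
by rewrite shift_ce shift_arity0 ce0 theta_arity0 oppr0 addr0.
Qed.

Lemma theta_arity1 x (p : V -> lend U) :
  theta x (arity1 p : C) = arity1 (fun y => p (br x y)).
Proof.
apply: cochain_ext => [//|y].
by rewrite shift_theta !shift_arity1 theta_arity0 addr0.
Qed.

Lemma ce_arity1 (p : V -> lend U) : ce (arity1 p : C) =
  - arity2 (fun x y => p (br x y)).
Proof.
apply: cochain_ext => [|x]; first by rewrite cochainN oppr0.
by rewrite shift_ce shift_arity1 ce_arity0 theta_arity1 shiftN shift_arity2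
  oppr0 add0r.
Qed.

Lemma theta_twist x F : theta x (twist F) = twist (theta x F).
Proof.
apply: cochainP => s; elim: s F => [|y s IHs] F; first by rewrite /twist scaler0.
rewrite -[LHS]/(shift y _ s) -[RHS]/(shift y _ s) shift_theta !shift_twist.
rewrite thetaN !cochainD !cochainN IHs -opprD; congr (- _).
by rewrite shift_theta twistD.
Qed.

Lemma ce_twist F : ce (twist F) = - twist (ce F).
Proof.
apply: cochainP => s; elim: s F => [|x s IHs] F.
  by rewrite /twist cochainN scaler0 oppr0.
rewrite -[LHS]/(shift x _ s) -[RHS]/(shift x _ s) shift_ce shiftN !shift_twist.
rewrite shift_ce theta_twist ceN !(twistD, twistN) !(cochainD, cochainN) IHs.
by rewrite !(cochainN, cochainD); abel.
Qed.

Lemma thetaM x F G : theta x (F * G) = theta x F * G + F * theta x G.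
Proof.
apply: cochainP => s; elim: s F G => [|y s IHs] F G.
  by rewrite cochainD !cochainM_nil mul0r mulr0 addr0.
rewrite -[LHS]/(shift y _ s) -[RHS]/(shift y _ s).
rewrite shift_theta shiftD !shiftM !shift_theta thetaD !cochainD !IHs.
by rewrite theta_twist mulrDl mulrDr !cochainD; abel.
Qed.

Lemma ceM F G : ce (F * G) = ce F * G + twist F * ce G.
Proof.
apply: cochainP => s; elim: s F G => [|x s IHs] F G.
  by rewrite cochainD !cochainM_nil mul0r mulr0 addr0.
rewrite -[LHS]/(shift x _ s) -[RHS]/(shift x _ s).
rewrite shift_ce shiftD !shiftM !shift_ce ceD twistK shift_twist.
rewrite !(cochainD, cochainN) !IHs !(cochainD, cochainN) twistK ce_twist thetaM.
rewrite mulrBr mulrBl !(mulNr, mulrN, mulrBr, mulrDl, mulrDr).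
by rewrite !(cochainD, cochainN); abel.
Qed.

Definition multilinear F := forall s t a x y,
  F (s ++ (a *: x + y) :: t) = a *: F (s ++ x :: t) + F (s ++ y :: t).

Definition skew F := forall s t x y,
  F (s ++ x :: y :: t) = - F (s ++ y :: x :: t).

Hypothesis jacobi : forall x y z, br x (br y z) = br (br x y) z + br y (br x z).

Lemma multilinear_shift x F : multilinear F -> multilinear (shift x F).
Proof. by move=> mF s; exact: (mF (x :: s)). Qed.

Lemma multilinear_shiftP a x y F : multilinear F ->
  shift (a *: x + y) F = a *: shift x F + shift y F.
Proof. by move=> mF; apply: cochainP => s; exact: (mF [::]). Qed.

(** This is where the Jacobi identity enters: [theta x], the negative of a Lie
    derivative, represents the Lie algebra up to sign. *)
Lemma theta_theta x y F : multilinear F ->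
  theta x (theta y F) - theta y (theta x F) = - (theta (br x y) F : C).
Proof.
move=> mF; apply: cochainP => s; elim: s F mF => [|z s IHs] F mF.
  by rewrite cochainD !cochainN /= subrr oppr0.
rewrite -[LHS]/(shift z _ s) -[RHS]/(shift z _ s).
rewrite shiftD !shiftN !shift_theta !thetaD.
have /eqP := IHs _ (multilinear_shift z mF); rewrite subr_eq => /eqP E.
rewrite !cochainD !cochainN !cochainD E !cochainN.
have := multilinear_shiftP 1 (br (br x y) z) (br y (br x z)) mF.
rewrite !scale1r -jacobi => ->.
by rewrite !cochainD; abel.
Qed.

Lemma theta_ce x F : multilinear F -> ce (theta x F) = theta x (ce F).
Proof.
move=> mF; apply: cochainP => s; elim: s F mF => [//|y s IHs] F mF.
rewrite -[LHS]/(shift y _ s) -[RHS]/(shift y _ s).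
rewrite shift_ce !shift_theta !shift_ce !ceD !(thetaD, thetaN).
have /eqP := theta_theta x y mF; rewrite subr_eq => /eqP ->.
rewrite !(cochainD, cochainN) -(IHs _ (multilinear_shift y mF)); abel.
Qed.

(** By the Cartan formula, the shift of the square of [ce] is the square of
    [ce] on the shift plus the commutator of [ce] with [theta], which vanishes by
    [theta_ce]. *)
Lemma ce_ce F : multilinear F -> ce (ce F) = 0.
Proof.
move=> mF; apply: cochainP => s; elim: s F mF => [//|x s IHs] F mF.
rewrite -[LHS]/(shift x _ s) shift_ce !shift_ce !(ceD, ceN).
rewrite -(theta_ce x mF) !(cochainD, cochainN).
by rewrite (IHs _ (multilinear_shift x mF)) cochain0; abel.
Qed.

(** The square of the operator sending [G] to [twist (Z * G - ce G)] is the
    multiplication by [twist Z * Z + ce Z], and conjugating this operator by the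
    multiplication by [F] replaces [Z] by [Y].  The computation uses that [ce] is
    an odd derivation of square zero and that [twist] is an automorphism
    anticommuting with it. *)
Lemma gauge_maurer_cartan F h Z : h * F = 1 -> F * h = 1 -> multilinear F ->
    twist Z * Z + ce Z = 0 ->
  let Y := twist h * (Z * F - ce F) in twist Y * Y + ce Y = 0.
Proof.
move=> hF Fh mF mcZ Y.
have tF : twist F * twist h = 1 by rewrite -twistM Fh twist1.
have ceh : ce (twist h) = h * twist (ce F) * twist h.
  have : ce (twist h * twist F) = 0 by rewrite -twistM hF twist1 ce_arity0.
  rewrite ceM twistK (ce_twist F) mulrN => /eqP; rewrite subr_eq add0r => /eqP E.
  by rewrite -E -mulrA tF mulr1.
have ceZ : ce Z = - (twist Z * Z) by apply/eqP; rewrite -addr_eq0 addrC mcZ.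
have -> : ce Y = h * twist (ce F) * Y + h * (- (twist Z * Z) * F + twist Z * ce F).
  rewrite /Y ceM ceh twistK ceD ceN ceM (ce_ce mF) subr0 ceZ.
  by rewrite -!mulrA.
have -> : twist Y = h * (twist Z * twist F - twist (ce F)).
  by rewrite /Y twistM twistK twistD twistN twistM.
rewrite mulrBr mulrBl addrA subrK {1}/Y.
rewrite -!mulrA (mulrA (twist F)) tF mul1r mulrBr.
by rewrite mulNr !(mulrDr h) !mulrN -!mulrA; abel.
Qed.

Lemma skew_shift F (a : V) : skew F -> skew (shift a F).
Proof. by move=> sF t; exact: (sF (a :: t)). Qed.

Lemma shift_shift F (a b : V) : skew F ->
  shift a (shift b F) = - shift b (shift a F).
Proof. by move=> sF; apply: cochainP => t; exact: (sF [::]). Qed.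

Lemma shift_0 F : multilinear F -> shift 0 F = 0.
Proof.
move=> mF; have := multilinear_shiftP (-1) 0 0 mF.
by rewrite scaler0 addr0 scaleN1r addNr.
Qed.

End ChevalleyEilenberg.

Section AlternatingCochains.
Context {K : comPzRingType} {V U : lmodType K}.
Notation C := (cochain V U).
Implicit Types (F G : C) (s t : seq V) (x y : V).

Definition alternating F := multilinear F /\ skew F.

Lemma alternatingD F G : alternating F -> alternating G -> alternating (F + G).
Proof.
move=> [mF sF] [mG sG]; split=> [s t a x y|s t x y]; rewrite !cochainD.
  by rewrite mF mG scalerDr addrACA.
by rewrite sF sG opprD.
Qed.

Lemma alternatingZ a F : alternating F -> alternating (a *: F).
Proof.
move=> [mF sF]; split=> [s t b x y|s t x y]; rewrite !cochainZ.
  by rewrite mF scalerDr !scalerA mulrC.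
by rewrite sF scalerN.
Qed.

Lemma alternatingN F : alternating F -> alternating (- F).
Proof. by rewrite -scaleN1r; exact: alternatingZ. Qed.

Lemma alternating_twist F : alternating F -> alternating (twist F).
Proof.
move=> [mF sF]; split=> [s t a x y|s t x y]; rewrite /twist !size_cat /=.
  by rewrite mF scalerDr !scalerA mulrC.
by rewrite sF scalerN.
Qed.

Lemma alternating_shift x F : alternating F -> alternating (shift x F).
Proof. by move=> [mF sF]; split=> s; [exact: (mF (x :: s))|exact: (sF (x :: s))]. Qed.

Lemma alternatingM F G : alternating F -> alternating G -> alternating (F * G).
Proof.
move=> aF aG; split=> s.
  elim: s F G aF aG => [|z s IHs] F G aF aG t a x y; rewrite ?cat_cons !cochainM_cons.
    rewrite (multilinear_shiftP _ _ _ aF.1) (multilinear_shiftP _ _ _ aG.1).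
    rewrite mulrDl mulrDr -cochain_scalerAl -cochain_scalerAr !cochainD !cochainZ.
    by rewrite scalerDr addrACA.
  rewrite (IHs (shift z F)) ?(IHs (twist F));
    try by [exact: aF|exact: aG|exact: alternating_shift|exact:
    alternating_twist].
  by rewrite scalerDr addrACA.
elim: s F G aF aG => [|z s IHs] F G aF aG t x y; rewrite ?cat_cons !cochainM_cons.
  rewrite !shift_twist !mulNr !cochainN !twistK.
  rewrite (shift_shift y x aF.2) (shift_shift y x aG.2) mulNr mulrN !cochainN.
  by abel.
rewrite (IHs (shift z F)); last 2 first.
- exact: alternating_shift.
- exact: aG.
rewrite (IHs (twist F)) ?opprD //;
  by [exact: alternating_shift|exact: alternating_twist].
Qed.

Lemma alternating_arity0 e : alternating (arity0 e : C).
Proof.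
by split=> [[|z s] t a x y|[|z s] t x y]; rewrite /= ?scaler0 ?addr0 ?oppr0.
Qed.

Lemma alternating_arity1 (p : V -> lend U) :
  (forall a x y, p (a *: x + y) = a *: p x + p y) -> alternating (arity1 p : C).
Proof.
move=> pl; split=> [s t a x y|s t x y].
  case: s => [|z [|z' s]] /=; rewrite ?scaler0 ?addr0 //.
  by case: t => [|z t]; rewrite ?pl ?scaler0 ?addr0.
by case: s => [|z [|z' s]] /=; rewrite ?oppr0.
Qed.

Lemma alternating_arity2 (p : V -> V -> lend U) :
  (forall z a x y, p z (a *: x + y) = a *: p z x + p z y) ->
  (forall x y, p x y = - p y x) -> alternating (arity2 p : C).
Proof.
move=> pl pC.
have pr z a x y : p (a *: x + y) z = a *: p x z + p y z.
  by rewrite pC pl opprD -scalerN -!pC.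
split=> [s t a x y|s t x y].
  case: s => [|z [|z' s]] /=.
  - by case: t => [|b [|c t]]; rewrite ?pr ?scaler0 ?addr0.
  - by case: t => [|b t]; rewrite ?pl ?scaler0 ?addr0.
  - by case: s => [|b s] /=; rewrite ?scaler0 ?addr0.
case: s => [|z [|z' s]] /=; last by case: s => [|? ?] /=; rewrite ?oppr0.
- by case: t => [|b t]; rewrite ?oppr0.
- by rewrite ?oppr0.
Qed.

End AlternatingCochains.

(** * Power series in the interior product *)

Section BinomialConvolution.
Context {K : comPzRingType}.
Implicit Types a b c : nat -> K.

Definition seq_tail a n := a n.+1.
Definition seq_sign a n := (-1) ^+ n * a n.

(** The product of exponential generating functions, in the recursive form that
    matches the Leibniz rule; [seq_tail] is the derivative of such a series
    and [seq_sign] the substitution of [- x]. *)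
Fixpoint binconv a b n : K :=
  if n is n'.+1 then binconv (seq_tail a) b n' + binconv a (seq_tail b) n'
  else a 0%N * b 0%N.

Lemma binconvE a b n :
  binconv a b n = \sum_(k < n.+1) 'C(n, k)%:R * (a k * b (n - k)%N).
Proof.
elim: n a b => [|n IHn] a b; first by rewrite big_ord1 mul1r.
rewrite /= !IHn [in RHS]big_ord_recl bin0 mul1r.
under [in RHS]eq_bigr => k _ do rewrite lift0 binS natrD mulrDl subSS.
rewrite big_split /= addrA [RHS]addrC; congr (_ + _).
rewrite big_ord_recl bin0 mul1r; congr (_ + _).
  by rewrite /seq_tail /= !subn0.
rewrite [in RHS]big_ord_recr /= bin_small // mul0r addr0.
by apply: eq_bigr => k _; rewrite /seq_tail /bump add1n subnSK.
Qed.

End BinomialConvolution.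

Section InteriorProducts.
Context {K : comPzRingType} {V U : lmodType K} (br : V -> V -> V).
Context (iot : V -> lend U).
Notation C := (cochain V U).
Implicit Types (F G : C) (s t : seq V) (x y z : V) (a b : nat -> K).

Hypothesis iot_lin : forall (c : K) x y, iot (c *: x + y) = c *: iot x + iot y.
Hypothesis iotC : forall x y, iot x * iot y = - (iot y * iot x).
Hypothesis brC : forall x y, br x y = - br y x.

Lemma iotN x : iot (- x) = - iot x.
Proof.
have i0 : iot 0 = 0.
  by have := iot_lin (-1) 0 0; rewrite !scaleN1r oppr0 !addNr addr0.
by rewrite -scaleN1r -[_ *: x]addr0 iot_lin i0 addr0 scaleN1r.
Qed.

(** The cochain [a(iota)] for the exponential generating function [a].  No
    factorial occurs: the n-th shuffle power of [iota] on [n] arguments is n!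
    times the composite of the interior products. *)
Definition ser a : C := fun s => a (size s) *: \prod_(x <- s) iot x.

Lemma ser_nil a : ser a [::] = a 0%N *: (1 : lend U).
Proof. by rewrite /ser big_nil. Qed.

Lemma shift_ser x a : shift x (ser a) = arity0 (iot x) * ser (seq_tail a).
Proof.
apply: cochainP => s; rewrite arity0M_apply /shift /ser big_cons.
by rewrite lend_scalerAr.
Qed.

Lemma prod_iot_iot s x :
  (\prod_(y <- s) iot y) * iot x = (-1) ^+ size s *: (iot x * \prod_(y <- s) iot y).
Proof.
elim: s => [|y s IHs]; first by rewrite big_nil mul1r mulr1 scale1r.
rewrite big_cons -mulrA IHs -lend_scalerAr mulrA iotC mulNr scalerN -scaleNr.
by rewrite -mulrA exprS mulN1r.
Qed.

Lemma serD a b : ser (a + b) = ser a + ser b.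
Proof. by apply: cochainP => s; rewrite /ser scalerDl. Qed.

Lemma serZ (c : K) a : ser (fun n => c * a n) = c *: ser a.
Proof. by apply: cochainP => s; rewrite cochainZ /ser scalerA. Qed.

Lemma serN a : ser (- a) = - ser a.
Proof. by apply: cochainP => s; rewrite cochainN /ser scaleNr. Qed.

Lemma twist_ser a : twist (ser a) = ser (seq_sign a).
Proof. by apply: cochainP => s; rewrite /twist /ser scalerA. Qed.

Lemma ser_iot a x : ser a * arity0 (iot x) = arity0 (iot x) * twist (ser a).
Proof.
apply: cochainP => s; rewrite arity0M_apply Marity0_apply /twist /ser.
by rewrite -lend_scalerAl prod_iot_iot scalerA scalerA -lend_scalerAr mulrC.
Qed.

Lemma twist_ser_iot a x : twist (ser a) * arity0 (iot x) = arity0 (iot x) * ser a.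
Proof.
by rewrite -[RHS]twistK twistM twist_arity0 -ser_iot twistM twist_arity0.
Qed.

Lemma ser_multilinear a : multilinear (ser a).
Proof.
move=> s t c x y; rewrite /ser !size_cat /= !big_cat !big_cons /= iot_lin.
rewrite mulrDl mulrDr scalerDr -lend_scalerAl -lend_scalerAr.
by rewrite !scalerA mulrC.
Qed.

Lemma ser_skew a : skew (ser a).
Proof.
move=> s t x y; rewrite /ser !size_cat /= !big_cat !big_cons /= !mulrA.
by rewrite -(mulrA _ (iot x)) iotC mulrN !mulrA mulNr scalerN.
Qed.

(** Interior products anticommute, which compensates the signs of the shuffle
    product: [iota] behaves as an ordinary variable. *)
Lemma serM a b : ser a * ser b = ser (binconv a b).
Proof.
apply: cochainP => s; elim: s a b => [|x s IHs] a b.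
  by rewrite cochainM_nil !ser_nil -lend_scalerAl mul1r scalerA.
rewrite -[LHS]/(shift x _ s) -[RHS]/(shift x _ s) shiftM !shift_ser.
rewrite mulrA twist_ser_iot -!mulrA -mulrDr !arity0M_apply.
by rewrite cochainD !IHs /ser -scalerDl.
Qed.

Lemma ser1 : ser (fun n => (n == 0%N)%:R) = 1.
Proof.
apply: cochainP => -[|x s]; first by rewrite ser_nil scale1r.
by rewrite /ser /= scale0r.
Qed.

Lemma ser_iot1 : ser (fun n => (n == 1%N)%:R) = arity1 iot.
Proof.
apply: cochainP => -[|x [|y s]]; rewrite /ser /= ?scale0r //.
by rewrite big_cons big_nil mulr1 scale1r.
Qed.

Context (lied : V -> lend U) (d : lend U).
Hypothesis lied_iot : forall x y,
  lied x * iot y = iot y * lied x + iot (br x y).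
Hypothesis d_iot : forall x, d * iot x = lied x - iot x * d.

Local Notation L := (arity1 lied : C).
Local Notation ka := (arity2 (fun x y => iot (br x y)) : C).
Local Notation iot_br x := (arity1 (fun y => iot (br x y)) : C).

Lemma arity1_iot (p : V -> V) x :
  (arity1 (fun y => iot (p y)) : C) * arity0 (iot x) =
  - (arity0 (iot x) * arity1 (fun y => iot (p y))).
Proof.
apply: cochainP => s; rewrite cochainN Marity0_apply arity0M_apply.
case: s => [|y [|z s]]; rewrite ?mul0r ?mulr0 ?oppr0 //.
exact: iotC.
Qed.

Lemma arity1_ser (p : V -> V) a :
  (arity1 (fun y => iot (p y)) : C) * ser a =
  ser a * arity1 (fun y => iot (p y)).
Proof.
apply: cochainP => s; elim: s a => [|y s IHs] a.
  by rewrite !cochainM_nil mul0r mulr0.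
rewrite -[LHS]/(shift y _ s) -[RHS]/(shift y _ s) !shiftM !shift_arity1.
rewrite !shift_ser twist_arity1 mulNr mulrA arity1_iot mulNr opprK twist_ser_iot.
by rewrite -!mulrA !cochainD !arity0M_apply IHs addrC.
Qed.

Lemma lied_ser x a : arity0 (lied x) * ser a =
  ser a * arity0 (lied x) + ser (seq_tail a) * iot_br x.
Proof.
apply: cochainP => s; elim: s a => [|y s IHs] a.
  rewrite cochainD !cochainM_nil mulr0 addr0 ser_nil.
  by rewrite -lend_scalerAl -lend_scalerAr mul1r mulr1.
rewrite -[LHS]/(shift y _ s) -[RHS]/(shift y _ s) shiftD !shiftM !shift_arity0.
rewrite !shift_ser shift_arity1 twist_arity0 mul0r add0r mulr0 addr0.
rewrite mulrA -arity0M lied_iot arity0D mulrDl arity0M -!mulrA twist_ser_iot.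
rewrite !cochainD !(arity0M_apply (iot _)) IHs cochainD mulrDr.
by rewrite -!addrA.
Qed.

(** The commutator of the Lie derivative with [iota] is twice [ka], because
    both orders of the two arguments contribute [iot (br x y)]. *)
Lemma L_ser a : L * ser a =
  twist (ser a) * L + (twist (ser (seq_tail a)) * ka) *+ 2.
Proof.
apply: cochainP => s; elim: s a => [|x s IHs] a.
  by rewrite cochainD mulr2n cochainD !cochainM_nil !mulr0 mul0r !addr0.
have Lio y : L * arity0 (iot y) = arity0 (iot y) * L - iot_br y.
  apply: cochainP => t; rewrite cochainD Marity0_apply arity0M_apply cochainN.
  case: t => [|z [|z' t]]; rewrite /= ?mul0r ?mulr0 ?subr0 //.
  by rewrite lied_iot brC iotN.
rewrite -[LHS]/(shift x _ s) -[RHS]/(shift x _ s) mulr2n !shiftD !shiftM.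
rewrite !shift_twist !shift_ser shift_arity1 shift_arity2 !twistK.
rewrite lied_ser twist_arity1 mulNr (mulrA L) Lio mulrBl -(mulrA _ L).
rewrite arity1_ser !twistM !twist_arity0.
rewrite !mulNr -!mulrA !(cochainD, cochainN).
rewrite !(arity0M_apply (iot _)) IHs mulr2n !cochainD.
by rewrite !mulrDr; abel.
Qed.

(** The commutator of [d] with [iota] is [L] by Cartan's formula, and the
    commutator of [L] with [iota] is a multiple of [ka], which commutes with
    [iota]; hence a second-order Taylor formula without further terms. *)
Lemma d_ser a : arity0 d * ser a =
  twist (ser a) * arity0 d + twist (ser (seq_tail a)) * L +
  twist (ser (seq_tail (seq_tail a))) * ka.
Proof.
apply: cochainP => s; elim: s a => [|x s IHs] a.
  rewrite !cochainD !cochainM_nil !mulr0 !addr0 /twist !ser_nil scale1r.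
  by rewrite -lend_scalerAl -lend_scalerAr mul1r mulr1.
rewrite -[LHS]/(shift x _ s) -[RHS]/(shift x _ s) !shiftD !shiftM.
rewrite !shift_twist !shift_ser shift_arity0 shift_arity1 shift_arity2 !twistK.
rewrite twist_arity0 mul0r add0r mulr0 addr0 mulrA -arity0M d_iot.
rewrite arity0B mulrBl arity0M -mulrA lied_ser !twistM !twist_arity0.
rewrite !mulNr !(cochainD, cochainN) -!mulrA !(arity0M_apply (iot _)) IHs !cochainD.
by rewrite !mulrDr; abel.
Qed.

Lemma theta_ser x a : theta br x (ser a) = ser (seq_tail a) * iot_br x.
Proof.
apply: cochainP => s; elim: s a => [|y s IHs] a.
  by rewrite cochainM_nil mulr0.
rewrite -[LHS]/(shift y _ s) -[RHS]/(shift y _ s) shift_theta shiftM.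
rewrite !shift_ser shift_arity1 thetaM theta_arity0 mul0r add0r twist_ser_iot.
by rewrite -mulrA !cochainD !(arity0M_apply (iot _)) IHs addrC.
Qed.

(** The differential of [iota] is [- ka], and [ka] commutes with [iota]: this is
    the chain rule. *)
Lemma ce_ser a : ce br (ser a) = - (twist (ser (seq_tail a)) * ka).
Proof.
apply: cochainP => s; elim: s a => [|x s IHs] a.
  by rewrite cochainN cochainM_nil mulr0 oppr0.
rewrite -[LHS]/(shift x _ s) -[RHS]/(shift x _ s) shift_ce shiftN shiftM.
rewrite shift_twist !shift_ser ceM ce_arity0 mul0r add0r twist_arity0 theta_ser.
rewrite shift_arity2 twistK twistM twist_arity0 !mulNr -mulrA.
rewrite !(cochainD, cochainN) !(arity0M_apply (iot _)) IHs cochainN mulrN.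
by abel.
Qed.

End InteriorProducts.

(** * Bernoulli numbers *)

Section BinconvTheory.
Context {K : comPzRingType}.
Implicit Types a b c : nat -> K.

Definition seq_unit n : K := (n == 0%N)%:R.
Definition seq_X n : K := (n == 1%N)%:R.

Lemma seqP a b : a =1 b -> a = b. Proof. exact: funext. Qed.

Lemma binconvS a b n :
  binconv a b n.+1 = binconv (seq_tail a) b n + binconv a (seq_tail b) n.
Proof. by []. Qed.
Lemma seqD a b n : (a + b) n = a n + b n. Proof. by []. Qed.
Lemma seqN a n : (- a) n = - a n. Proof. by []. Qed.
Lemma seq_tailD a b : seq_tail (a + b) = seq_tail a + seq_tail b.
Proof. by []. Qed.

Lemma binconvC a b : binconv a b = binconv b a.
Proof.
apply: seqP => n; elim: n a b => [|n IHn] a b; first exact: mulrC.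
by rewrite /= addrC (IHn a) (IHn (seq_tail a)).
Qed.

Lemma binconvDl a b c : binconv (a + b) c = binconv a c + binconv b c.
Proof.
apply: seqP => n; elim: n a b c => [|n IHn] a b c; first exact: mulrDl.
rewrite seqD !binconvS seq_tailD (IHn (seq_tail a)) (IHn a) !seqD.
exact: addrACA.
Qed.

Lemma binconvDr a b c : binconv a (b + c) = binconv a b + binconv a c.
Proof. by rewrite binconvC binconvDl !(binconvC a). Qed.

Lemma seq_tail_binconv a b :
  seq_tail (binconv a b) = binconv (seq_tail a) b + binconv a (seq_tail b).
Proof. by []. Qed.

Lemma binconvA a b c : binconv a (binconv b c) = binconv (binconv a b) c.
Proof.
apply: seqP => n; elim: n a b c => [|n IHn] a b c; first exact: mulrA.
rewrite !binconvS !seq_tail_binconv binconvDl binconvDr !seqD !IHn.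
exact: addrA.
Qed.

Lemma binconv0r a : binconv a 0 = 0.
Proof. by have := binconvDr a 0 0; rewrite addr0 => /eqP;
  rewrite addrC -subr_eq subrr => /eqP. Qed.

Lemma binconv1r a : binconv a seq_unit = a.
Proof.
apply: seqP => n; elim: n a => [|n IHn] a; first exact: mulr1.
rewrite /= IHn (_ : seq_tail seq_unit = 0) ?binconv0r; last exact: seqP.
exact: addr0.
Qed.

Lemma binconv1l a : binconv seq_unit a = a.
Proof. by rewrite binconvC binconv1r. Qed.

Lemma seq_tail_X : seq_tail seq_X = seq_unit. Proof. exact: seqP. Qed.

Lemma binconv_X a n : binconv a seq_X n = n%:R * a n.-1.
Proof.
elim: n a => [|n IHn] a; first by rewrite /= mulr0 mul0r.
rewrite /= seq_tail_X binconv1r IHn /seq_tail.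
case: n {IHn} => [|n] /=; first by rewrite mul0r add0r mul1r.
by rewrite -[in RHS]natr1 mulrDl mul1r.
Qed.

Lemma seq_sign_tail a : seq_tail (seq_sign a) = - seq_sign (seq_tail a).
Proof. by apply: seqP => n; rewrite /seq_tail /seq_sign exprS mulN1r mulNr. Qed.

Lemma binconvNl a b : binconv (- a) b = - binconv a b.
Proof.
apply/eqP; rewrite -addr_eq0 -binconvDl addNr binconvC binconv0r.
exact: eqxx.
Qed.

Lemma binconvNr a b : binconv a (- b) = - binconv a b.
Proof. by rewrite binconvC binconvNl binconvC. Qed.

Lemma binconv_sign a b :
  binconv (seq_sign a) (seq_sign b) = seq_sign (binconv a b).
Proof.
apply: seqP => n; elim: n a b => [|n IHn] a b; first by rewrite /seq_sign /= !mul1r.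
rewrite binconvS !seq_sign_tail binconvNl binconvNr !seqN !IHn /seq_sign exprS mulN1r.
by rewrite mulNr mulrDr opprD.
Qed.

End BinconvTheory.

Section BernoulliNumbers.
Context {K : numFieldType}.

(** The coefficients of [(e^x - 1) / x]. *)
Definition inv_succ n : K := n.+1%:R^-1.

Lemma size_bernoulli_seq n : size (bernoulli_seq K n) = n.+1.
Proof. by elim: n => [//|n IHn] /=; rewrite size_rcons IHn. Qed.

Lemma nth_bernoulli_seq n k : (k <= n)%N -> (bernoulli_seq K n)`_k = bernoulli K k.
Proof.
elim: n k => [|n IHn] k; first by rewrite leqn0 => /eqP ->.
rewrite leq_eqVlt => /orP[/eqP -> //|]; rewrite ltnS => kn /=.
by rewrite nth_rcons size_bernoulli_seq ltnS kn IHn.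
Qed.

Lemma bernoulliS n : bernoulli K n.+1 =
  - (\sum_(k < n.+1) 'C(n.+2, k)%:R * bernoulli K k) / n.+2%:R.
Proof.
rewrite /bernoulli /= nth_rcons size_bernoulli_seq ltnn eqxx.
congr (- _ / _); apply: eq_bigr => k _.
by rewrite nth_bernoulli_seq // -ltnS.
Qed.

Lemma bernoulli0 : bernoulli K 0 = 1. Proof. by []. Qed.

(** The recursion defining the Bernoulli numbers says that their generating
    function is [x / (e^x - 1)]. *)
Lemma bernoulli_inv : binconv (bernoulli K) inv_succ = seq_unit.
Proof.
apply: seqP => n; rewrite binconvE.
have nS k : k.+1%:R != 0 :> K by rewrite pnatr_eq0.
have E (k : 'I_n.+1) : 'C(n, k)%:R * (bernoulli K k * inv_succ (n - k)) =
    n.+1%:R^-1 * ('C(n.+1, k)%:R * bernoulli K k).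
  have kn : (k <= n)%N by rewrite -ltnS.
  have /(congr1 (fun m => m%:R : K)) := mul_bin_down n.+1 k.
  rewrite /= !natrM subSn // => e.
  apply: (mulfI (nS n)); rewrite mulVKf ?nS //.
  rewrite [LHS]mulrA e /inv_succ; field.
  by rewrite nat1r nS.
rewrite (eq_bigr _ (fun k _ => E k)) -mulr_sumr /seq_unit.
case: n nS E => [|n] nS _; first by rewrite big_ord1 bin0 bernoulli0 invr1 !mulr1.
rewrite big_ord_recr /= binSn bernoulliS [X in _ * (_ + X)]mulrCA.
by rewrite divff ?nS // mulr1 subrr mulr0.
Qed.

(** The identity [h(- x) = h(x) + x] for [h(x) = x / (e^x - 1)], which amounts to
    the vanishing of the Bernoulli numbers of odd index greater than 1. *)
Lemma bernoulli_sign : seq_sign (bernoulli K) = bernoulli K + seq_X.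
Proof.
(* [e] is the exponential series; [ee], [Xf], [ef] and [eh] read
   e^x e^(-x) = 1, x f(x) = e^x - 1, e^x f(-x) = f(x) and e^x h(x) = h(x) + x. *)
pose e : nat -> K := fun=> 1.
have ee : binconv e (seq_sign e) = seq_unit.
  apply: seqP => -[|n]; first by rewrite /= /seq_sign expr0 !mulr1.
  rewrite /= seq_sign_tail (_ : seq_tail e = e) //.
  rewrite [X in _ + X](_ : _ = - binconv e (seq_sign e) n) ?subrr //.
  by rewrite binconvNr.
have Xf : binconv inv_succ seq_X = e - seq_unit.
  apply: seqP => -[|n]; rewrite binconv_X.
    by rewrite mul0r -[RHS]/(1 - 1) subrr.
  by rewrite /inv_succ /= divff ?pnatr_eq0 // -[RHS]/(1 - 0) subr0.
have Xfs : binconv (seq_sign inv_succ) seq_X = seq_unit - seq_sign e.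
  apply: seqP => -[|n]; rewrite binconv_X.
    by rewrite mul0r -[RHS]/(1 - 1 * 1) mul1r subrr.
  rewrite /seq_sign /inv_succ /= mulrCA divff ?pnatr_eq0 // mulr1.
  by rewrite -[RHS]/(0 - (-1) ^+ n.+1 * 1) sub0r mulr1 exprS mulN1r opprK.
have ef : binconv e (seq_sign inv_succ) = inv_succ.
  have : binconv (binconv e (seq_sign inv_succ)) seq_X = binconv inv_succ seq_X.
    by rewrite -binconvA Xfs Xf binconvDr binconv1r binconvNr ee.
  move=> E; apply: seqP => n; have /(congr1 (fun s => s n.+1)) := E.
  by rewrite !binconv_X; apply: mulfI; rewrite pnatr_eq0.
have eh : binconv e (bernoulli K) = bernoulli K + seq_X.
  have -> : e = binconv inv_succ seq_X + seq_unit by rewrite Xf subrK.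
  rewrite binconvDl binconv1l binconvC binconvA bernoulli_inv binconv1l.
  exact: addrC.
rewrite -eh -[LHS]binconv1r -bernoulli_inv (binconvC (bernoulli K)) -{1}ef.
rewrite !binconvA (binconvC _ e) -(binconvA e) binconv_sign bernoulli_inv.
rewrite (_ : seq_sign seq_unit = seq_unit) ?binconv1r //.
by apply: seqP => -[|n]; rewrite /seq_sign /seq_unit ?mul1r ?mulr0.
Qed.

(** The generating function of these weights, multiplied by [x^2 / 12], is that
    of the Bernoulli numbers without its terms of degree 0 and 1. *)
Definition nary_weight n : K := 12 * bernoulli K n.+2 / (n.+2 * n.+1)%:R.

Lemma bernoulli_signS n : (-1) ^+ n * bernoulli K n.+2 = bernoulli K n.+2.
Proof.
have /(congr1 (fun s => s n.+2)) := bernoulli_sign.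
by rewrite seqD /seq_sign /seq_X addr0 !exprS !mulN1r opprK.
Qed.

Lemma bernoulli1 : bernoulli K 1 = - 2^-1.
Proof. by rewrite bernoulliS big_ord1 bin0 bernoulli0 mulr1 mulN1r. Qed.

(** For [f(x) = (e^x - 1) / x] this is the differential equation
    [x f' + f = x f + 1], both sides being [e^x]. *)
Lemma inv_succ_X : binconv (seq_tail inv_succ) seq_X + inv_succ =
  binconv inv_succ seq_X + seq_unit.
Proof.
apply: seqP => -[|n]; rewrite !seqD !binconv_X /inv_succ /seq_unit /seq_tail /=.
  by rewrite !mul0r !add0r invr1.
rewrite addr0; field.
by rewrite nat1r -natrD !pnatr_eq0.
Qed.

(** Multiplying the differential equation by [h = 1 / f] gives
    [h f' = 1 + (h - 1) / x]. *)
Lemma binconv_inv_succ1 n :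
  binconv (bernoulli K) (seq_tail inv_succ) n =
    (n == 0%N)%:R + bernoulli K n.+1 / n.+1%:R.
Proof.
have := congr1 (binconv (bernoulli K)) inv_succ_X.
rewrite !binconvDr !binconvA bernoulli_inv binconv1r binconv1l.
move=> /(congr1 (fun s => s n.+1)); rewrite !seqD !binconv_X /= addr0 => e.
have nS : n.+1%:R != 0 :> K by rewrite pnatr_eq0.
apply: (mulfI nS); rewrite e mulrDr mulrCA divff // mulr1; congr (_ + _).
by case: n {e nS} => [|n]; rewrite /seq_X ?mulr1 ?mulr0.
Qed.

(** Multiplying the derivative of the differential equation by [h = 1 / f] gives
    [h (f'' - f') = (1 - 2 h f') / x], whose coefficients are known from
    [binconv_inv_succ1]. *)
Lemma binconv_inv_succ2 n :
  binconv (bernoulli K) (seq_tail (seq_tail inv_succ)) n -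
  binconv (bernoulli K) (seq_tail inv_succ) n =
  - 2 * bernoulli K n.+2 / (n.+2 * n.+1)%:R.
Proof.
have := congr1 (fun s => binconv (bernoulli K) (seq_tail s)) inv_succ_X.
rewrite !seq_tailD !seq_tail_binconv !seq_tail_X !binconv1r.
rewrite (_ : seq_tail seq_unit = 0); last exact: seqP.
rewrite !binconvDr !binconvA bernoulli_inv binconv0r addr0.
move=> /(congr1 (fun s => s n.+1)); rewrite !seqD !binconv_X -[n.+1.-1]/n.
rewrite (_ : seq_unit n.+1 = 0) // addr0 binconv_inv_succ1 add0r -addrA => /eqP.
rewrite eq_sym -subr_eq => /eqP e.
have nS : n.+1%:R != 0 :> K by rewrite pnatr_eq0.
apply: (mulfI nS); rewrite mulrBr -e natrM; field.
by rewrite nat1r -natrD !pnatr_eq0.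
Qed.

End BernoulliNumbers.

Lemma nary_weight_odd (K : numFieldType) n : odd n -> nary_weight n = 0 :> K.
Proof.
move=> on; have := bernoulli_signS (K := K) n.
rewrite -signr_odd on expr1 mulN1r => /eqP.
by rewrite eqNr /nary_weight => /eqP ->; rewrite mulr0 mul0r.
Qed.

(** * The truncated Cartan calculus and its Bernoulli gauge *)

Section TruncatedCartan.
Context {K : numFieldType} {V U : lmodType K} (br : V -> V -> V).
Context (iot lied : V -> lend U) (d P : lend U).
Notation C := (cochain V U).
Implicit Types (F G : C) (s t : seq V) (x y z : V) (a b : nat -> K).

Hypothesis iot_lin : forall (c : K) x y, iot (c *: x + y) = c *: iot x + iot y.
Hypothesis brC : forall x y, br x y = - br y x.
Hypothesis jacobi : forall x y z, br x (br y z) = br (br x y) z + br y (br x z).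
Hypothesis iotC : forall x y, iot x * iot y = - (iot y * iot x).
Hypothesis lied_iot : forall x y,
  lied x * iot y = iot y * lied x + iot (br x y).
Hypothesis lied_br : forall x y, lied x * lied y - lied y * lied x = lied (br x y).
Hypothesis d_iot : forall x, d * iot x = lied x - iot x * d.
Hypothesis d_d : d * d = 0.
Hypothesis d_lied : forall x, d * lied x = lied x * d.
Hypothesis P_P : P * P = P.
Hypothesis P_lied : forall x, P * lied x = lied x * P.
Hypothesis P_d : P * d * P = P * d.
Hypothesis P_iot : forall x, P * iot x * P = iot x * P.
Hypothesis d_iot_P : forall x, (1 - P) * d * iot x * P = 0.

Local Notation L := (arity1 lied : C).
Local Notation io := (arity1 iot : C).
Local Notation ka := (arity2 (fun x y => iot (br x y)) : C).
Local Notation jser := (ser iot).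

Lemma arity1M (p q : V -> lend U) :
  (arity1 p : C) * arity1 q = arity2 (fun x y => p x * q y - p y * q x).
Proof.
apply: cochain_ext => [|x]; first by rewrite cochainM_nil mulr0.
rewrite shiftM !shift_arity1 shift_arity2 twist_arity1.
apply: cochainP => -[|y [|z s]].
- by rewrite mulNr cochainD cochainN !cochainM_nil mulr0 mul0r oppr0 addr0.
- by rewrite mulNr cochainD cochainN arity0M_apply Marity0_apply.
- by rewrite mulNr cochainD cochainN arity0M_apply Marity0_apply mulr0 mul0r subr0.
Qed.

Lemma arity0_arity1 e (p : V -> lend U) :
  arity0 e * arity1 p = arity1 (fun x => e * p x) :> C.
Proof.
by apply: cochainP => s; rewrite arity0M_apply; case: s => [|x []] *; rewrite ?mulr0.
Qed.

Lemma arity1_arity0 e (p : V -> lend U) :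
  arity1 p * arity0 e = arity1 (fun x => p x * e) :> C.
Proof.
by apply: cochainP => s; rewrite Marity0_apply; case: s => [|x []] *; rewrite ?mul0r.
Qed.

(** The strict action of the Lie algebra on the truncated complex.  The sign of
    [L] comes from the bracket of a module element with a vector field, where
    the vector field stands second. *)
Definition strict : C := arity0 (P * d) - L.

(** The three components of the equation say that [P * d] squares to zero, that
    it commutes with Lie derivatives, and that [lied] represents the Lie
    algebra. *)
Lemma strict_maurer_cartan : twist strict * strict + ce br strict = 0.
Proof.
have tw : twist strict = arity0 (P * d) + L.
  by rewrite /strict twistD twistN twist_arity0 twist_arity1 opprK.
have LL : L * L = - ce br L.
  rewrite arity1M ce_arity1 opprK; congr arity2.
  by apply/funext => x; apply/funext => y; rewrite lied_br.
have dL : L * arity0 (P * d) = arity0 (P * d) * L.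
  rewrite arity0_arity1 arity1_arity0; congr arity1; apply/funext => x.
  by rewrite mulrA -P_lied -!mulrA d_lied.
have dd : arity0 (P * d) * arity0 (P * d) = 0 :> C.
  by rewrite -arity0M mulrA P_d -mulrA d_d mulr0 linear0.
rewrite tw /strict mulrDl !mulrDr !mulrN dd dL LL ceD ceN ce_arity0.
by abel.
Qed.

Definition gauged (f h : nat -> K) : C :=
  twist (jser h) * (strict * jser f - ce br (jser f)).

Lemma gauged_maurer_cartan f h : binconv f h = seq_unit ->
  twist (gauged f h) * gauged f h + ce br (gauged f h) = 0.
Proof.
move=> fh; apply: gauge_maurer_cartan strict_maurer_cartan => //.
- by rewrite serM // binconvC fh ser1.
- by rewrite serM // fh ser1.
- exact: ser_multilinear.
Qed.

Lemma prod_iot_P s : P * (\prod_(x <- s) iot x) * P = (\prod_(x <- s) iot x) * P.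
Proof.
elim: s => [|x s IHs]; first by rewrite big_nil mulr1 mul1r P_P.
by rewrite big_cons -!mulrA -IHs !mulrA P_iot.
Qed.

(** On the image of [P], an interior product leaves room for [d] below the
    truncation degree, so that [(1 - P) * d] sees only the constant term of the
    series. *)
Lemma top_ser a : arity0 ((1 - P) * d) * jser a * arity0 P =
  a 0%N *: arity0 ((1 - P) * d * P) :> C.
Proof.
apply: cochainP => s; rewrite Marity0_apply arity0M_apply cochainZ.
case: s => [|x s]; first by rewrite ser_nil -lend_scalerAr mulr1 -lend_scalerAl.
rewrite /ser big_cons -lend_scalerAr -lend_scalerAl -!mulrA -prod_iot_P !mulrA.
by rewrite d_iot_P !mul0r scaler0 scaler0.
Qed.

(** The gauge transform with the operators [d], [L], [ka] and [(1 - P) * d]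
    brought to the right of the series in the interior product. *)
Definition gauged_bracket (f h : nat -> K) : C :=
  arity0 d +
  jser (seq_sign (binconv h (seq_tail f) - seq_unit)) * L +
  jser (seq_sign (binconv h (seq_tail (seq_tail f)) - binconv h (seq_tail f))) * ka -
  jser (seq_sign h) * arity0 ((1 - P) * d).

(** The right factor [P] is essential: [top_ser] disposes of [(1 - P) * d] only on
    the image of [P]. *)
Lemma gaugedE f h : f 0%N = 1 -> binconv f h = seq_unit ->
  gauged f h * arity0 P = gauged_bracket f h * arity0 P.
Proof.
move=> f0 fh.
have hf a : twist (jser h) * twist (jser a) = jser (seq_sign (binconv h a)).
  by rewrite -twistM serM // twist_ser.
have dec : strict = arity0 d - arity0 ((1 - P) * d) - L.
  by rewrite /strict -arity0B mulrBl mul1r opprB addrCA subrr addr0.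
have signB a b : jser (seq_sign (a - b)) = jser (seq_sign a) - jser (seq_sign b).
  rewrite -serN -serD; congr ser; apply/funext => n.
  exact: mulrBr.
have sign1 : jser (seq_sign seq_unit) = 1.
  rewrite -(ser1 iot); congr ser; apply/funext => -[|n].
    by rewrite /seq_sign mul1r.
  by rewrite /seq_sign mulr0.
have top : twist (jser h) * arity0 ((1 - P) * d) * jser f * arity0 P =
    jser (seq_sign h) * arity0 ((1 - P) * d) * arity0 P.
  by rewrite -!mulrA (mulrA (arity0 _)) top_ser f0 scale1r twist_ser -arity0M.
rewrite /gauged /gauged_bracket dec !signB sign1.
move: ((1 - P) * d) top {dec} => e top.
rewrite !mulrBl (d_ser iotC lied_iot d_iot).
rewrite (L_ser iot_lin iotC brC lied_iot) (ce_ser br iotC) mulr2n.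
rewrite !(mulrDl, mulrDr, mulNr, mulrN) !mulrA top !hf binconvC fh sign1 !mul1r.
by abel.
Qed.

Definition trinary : C :=
  - 6^-1 *: (2^-1 *: (io * L) + ka + 2^-1 *: (io * io * arity0 ((1 - P) * d))).

(** For [f = (e^x - 1) / x], the three series of [gauged_bracket] are, up to
    terms of degree at most 1, multiples of [x b], [b] and [x^2 b], where [b] is
    the series of [nary_weight].  Factoring out [b] leaves the trinary
    cochain. *)
Lemma gauged_bracketE :
  gauged_bracket inv_succ (bernoulli K) =
  arity0 (P * d) - 2^-1 *: L - 2^-1 *: (io * arity0 ((1 - P) * d)) +
  jser nary_weight * trinary.
Proof.
have nz (n : nat) : n.+1%:R != 0 :> K by rewrite pnatr_eq0.
(* The series of x b(x). *)
pose bX : nat -> K := binconv nary_weight seq_X.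
have bXS n : bX n.+1 = 12 * bernoulli K n.+2 / n.+2%:R.
  rewrite /bX binconv_X /nary_weight natrM; field.
  by rewrite nat1r -natrD !pnatr_eq0.
have serbX : jser bX = jser nary_weight * io by rewrite -ser_iot1 serM.
have serbXX : jser (binconv bX seq_X) = jser nary_weight * (io * io).
  by rewrite mulrA -serbX -ser_iot1 serM.
have c1 : jser (seq_sign (binconv (bernoulli K) (seq_tail inv_succ) - seq_unit)) =
    - 2^-1 *: (1 : C) - 6^-1 *: (2^-1 *: (jser nary_weight * io)).
  rewrite -serbX -(ser1 iot) -!serZ -serN -serD; congr ser; apply/funext => n.
  rewrite seqD seqN {1}/seq_sign seqD seqN binconv_inv_succ1 /seq_unit addrAC
    subrr add0r.
  case: n => [|n].
    by rewrite /bX binconv_X mul0r !mulr0 subr0 mulr1 bernoulli1; field.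
  rewrite mulr0 sub0r bXS [LHS]mulrA exprS mulN1r mulNr bernoulli_signS; field.
  by rewrite -natrD pnatr_eq0.
have c2 : jser (seq_sign (binconv (bernoulli K) (seq_tail (seq_tail inv_succ)) -
    binconv (bernoulli K) (seq_tail inv_succ))) = - 6^-1 *: jser nary_weight.
  rewrite -serZ; congr ser; apply/funext => n.
  rewrite /seq_sign seqD seqN binconv_inv_succ2 /nary_weight.
  rewrite -mulrA mulrCA (mulrA _ (bernoulli K _)) bernoulli_signS natrM; field.
  by rewrite nat1r -natrD !pnatr_eq0.
have c3 : jser (seq_sign (bernoulli K)) =
    (1 : C) + 2^-1 *: io + 6^-1 *: (2^-1 *: (jser nary_weight * (io * io))).
  rewrite -serbXX -ser_iot1 -(ser1 iot) -!serZ -!serD; congr ser; apply/funext => n.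
  rewrite bernoulli_sign !seqD binconv_X.
  case: n => [|[|n]].
  - by rewrite bernoulli0 /seq_X mul0r !mulr0 !addr0.
  - by rewrite bernoulli1 /bX binconv_X mul0r !mulr0 add0r addr0 mulr1;
    rewrite -[seq_X 1]/(1 : K); field.
  - rewrite /seq_X !mulr0 !addr0 add0r bXS; field.
    by rewrite -natrD pnatr_eq0.
have dE : arity0 d = arity0 (P * d) + arity0 ((1 - P) * d) :> C.
  by rewrite -arity0D mulrBl mul1r addrC subrK.
rewrite /gauged_bracket /trinary c1 c2 c3 dE.
move: (arity0 ((1 - P) * d)) => e.
rewrite !(mulrDl, mulrDr, mulNr) -!cochain_scalerAr -!cochain_scalerAl !mulrDr.
rewrite -!cochain_scalerAr !mul1r !mulrA !(scalerDr, scaleNr).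
by abel.
Qed.

End TruncatedCartan.

(** * Values of products with a series *)

Section RemoveNth.
Variable T : Type.
Definition remove_nth i (s : seq T) := take i s ++ drop i.+1 s.

Lemma remove_nth0 x s : remove_nth 0 (x :: s) = s.
Proof. by rewrite /remove_nth /= drop0. Qed.

End RemoveNth.

Arguments remove_nth {T} i s.

Lemma remove_nth_map (T T' : Type) (f : T -> T') i s : map f (remove_nth i s) =
  remove_nth i (map f s).
Proof. by rewrite /remove_nth map_cat map_take map_drop. Qed.

Lemma size_remove_nth (T : Type) i (s : seq T) : (i < size s)%N ->
  (size (remove_nth i s)).+1 = size s.
Proof.
by move=> si; rewrite /remove_nth size_cat size_takel ?size_drop ?(ltnW si) //; lia.
Qed.

Lemma remove_nth_filter (T : eqType) (x0 : T) i (s : seq T) : uniq s ->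
  (i < size s)%N ->
  remove_nth i s = [seq x <- s | x != nth x0 s i].
Proof. by move=> us si; rewrite -rem_filter // remE index_uniq. Qed.

Lemma remove_two_index_iota n i j : (i < j)%N -> (j < n.-1)%N ->
  remove_nth i (remove_nth j (index_iota 1 n)) =
  [seq k <- index_iota 1 n | (k != i.+1) && (k != j.+1)].
Proof.
move=> ij jn; have us : uniq (index_iota 1 n) by exact: iota_uniq.
have sL : size (index_iota 1 n) = n.-1 by rewrite size_iota subn1.
have nthL k : (k < n.-1)%N -> nth 0%N (index_iota 1 n) k = k.+1.
  by move=> kn; rewrite nth_iota ?subn1 // add1n.
have st : size (take j (index_iota 1 n)) = j by rewrite size_takel ?sL // ltnW.
have nthi : nth 0%N (remove_nth j (index_iota 1 n)) i = i.+1.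
  by rewrite /remove_nth nth_cat st ij nth_take // nthL // (ltn_trans ij).
rewrite (remove_nth_filter 0%N) ?nthi; last 2 first.
- by rewrite (remove_nth_filter 0%N) ?sL // filter_uniq.
- by rewrite /remove_nth size_cat st ltn_addr.
by rewrite (remove_nth_filter 0%N) ?sL // nthL // -filter_predI.
Qed.

Section ValuesOfSeries.
Context {K : comPzRingType} {V U : lmodType K} (iot : V -> lend U).
Hypothesis iotC : forall x y, iot x * iot y = - (iot y * iot x).
Notation C := (cochain V U).
Implicit Types (s : seq V) (b : nat -> K).

Lemma prod_iot_rev s :
  \prod_(x <- rev s) iot x = (-1) ^+ 'C(size s, 2) *: \prod_(x <- s) iot x.
Proof.
elim: s => [|x s IHs]; first by rewrite big_nil scale1r.
rewrite rev_cons -cats1 big_cat big_seq1 /= IHs -lend_scalerAl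
  prod_iot_iot // scalerA -exprD.
by rewrite big_cons /= binS bin1.
Qed.

Lemma ser_arity1E b (p : V -> lend U) s x0 : (ser iot b * arity1 p : C) s =
  \sum_(j < size s) ((-1) ^+ (size s + j).+1 * b (size s).-1) *:
     ((\prod_(x <- remove_nth j s) iot x) * p (nth x0 s j)).
Proof.
elim: s b => [|x s IHs] b; first by rewrite big_ord0 cochainM_nil mulr0.
rewrite cochainM_cons shift_ser -mulrA arity0M_apply IHs shift_arity1.
rewrite Marity0_apply big_ord_recl addrC; congr (_ + _).
  rewrite /twist /ser {1}/remove_nth take0 /= drop0 addn0 !exprS !mulN1r opprK.
  by rewrite scalerA -lend_scalerAl.
rewrite mulr_sumr; apply: eq_bigr => j _.
rewrite -lend_scalerAr [LHS]/= mulrA lift0 /remove_nth /= big_cons; congr (_ *: _).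
by rewrite addSn addnS !exprS !mulN1r opprK; case: (s) j => [[]|].
Qed.

(** The [i]-th and the [j]-th argument go to the right factor; the sign is that
    of moving them to the end of the list, and depends only on the parity of
    [i + j]. *)
Lemma ser_arity2E b (q : V -> V -> lend U) s x0 : (ser iot b * arity2 q : C) s =
  \sum_(j < size s) \sum_(i < j) ((-1) ^+ (i + j).+1 * b (size s).-2) *:
     ((\prod_(x <- remove_nth i (remove_nth j s)) iot x) * q (nth x0 s i)
       (nth x0 s j)).
Proof.
elim: s b => [|x s IHs] b; first by rewrite big_ord0 cochainM_nil mulr0.
rewrite cochainM_cons shift_ser -mulrA arity0M_apply IHs shift_arity2.
rewrite twist_ser (ser_arity1E _ _ _ x0) big_ord_recl big_ord0 add0r.
rewrite mulr_sumr addrC -big_split; apply: eq_bigr => j _.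
rewrite [RHS]big_ord_recl; congr (_ + _).
  have -> : remove_nth (@ord0 j) (remove_nth (lift ord0 j) (x :: s)) = remove_nth j s.
    exact: remove_nth0.
  rewrite [nth x0 _ _]/= [in RHS]/=; congr (_ *: _).
  move: (nat_of_ord j) (leq_ltn_trans (leq0n _) (ltn_ord j)) => k.
  case: (size s) => // N _.
  rewrite /= /seq_sign /bump add0n add1n mulrA -exprD; congr (_ * _).
  have -> : ((N.+1 + k).+1 + N = 2 * N + k.+2)%N by lia.
  by rewrite exprD exprM sqrrN !expr1n mul1r.
rewrite mulr_sumr; apply: eq_bigr => i _.
rewrite -[remove_nth (lift ord0 i) _]/(x :: remove_nth i (remove_nth j s))
  big_cons -lend_scalerAr mulrA.
rewrite [in RHS]/=; congr (_ *: _).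
rewrite /seq_tail /bump !add1n addSn addnS !exprS !mulN1r opprK.
have ij := ltn_ord i; have js := ltn_ord j.
by congr (_ * b _); lia.
Qed.

Lemma ser_arity2_pair b (q : V -> V -> lend U) x y :
  (ser iot b * arity2 q : C) [:: x; y] = b 0%N *: q x y.
Proof.
rewrite (ser_arity2E _ _ _ x) !big_ord_recl !big_ord0 /remove_nth /=.
by rewrite big_nil mul1r sqrrN expr1n mul1r !add0r !addr0.
Qed.

End ValuesOfSeries.

(** * Brackets of a Lie algebra with a module up to homotopy *)

Section ShuffleSums.
Context {K : comPzRingType} {T : Type} {W : lmodType K}.
Implicit Types (G H : seq T -> seq T -> W) (s u v : seq T).

(** The signed sum over all decompositions of a list into two complementary
    sublists, with the sign of the corresponding unshuffle; every entry of the
    right part passes the entries of the left part that stand after it. *)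
Fixpoint shsum G s : W :=
  if s is x :: s' then
    shsum (fun u v => G (x :: u) v) s' +
    shsum (fun u v => (-1) ^+ size u *: G u (x :: v)) s'
  else G [::] [::].

Lemma shsum_cons G x s : shsum G (x :: s) =
  shsum (fun u v => G (x :: u) v) s +
  shsum (fun u v => (-1) ^+ size u *: G u (x :: v)) s.
Proof. by []. Qed.

Lemma eq_shsum G H s :
  (forall u v, (size u + size v = size s)%N -> G u v = H u v) ->
  shsum G s = shsum H s.
Proof.
elim: s G H => [|x s IHs] G H GH /=; first exact: GH.
congr (_ + _); apply: IHs => u v uv; first by apply: GH; rewrite /= addSn uv.
by rewrite GH //= addnS uv.
Qed.

Lemma shsum_linear a G H s :
  shsum (fun u v => a *: G u v + H u v) s = a *: shsum G s + shsum H s.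
Proof.
elim: s G H => [//|x s IHs] G H /=; rewrite scalerDr addrACA -!IHs.
congr (_ + _); apply: eq_shsum => u v _.
by rewrite scalerDr !scalerA mulrC.
Qed.

Lemma shsumD G H s : shsum (fun u v => G u v + H u v) s = shsum G s + shsum H s.
Proof.
rewrite -[shsum G s]scale1r -shsum_linear; apply: eq_shsum => u v _.
by rewrite scale1r.
Qed.

Lemma shsum0 s : shsum (fun _ _ => 0) s = 0.
Proof.
apply: (addrI (shsum (fun _ _ => 0) s)); rewrite -shsumD [RHS]addr0.
by apply: eq_shsum => u v _; exact: addr0.
Qed.

Lemma shsumZ a G s : shsum (fun u v => a *: G u v) s = a *: shsum G s.
Proof.
rewrite -[RHS]addr0 -[X in _ + X](shsum0 s) -shsum_linear.
by apply: eq_shsum => u v _; rewrite addr0.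
Qed.

Lemma shsumN G s : shsum (fun u v => - G u v) s = - shsum G s.
Proof.
by rewrite -scaleN1r -shsumZ; apply: eq_shsum => u v _; rewrite scaleN1r.
Qed.

Lemma shsum_nil G s : (forall x u v, G (x :: u) v = 0) -> shsum G s = G [::] s.
Proof.
elim: s G => [//|x s IHs] G G0 /=; rewrite IHs => [|y u v]; last exact: G0.
rewrite G0 add0r IHs => [|y u v]; last by rewrite G0 scaler0.
by rewrite scale1r.
Qed.

End ShuffleSums.

Lemma shsum_map (K : comPzRingType) (T T' : Type) (W : lmodType K) (f : T -> T')
    (G : seq T' -> seq T' -> W) s :
  shsum (fun u v => G (map f u) (map f v)) s = shsum G (map f s).
Proof.
elim: s G => [//|x s IHs] G; rewrite [map _ _]/= !shsum_cons -!IHs.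
by congr (_ + _); apply: eq_shsum => u v _; rewrite size_map.
Qed.

Lemma signDmulnS (K : pzRingType) m n :
  (-1) ^+ (m + m * n.+1) = (-1) ^+ (m * n) :> K.
Proof.
by rewrite mulnS addnA addnn -mul2n exprD exprM sqrrN !expr1n mul1r.
Qed.

Section SemidirectBracket.
Context {K : comPzRingType} {V U : lmodType K} (br : V -> V -> V).
Notation C := (cochain V U).
Notation T := (V * U)%type.
Implicit Types (F G : C) (s u v : seq T) (x y z : T).

(** The module component of the bracket on the semidirect sum of [V] and [U]; the
    sign moves the entry whose module component is used to the front. *)
Fixpoint mbr F s : U :=
  if s is x :: s' then F (unzip1 s') x.2 - mbr (shift x.1 F) s' else 0.

Lemma mbr_cons F x s :
  mbr F (x :: s) = F (unzip1 s) x.2 - mbr (shift x.1 F) s.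
Proof. by []. Qed.

Lemma mbr_linear a F G s : mbr (a *: F + G) s = a *: mbr F s + mbr G s.
Proof.
elim: s F G => [|x s IHs] F G; first by rewrite scaler0 addr0.
rewrite !mbr_cons shiftD shiftZ IHs cochainD cochainZ lendD lendZ scalerBr opprD.
exact: addrACA.
Qed.

Lemma mbrD F G s : mbr (F + G) s = mbr F s + mbr G s.
Proof. by have := mbr_linear 1 F G s; rewrite !scale1r. Qed.

Lemma mbr0 s : mbr 0 s = 0.
Proof.
by have := mbr_linear (-1) 0 0 s; rewrite !scaleN1r !addNr.
Qed.

Lemma mbrZ a F s : mbr (a *: F) s = a *: mbr F s.
Proof. by have := mbr_linear a F 0 s; rewrite mbr0 !addr0. Qed.

Lemma mbrN F s : mbr (- F) s = - mbr F s.
Proof. by rewrite -[- F]scaleN1r mbrZ scaleN1r. Qed.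

Lemma mbr_multilinear F s t a x y : multilinear F ->
  mbr F (s ++ (a *: x + y) :: t) =
  a *: mbr F (s ++ x :: t) + mbr F (s ++ y :: t).
Proof.
elim: s F => [|z s IHs] F mF; rewrite ?cat_cons !mbr_cons.
  rewrite multilinear_shiftP // mbr_linear linearP scalerBr opprD.
  exact: addrACA.
rewrite /unzip1 !map_cat /= mF IHs; last exact: multilinear_shift.
rewrite lendD lendZ scalerBr opprD.
exact: addrACA.
Qed.

Lemma mbr_skew F s t x y : skew F ->
  mbr F (s ++ x :: y :: t) = - mbr F (s ++ y :: x :: t).
Proof.
elim: s F => [|z s IHs] F sF; rewrite ?cat_cons !mbr_cons.
  by rewrite (shift_shift _ _ sF) mbrN /shift; abel.
rewrite /unzip1 !map_cat /= sF lendN IHs; last exact: skew_shift.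
by rewrite opprD.
Qed.

(** In a nested bracket the inner arguments [u] come first but the inner operator
    acts first, hence stands on the right; the sign [size u * size v] exchanges
    the two blocks and turns the sum into the shuffle product. *)
Lemma convE F G s :
  shsum (fun u v => (-1) ^+ (size u * size v) *: (F (unzip1 v) * G (unzip1 u))) s =
  (F * G) (unzip1 s).
Proof.
elim: s F G => [|x s IHs] F G; first by rewrite /= mul0n scale1r.
rewrite /= cochainM_cons addrC -!IHs; congr (_ + _); apply: eq_shsum => u v _.
  by rewrite scalerA -exprD signDmulnS.
by rewrite mulSn addnC exprD -scalerA /twist size_map -lend_scalerAl.
Qed.

Lemma lend_shsum (H : seq T -> seq T -> lend U) s w :
  shsum H s w = shsum (fun u v => H u v w) s.
Proof. by elim: s H => [//|x s IHs] H; rewrite !shsum_cons lendD !IHs. Qed.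

(** If the module element lies in the inner bracket, the composite of the two
    operators acts on it.  The twist accounts for the module element, an extra
    entry of the inner block that the arguments of the outer operator pass. *)
Lemma mbr_conv F G s :
  shsum (fun u v => (-1) ^+ (size u * size v) *: F (unzip1 v) (mbr G u)) s =
  mbr (twist F * G) s.
Proof.
elim: s F G => [|x s IHs] F G; first by rewrite /= linear0 scaler0.
rewrite mbr_cons shiftM shift_twist twistK mulNr mbrD mbrN -IHs.
have := IHs (twist F) (shift x.1 G); rewrite twistK => <-.
rewrite -convE lend_shsum shsum_cons.
rewrite opprD opprK addrCA [LHS]addrC; congr (_ + _).
  by apply: eq_shsum => u v _; rewrite scalerA -exprD signDmulnS.
rewrite -shsumN -shsumD; apply: eq_shsum => u v _.
rewrite mbr_cons linearB scalerBr lendZ /twist lendM lendZ lendZ !scalerA -exprD.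
by rewrite size_map mulSn addnC.
Qed.

Definition vbr (u : seq T) : V := if u is [:: x; y] then br x.1 y.1 else 0.
Definition vbr1 (a : V) (u : seq T) : V := if u is [:: y] then br a y.1 else 0.

Lemma thetaE F a s : multilinear F -> skew F ->
  shsum (fun u v => F (vbr1 a u :: unzip1 v)) s = theta br a F (unzip1 s).
Proof.
elim: s F => [|y s IHs] F mF sF.
  by rewrite /= -[LHS]/(shift 0 F [::]) shift_0.
rewrite /= shsum_nil => [|z u v]; last first.
  by rewrite -[LHS]/(shift 0 F _) shift_0.
congr (_ + _).
rewrite -[RHS]/(theta br a (shift y.1 F) (unzip1 s)).
rewrite -IHs; [|exact: multilinear_shift|exact: skew_shift].
apply: eq_shsum => -[|z [|z' u]] v _.
- by rewrite /vbr1 /shift /= -[F _]/(shift 0 F _) scale1r shift_0 // (sF [::])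
  -[F _]/(shift 0 F _) shift_0 ?oppr0.
- by rewrite scaleN1r /shift (sF [::]) opprK.
- by rewrite /vbr1 /shift -[F _]/(shift 0 F _) shift_0 // scaler0 (sF [::])
  -[F _]/(shift 0 F _) shift_0 ?oppr0.
Qed.

Lemma mbr_theta F a s : multilinear F -> skew F ->
  shsum (fun u v => mbr (shift (vbr1 a u) F) v) s = - mbr (theta br a F) s.
Proof.
elim: s F => [|y s IHs] F mF sF; first by rewrite /= oppr0.
rewrite mbr_cons shift_theta mbrD opprB.
have -> : mbr (theta br a (shift y.1 F)) s =
    - shsum (fun u v => mbr (shift (vbr1 a u) (shift y.1 F)) v) s.
  by rewrite IHs ?opprK //; [exact: multilinear_shift|exact: skew_shift].
rewrite -thetaE // lend_shsum shsum_cons shsum_nil => [|z u v]; last first.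
  by rewrite shift_0 // mbr0.
rewrite -addrA; congr (_ + _); rewrite -!shsumN -shsumD.
apply: eq_shsum => u v _; rewrite mbr_cons (shift_shift _ _ sF) mbrN opprK.
rewrite -[F (_ :: _)]/(shift _ F _).
case: u => [|z [|z' u]] /=.
- by rewrite shift_0 // shift_0 ?mbr0 ?lend0 ?addr0 ?scaler0 ?subr0 ?oppr0 //;
  exact: multilinear_shift.
- by rewrite scaleN1r opprD addrC.
- by rewrite shift_0 // shift_0 ?mbr0 ?lend0 ?addr0 ?scaler0 ?subr0 ?oppr0 //;
  exact: multilinear_shift.
Qed.

Lemma signed_vbr (u : seq T) n F (e : C -> U) : multilinear F -> e 0 = 0 ->
  (-1) ^+ (size u * n) *: e (shift (vbr u) F) = e (shift (vbr u) F).
Proof.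
move=> mF e0; case: u => [|x [|y [|z u]]]; rewrite /= ?shift_0 ?e0 ?scaler0 //.
by rewrite exprM sqrrN !expr1n !scale1r.
Qed.

Lemma ceE F s : multilinear F -> skew F ->
  shsum (fun u v => F (vbr u :: unzip1 v)) s = - ce br F (unzip1 s).
Proof.
elim: s F => [|x s IHs] F mF sF.
  by rewrite /= -[LHS]/(shift 0 F [::]) shift_0 // oppr0.
rewrite shsum_cons ce_cons opprB opprK -thetaE //; congr (_ + _).
rewrite -[RHS]opprK -IHs; [|exact: multilinear_shift|exact: skew_shift].
rewrite -shsumN; apply: eq_shsum => u v _; rewrite -(sF [::]) /=.
apply: lendP => w; rewrite lendZ -[size u]muln1.
exact: (signed_vbr u 1 (e := fun G => G (x.1 :: unzip1 v) w)).
Qed.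

(** If the inner bracket is that of two elements of [V], summing over the choice
    of these two is the Chevalley-Eilenberg differential. *)
Lemma mbr_ce F s : multilinear F -> skew F ->
  shsum (fun u v => mbr (shift (vbr u) F) v) s = - mbr (ce br F) s.
Proof.
elim: s F => [|x s IHs] F mF sF; first by rewrite /= oppr0.
rewrite mbr_cons shift_ce mbrD !mbrN -mbr_theta //.
rewrite -IHs; [|exact: multilinear_shift|exact: skew_shift].
rewrite -[ce br F _]opprK -ceE // lendN lend_shsum shsum_cons opprD !opprK addrC.
rewrite addrA; congr (_ + _); rewrite -shsumD; apply: eq_shsum => u v _.
rewrite -[size u]muln1 (signed_vbr u 1 (e := fun G => mbr G (x :: v))) ?mbr0 //.
by rewrite mbr_cons (shift_shift _ _ sF) mbrN opprK addrC.
Qed.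

Definition sbr F s : T := (vbr s, mbr F s).

Hypothesis jacobi : forall a b c : V,
  br a (br b c) = br (br a b) c + br b (br a c).
Hypothesis brC : forall a b : V, br a b = - br b a.

Hypothesis br_linr : forall (k : K) (a b c : V),
  br a (k *: b + c) = k *: br a b + br a c.

Lemma br0 a : br 0 a = 0.
Proof.
by rewrite brC; have := br_linr (-1) a 0 0;
  rewrite scaler0 addr0 scaleN1r addNr => ->; rewrite oppr0.
Qed.

Lemma vbr_jacobi F s :
  shsum (fun u v => (-1) ^+ (size u * size v) *: vbr (sbr F u :: v)) s = 0.
Proof.
case: s => [|x [|y [|z [|w s]]]].
- by rewrite /= scaler0.
- by rewrite /= !br0 !scaler0 addr0.
- by rewrite /= !br0 !scaler0 !addr0.
- rewrite /= -[(2 * 1)%N]/2%N !scaler0 !addr0 sqrrN !expr1n !scale1r.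
  rewrite expr1 scaleN1r add0r (brC (br x.1 z.1)) (brC (br y.1 z.1)) (jacobi x.1).
  by abel.
- rewrite -[RHS](shsum0 [:: x, y, z, w & s]); apply: eq_shsum => u v uv.
  rewrite [X in _ *: X](_ : _ = 0) ?scaler0 //.
  case: v uv => [|b [|c v]] //=; case: u => [|a1 [|a2 [|a3 u]]] //= _; exact: br0.
Qed.

(** The module component of the inner bracket contributes the quadratic term of
    the Maurer-Cartan equation, its component in [V] the differential. *)
Lemma mbr_jacobi F s : multilinear F -> skew F -> twist F * F + ce br F = 0 ->
  shsum (fun u v => (-1) ^+ (size u * size v) *: mbr F (sbr F u :: v)) s = 0.
Proof.
move=> mF sF mc; rewrite -(mbr0 s) -mc mbrD -mbr_conv -[mbr (ce _ _) _]opprK.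
rewrite -mbr_ce // -shsumN -shsumD; apply: eq_shsum => u v _.
rewrite mbr_cons scalerBr.
by rewrite (signed_vbr u (size v) (e := fun G => mbr G v)) ?mbr0.
Qed.

(** For ungraded entries, the L-infinity identities of the semidirect bracket are
    the Jacobi identity together with the Maurer-Cartan equation. *)
Lemma sbr_jacobi F s : multilinear F -> skew F -> twist F * F + ce br F = 0 ->
  shsum (fun u v => (-1) ^+ (size u * size v) *: sbr F (sbr F u :: v)) s = 0.
Proof.
move=> mF sF mc.
have E (G : seq T -> seq T -> T) t :
    shsum G t = (shsum (fun u v => (G u v).1) t, shsum (fun u v => (G u v).2) t).
  elim: t G => [|x t IHt] G; first by rewrite /=; case: (G _ _).
  by rewrite shsum_cons !IHt.
rewrite E; congr pair; first exact: vbr_jacobi.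
exact: mbr_jacobi.
Qed.

End SemidirectBracket.

Section Vanishing.
Context {K : comPzRingType} {V U : lmodType K} (br : V -> V -> V).
Hypothesis brC : forall a b : V, br a b = - br b a.
Hypothesis br_linr : forall (k : K) (a b c : V),
  br a (k *: b + c) = k *: br a b + br a c.
Notation T := (V * U)%type.
Implicit Types (F : cochain V U) (s t u v : seq T) (x y : T).

Definition novec : pred T := fun x => x.1 == 0.

Lemma multilinear0 F (s t : seq V) : multilinear F -> F (s ++ 0 :: t) = 0.
Proof.
move=> mF; have := mF s t (-1) 0 0.
by rewrite scaler0 addr0 scaleN1r addNr.
Qed.

Lemma multilinear_zero F (s : seq V) : multilinear F -> has (fun a : V => a == 0) s ->
  F s = 0.
Proof.
move=> mF /split_find[x s1 s2 /eqP -> _].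
by rewrite cat_rcons; exact: multilinear0.
Qed.

(** At least one of two entries without component in [V] is used through that
    component. *)
Lemma mbr_zero F s : multilinear F -> (1 < count novec s)%N ->
  mbr F s = 0.
Proof.
elim: s F => [//|x s IHs] F mF /= c.
have cs : has (fun a : V => a == 0) (unzip1 s).
  rewrite has_map -[has _ s]/(has novec s) has_count.
  by move: c; case: (novec x); lia.
rewrite (multilinear_zero mF cs) lend0 sub0r.
have [x0|xN0] := eqVneq x.1 0; first by rewrite x0 shift_0 // mbr0 oppr0.
rewrite IHs ?oppr0 //; first exact: multilinear_shift.
by move: c; rewrite /novec (negPf xN0) add0n.
Qed.

Lemma br0r a : br a 0 = 0.
Proof. by rewrite brC (br0 brC br_linr) oppr0. Qed.

Lemma vbr_zero s : has novec s -> vbr br s = 0.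
Proof.
case: s => [|x [|y [|z s]]] //=; rewrite orbF => /orP[] /eqP ->.
  exact: (br0 brC br_linr).
exact: br0r.
Qed.

Lemma sbr_zero F s : multilinear F -> (1 < count novec s)%N ->
  sbr br F s = 0.
Proof.
move=> mF c; rewrite /sbr mbr_zero // vbr_zero // has_count; exact: ltnW.
Qed.

Lemma vbr_multilinear s t (a : K) x y :
  vbr br (s ++ (a *: x + y) :: t) = a *: vbr br (s ++ x :: t) + vbr br (s ++ y :: t).
Proof.
case: s => [|z [|z' s]] /=.
- case: t => [|b [|c t]]; rewrite ?scaler0 ?addr0 //.
  rewrite -[X in br X _]/(a *: x.1 + y.1).
  by rewrite brC br_linr opprD -scalerN -!brC.
- case: t => [|b t]; rewrite ?scaler0 ?addr0 //.
- by case: s => [|? ?] /=; rewrite scaler0 addr0.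
Qed.

Lemma vbr_skew s t x y : vbr br (s ++ x :: y :: t) = - vbr br (s ++ y :: x :: t).
Proof.
case: s => [|z [|z' s]] /=; last by case: s => [|? ?] /=; rewrite oppr0.
- by case: t => [|b t]; rewrite ?oppr0.
- by rewrite oppr0.
Qed.

Lemma sbr_multilinear F s t (a : K) x y : multilinear F ->
  sbr br F (s ++ (a *: x + y) :: t) =
  a *: sbr br F (s ++ x :: t) + sbr br F (s ++ y :: t).
Proof. by move=> mF; congr pair; [exact: vbr_multilinear|exact: mbr_multilinear]. Qed.

Lemma sbr_skew F s t x y : skew F ->
  sbr br F (s ++ x :: y :: t) = - sbr br F (s ++ y :: x :: t).
Proof. by move=> sF; congr pair; [exact: vbr_skew|exact: mbr_skew]. Qed.

Lemma sbr_entry0 F s t : multilinear F -> sbr br F (s ++ 0 :: t) = 0.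
Proof.
move=> mF; have := sbr_multilinear s t (-1) 0 0 mF.
by rewrite scaler0 addr0 scaleN1r addNr.
Qed.

Lemma sbr_sbr_zero F u v : multilinear F ->
  (1 < count novec (u ++ v))%N -> sbr br F (sbr br F u :: v) = 0.
Proof.
move=> mF; rewrite count_cat => c.
have [cu|cu] := ltnP 1 (count novec u).
  by rewrite (sbr_zero mF cu); exact: (sbr_entry0 [::]).
apply: sbr_zero => //=.
have hn : has novec u -> novec (sbr br F u).
  by move=> hu; rewrite /novec /sbr /= vbr_zero.
by move: hn c cu; rewrite has_count; case: (novec _); lia.
Qed.

Lemma eq_mbr0 F s :
  (forall (t : seq V) x, (size t).+1 = size s -> x \in s -> F t x.2 = 0) ->
  mbr F s = 0.
Proof.
elim: s F => [//|x s IHs] F F0; rewrite mbr_cons F0 ?mem_head ?size_map //.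
rewrite IHs ?subr0 // => t y ts ys; apply: (F0 (x.1 :: t)); first by rewrite /= ts.
by rewrite inE ys orbT.
Qed.

End Vanishing.

Section ModulePositions.
Context {K : comPzRingType} {V U : lmodType K}.
Implicit Types (F : cochain V U) (s : seq (V * U)).

Lemma mbrE F s x0 : mbr F s =
  \sum_(p < size s) (-1) ^+ p *: F (unzip1 (remove_nth p s)) (nth x0 s p).2.
Proof.
elim: s F => [|x s IHs] F; first by rewrite big_ord0.
rewrite big_ord_recl mbr_cons expr0 scale1r {1}/remove_nth take0 /= drop0.
congr (_ + _); rewrite IHs -sumrN; apply: eq_bigr => p _.
by rewrite exprS mulN1r scaleNr.
Qed.
End ModulePositions.

(** * Unshuffles as permutations *)

Section Shuffles.

Definition permute (T : Type) (s : seq T) (sigma : 'S_(size s)) : seq T :=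
  [seq tnth (in_tuple s) (sigma k) | k <- enum 'I_(size s)].

Arguments permute {T} s sigma.

Lemma size_permute T (s : seq T) sigma : size (permute s sigma) = size s.
Proof. by rewrite size_map size_enum_ord. Qed.

Lemma nth_permute T (x0 : T) (s : seq T) (sigma : 'S_(size s)) (k : 'I_(size s)) :
  nth x0 (permute s sigma) k = nth x0 s (sigma k).
Proof.
rewrite (nth_map k) ?size_enum_ord // nth_ord_enum.
exact: tnth_nth.
Qed.

(** The permutation that sends position [k] to the head of the list inserts that
    head at position [k] of a permutation of the tail. *)
Lemma permute_lift T (x : T) (s : seq T) (k : 'I_(size s).+1) (sigma : 'S_(size s)) :
  permute (x :: s) (lift_perm k ord0 sigma) =
  take k (permute s sigma) ++ x :: drop k (permute s sigma).
Proof.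
have kn : (k <= size s)%N by rewrite -ltnS.
apply: (@eq_from_nth _ x).
  by rewrite size_cat /= size_drop size_takel !size_permute ?subnKC /= ?addnS ?subnKC.
rewrite size_permute => j jn; pose j' : 'I_(size (x :: s)) := Ordinal jn.
rewrite -[j]/(nat_of_ord j') nth_permute nth_cat size_takel ?size_permute //.
case: (unliftP k j') => [a|] ->; last by rewrite lift_perm_id ltnn subnn.
rewrite lift_perm_lift -[nth x (x :: s) _]/(nth x s (sigma a)) -nth_permute /= /bump.
have [ka|ka] := leqP k a; rewrite ?add1n ?add0n.
  by rewrite ltnNge (leqW ka) subSn //= nth_drop subnKC.
by rewrite ka nth_take.
Qed.

Lemma shuffleP n i (sigma : 'S_n) :
  reflect (forall a b : 'I_n, (a < b)%N -> (b < i)%N || (i <= a)%N ->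
             (sigma a < sigma b)%N) (shuffle i sigma).
Proof.
apply: (iffP forallP) => [h a b ab bi|h a]; last first.
  by apply/forallP => b; apply/implyP => /andP[]; exact: h.
by have /forallP /(_ b) /implyP := h a; apply; rewrite ab.
Qed.

(** In an unshuffle into blocks of sizes [i] and [n + 1 - i], the smallest value
    stands at the head of the first block or at the head of the second. *)
Lemma shuffle_lift n (k : 'I_n.+1) (sigma : 'S_n) i :
  shuffle i (lift_perm k ord0 sigma) =
  ((k == i :> nat) && shuffle i sigma) ||
  [&& k == 0%N :> nat, (0 < i)%N & shuffle i.-1 sigma].
Proof.
apply/shuffleP/idP => [h|].
  have h0 (a b : 'I_n) : (a < b)%N -> (lift k b < i)%N || (i <= lift k a)%N ->
    (sigma a < sigma b)%N.
    move=> ab lab; have := h (lift k a) (lift k b).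
    rewrite !lift_perm_lift !lift0 ltnS; apply=> //.
    by rewrite /= /bump; lia.
  have [ki|ki] := eqVneq (k : nat) i.
    apply/orP; left; apply/shuffleP => a b ab abi; apply: h0 => //.
    by rewrite /= /bump; lia.
  have [k0|k0] := eqVneq (k : nat) 0%N.
    apply/orP; right; apply/and3P; split=> //; first by lia.
    apply/shuffleP => a b ab abi; apply: h0 => //.
    by rewrite /= /bump; lia.
  have [ltki|leik] := ltnP k i.
    have := h ord0 k; rewrite lift_perm_id ltn0; apply; first by rewrite lt0n.
    by rewrite ltki.
  have in1 : (i < n.+1)%N by apply: leq_ltn_trans leik _.
  have := h (Ordinal in1) k; rewrite lift_perm_id ltn0 leqnn orbT; apply=> //=.
  by rewrite ltn_neqAle eq_sym ki.
case/orP => [/andP[/eqP ki /shuffleP h]|/and3P[/eqP k0 i0 /shuffleP h]] a b.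
  case: (unliftP k a) => [a'|] ->; case: (unliftP k b) => [b'|] ->.
  - rewrite !lift_perm_lift !lift0 ltnS => ab abi; apply: h.
      by move: ab; rewrite /= /bump; lia.
    by move: ab abi; rewrite /= /bump; lia.
  - by move=> ab; lia.
  - by rewrite lift_perm_id lift_perm_lift lift0.
  - by rewrite ltnn.
case: (unliftP k a) => [a'|] ->; case: (unliftP k b) => [b'|] ->.
- rewrite !lift_perm_lift !lift0 ltnS => ab abi; apply: h.
    by move: ab; rewrite /= /bump; lia.
  by move: ab abi; rewrite /= /bump; lia.
- by move=> ab; lia.
- by rewrite lift_perm_id lift_perm_lift lift0.
- by rewrite ltnn.
Qed.

Lemma lift_perm0_bij n :
  bijective (fun p : 'I_n.+1 * 'S_n => lift_perm p.1 ord0 p.2).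
Proof.
apply: inj_card_bij => [[k s] [k' s'] /= e|]; last first.
  by rewrite card_prod card_ord !card_Sn factS.
have kk : k = k'.
  apply: (perm_inj (s := lift_perm k ord0 s)).
  by rewrite lift_perm_id e lift_perm_id.
rewrite kk in e *; congr pair; apply/permP => a.
by apply: (@lift_inj _ ord0); rewrite -!(lift_perm_lift k' ord0) e.
Qed.

(** Induction on the list: the head of the list opens the left block or the right
    one, and in the latter case the sign of the insertion is
    that of passing the whole left block, which is the sign built into
    [shsum]. *)
Lemma sum_shuffles (K : comPzRingType) (T : Type) (W : lmodType K)
    (G : seq T -> seq T -> W) (s : seq T) :
  \sum_(i < (size s).+1) \sum_(sigma : 'S_(size s) | shuffle i sigma)
    (-1) ^+ sigma *: G (take i (permute s sigma)) (drop i (permute s sigma)) =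
  shsum G s.
Proof.
elim: s G => [|x s IHs] G.
  rewrite big_ord1 (big_pred1 1%g) => [|sigma]; last first.
    have -> : sigma = 1%g by apply/permP; case.
    by rewrite [RHS]eqxx; apply/shuffleP; case.
  by rewrite odd_perm1 scale1r /permute enum_ord0.
rewrite shsum_cons -!IHs.
pose H i (k : 'I_(size s).+1) (sigma : 'S_(size s)) : W :=
  let p := permute (x :: s) (lift_perm k ord0 sigma) in
  (-1) ^+ lift_perm k ord0 sigma *: G (take i p) (drop i p).
(* A permutation of [x :: s] is the position [k] of [x] and a permutation of [s];
   [shuffle_lift] leaves the positions [k = i] and [k = 0]. *)
have split i : \sum_(sigma : 'S_(size (x :: s)) | shuffle i sigma)
      (-1) ^+ sigma *: G (take i (permute (x :: s) sigma))
                         (drop i (permute (x :: s) sigma)) =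
    \sum_(k < (size s).+1) \sum_(sigma : 'S_(size s))
      (if (k == i :> nat) && shuffle i sigma then H i k sigma else 0) +
    \sum_(k < (size s).+1) \sum_(sigma : 'S_(size s))
      (if [&& k == 0%N :> nat, (0 < i)%N & shuffle i.-1 sigma]
       then H i k sigma else 0).
  rewrite (reindex _ (onW_bij _ (lift_perm0_bij _))) big_mkcond /=.
  rewrite -(pair_big predT predT (fun (k : 'I_(size s).+1) (sigma : 'S_(size s)) =>
     if shuffle i (lift_perm k ord0 sigma) then H i k sigma else 0)) /=.
  rewrite -big_split; apply: eq_bigr => k _; rewrite -big_split.
  apply: eq_bigr => sigma _; rewrite shuffle_lift /=.
  have [ki|] := eqVneq (k : nat) i; last by rewrite /= add0r.
  have [k0|] := eqVneq (k : nat) 0%N; last by rewrite orbF addr0.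
  by rewrite -ki k0 /= orbF addr0.
under eq_bigr => i _ do rewrite split.
rewrite big_split /= addrC; congr (_ + _).
  rewrite big_ord_recl big1 ?add0r => [|k _]; last first.
    by rewrite big1 // => sigma _; rewrite andbF.
  apply: eq_bigr => i _;
    rewrite big_ord_recl [X in _ + X]big1 ?addr0 => [|k _]; last first.
    by rewrite big1.
  rewrite [RHS]big_mkcond; apply: eq_bigr => sigma _ /=; case: ifP => // _.
  rewrite /H permute_lift take0 drop0 /= odd_lift_perm /=.
  by [].
rewrite exchange_big; apply: eq_bigr => k _ /=.
have kn : (k <= size s)%N by rewrite -ltnS.
rewrite (bigD1 (widen_ord (leqnSn _) k)) //= [X in _ + X]big1 ?addr0 => [|i];
  last first.
  rewrite -val_eqE /= eq_sym => /negPf ik; apply: big1 => sigma _.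
  by rewrite ik.
rewrite [RHS]big_mkcond; apply: eq_bigr => sigma _; rewrite eqxx /=;
  case: ifP => // _.
rewrite /H permute_lift odd_lift_perm /= addbF signr_addb signr_odd.
have tk : size (take k (permute s sigma)) = k by rewrite size_takel ?size_permute.
rewrite take_size_cat // drop_size_cat // tk scalerA mulrC.
by [].
Qed.

End Shuffles.
Arguments permute {T} s sigma.

Lemma count_permute (T : Type) (a : pred T) (s : seq T) (sigma : 'S_(size s)) :
  count a (permute s sigma) = count a s.
Proof.
have E (f : 'I_(size s) -> T) : count a [seq f k | k <- enum 'I_(size s)] =
    (\sum_(k < size s | a (f k)) 1)%N.
  by rewrite -sum1_count big_map big_enum_cond.
transitivity (\sum_(k < size s | a (tnth (in_tuple s) k)) 1)%N.
  by rewrite E [RHS](reindex_perm sigma).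
by rewrite -E map_tnth_enum.
Qed.

Lemma big_permute (I : nmodType) (T : Type) (f : T -> I) (s : seq T)
  (sigma : 'S_(size s)) :
  \sum_(x <- permute s sigma) f x = \sum_(x <- s) f x.
Proof.
transitivity (\sum_(k < size s) f (tnth (in_tuple s) k)).
  by rewrite big_map big_enum [RHS](reindex_perm sigma).
by rewrite -big_enum -(big_map _ predT f) map_tnth_enum.
Qed.

(** A Koszul sign requires two entries of odd degree to be exchanged. *)
Lemma antisym_sign_le1 (K : fieldType) (V : int -> lmodType K) (s : seq (homog V))
    (sigma : 'S_(size s)) :
  (count (fun x : homog V => tag x != 0%R) s <= 1)%N -> antisym_sign sigma =
    (-1) ^+ sigma.
Proof.
move=> c; rewrite /antisym_sign big1 ?mulr1 // => a _;
  rewrite big1 // => b /andP[ab _].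
set x := tnth _ _; set y := tnth _ _.
suff -> : tag x * tag y = 0 by rewrite expr0z.
apply/eqP; rewrite mulf_eq0; apply: contraLR c;
  rewrite negb_or -ltnNge => /andP[x0 y0].
have -> : count (fun z => tag z != 0) s =
    count (fun z => tag z != 0) (map (tnth (in_tuple s)) (enum 'I_(size s))).
  by rewrite map_tnth_enum.
rewrite -sum1_count big_map big_enum_cond sum1_card.
apply/card_gt1P; exists (sigma a), (sigma b); split=> //.
by rewrite (inj_eq perm_inj) -val_eqE ltn_eqF.
Qed.

(** * Cartan calculus and degrees of differential forms *)

Section FormOperators.
Context {R : realType} {m : nat} {M : manifold R m}.
Notation V := (vfield M).
Notation W := (form M).
Implicit Types (X Y Z : V) (w v : W) (s t u : seq V).

Lemma form_ext w v : w =1 v -> w = v.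
Proof. by move=> wv; apply/val_inj/funext. Qed.

Lemma formD w v s : (w + v) s = w s + v s. Proof. by []. Qed.
Lemma formN w s : (- w) s = - w s. Proof. by []. Qed.
Lemma formZ a w s : (a *: w) s = a *: w s. Proof. by []. Qed.
Lemma form0 s : (0 : W) s = 0. Proof. by []. Qed.

Lemma contract_linear X : linear (contract X : W -> W).
Proof. by move=> a w v; exact: form_ext. Qed.

Lemma lieD_linear X : linear (lieD X : W -> W).
Proof.
move=> a w v; apply: form_ext => s; rewrite formD formZ /=.
rewrite /lieD_fun vfieldD vfieldZ big_split /= -scaler_sumr scalerBr opprD.
exact: addrACA.
Qed.

Lemma extd_linear : linear (extd : W -> W).
Proof.
move=> a w v; apply: form_ext => s; rewrite formD formZ /=.
rewrite /extd_fun scalerDr addrACA; congr (_ + _).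
  rewrite scaler_sumr -big_split; apply: eq_bigr => i _ /=.
  by rewrite vfieldD vfieldZ mulrDr Cinf_scalerAr.
rewrite scaler_sumr -big_split; apply: eq_bigr => j _ /=.
rewrite scaler_sumr -big_split; apply: eq_bigr => i _ /=.
by rewrite mulrDr Cinf_scalerAr.
Qed.

Definition iotE X : lend W := mk_lend (contract_linear X).
Definition lieE X : lend W := mk_lend (lieD_linear X).
Definition dE : lend W := mk_lend extd_linear.

Lemma form_linear w s t (a : R) X Y :
  w (s ++ (a *: X + Y) :: t) = a *: w (s ++ X :: t) + w (s ++ Y :: t).
Proof.
have -> : a *: X = fmul (a *: (1 : Cinf M)) X.
  by apply: vfieldP => f; rewrite /= mulrC -Cinf_scalerAr mulr1.
by rewrite (formP w).1 mulrC -Cinf_scalerAr mulr1.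
Qed.

Lemma lie_linr (a : R) X Y Z : lie X (a *: Y + Z) = a *: lie X Y + lie X Z.
Proof.
apply: vfieldP => f.
change (X (a *: Y f + Z f) - (a *: Y (X f) + Z (X f)) =
        a *: (X (Y f) - Y (X f)) + (X (Z f) - Z (X f))).
by rewrite vfieldD vfieldZ scalerBr opprD addrACA.
Qed.

Lemma lie_linl (a : R) X Y Z : lie (a *: Y + Z) X = a *: lie Y X + lie Z X.
Proof. by rewrite lie_anti lie_linr !(lie_anti _ X) scalerN opprD !opprK. Qed.

Lemma lie_jacobi X Y Z : lie X (lie Y Z) = lie (lie X Y) Z + lie Y (lie X Z).
Proof.
apply: vfieldP => f; rewrite vfield_addE /= !vfieldD !vfieldN.
by abel.
Qed.

Lemma iotE_linear (a : R) X Y : iotE (a *: X + Y) = a *: iotE X + iotE Y.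
Proof.
apply: lendP => w; apply: form_ext => s; rewrite lendD lendZ formD formZ /=.
exact: (form_linear w [::]).
Qed.

Lemma lieE_linear (a : R) X Y : lieE (a *: X + Y) = a *: lieE X + lieE Y.
Proof.
apply: lendP => w; apply: form_ext => s; rewrite lendD lendZ formD formZ /=.
rewrite /lieD_fun vfield_addE vfield_scaleE scalerBr scaler_sumr addrACA.
congr (_ + _); rewrite -opprD -big_split; congr (- _).
by apply: eq_bigr => i _; rewrite lie_linl form_linear.
Qed.

Lemma iotE_anti X Y : iotE X * iotE Y = - (iotE Y * iotE X).
Proof.
apply: lendP => w; apply: form_ext => s; rewrite lendN formN.
exact: (form_swap (formP w) [::] [::]).
Qed.

Lemma lieE_iotE X Y : lieE X * iotE Y = iotE Y * lieE X + iotE (lie X Y).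
Proof.
apply: lendP => w; apply: form_ext => s; rewrite lendD formD.
rewrite -[(iotE Y * lieE X) w s]/(lieD_fun X w (Y :: s)) lieD_fun_cons.
exact/esym/subrK.
Qed.

Lemma dE_iotE X : dE * iotE X = lieE X - iotE X * dE.
Proof.
apply: lendP => w; apply: form_ext => s; rewrite lendD lendN formD formN.
rewrite -[(iotE X * dE) w s]/(extd_fun w (X :: s)) (cartan_fun _ _ (formP w)).
by rewrite opprB addrCA subrr addr0.
Qed.

Lemma dE_nil w : (dE w) [::] = 0.
Proof. by rewrite /= /extd_fun !big_ord0 addr0. Qed.

Lemma lieE_nil X w : (lieE X w) [::] = X (w [::]).
Proof. by rewrite /= /lieD_fun big_ord0 subr0. Qed.

Lemma iotE_dE X : iotE X * dE = lieE X - dE * iotE X.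
Proof. by rewrite dE_iotE opprB addrCA subrr addr0. Qed.

Lemma iotE_lieE X Y : iotE Y * lieE X = lieE X * iotE Y - iotE (lie X Y).
Proof. by rewrite lieE_iotE addrK. Qed.

(** An operator on forms is determined by the degree 0 part of its values and its
    commutation with interior products.  Cartan calculus follows: each
    commutator below commutes with interior products up to sign, and its values
    have no part of degree 0. *)
Lemma lend_form_eq0 (e : lend W) (c : R) : (forall w, e w [::] = 0) ->
  (forall X, iotE X * e = c *: (e * iotE X)) -> e = 0.
Proof.
move=> e0 eS; apply: lendP => w; apply: form_ext => s.
elim: s w => [|X s IHs] w; first exact: e0.
rewrite -[LHS]/((iotE X * e) w s) eS lendZ formZ lendM IHs.
by rewrite form0 scaler0.
Qed.

Lemma lieE_br X Y : lieE X * lieE Y - lieE Y * lieE X = lieE (lie X Y).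
Proof.
apply/eqP; rewrite -subr_eq0; apply/eqP.
apply: (@lend_form_eq0 _ 1) => [w|Z].
  rewrite !(lendD, lendN) !(formD, formN) !lendM !lieE_nil.
  by rewrite -[lie X Y _]/(X (Y _) - Y (X _)) subrr.
have E A B : iotE Z * (lieE A * lieE B) = lieE A * (lieE B * iotE Z) -
    lieE A * iotE (lie B Z) - (lieE B * iotE (lie A Z) - iotE (lie B (lie A Z))).
  by rewrite [LHS]mulrA iotE_lieE mulrBl -mulrA !iotE_lieE mulrBr.
have := iotE_linear 1 (lie (lie X Y) Z) (lie Y (lie X Z)).
rewrite !scale1r -lie_jacobi => J.
rewrite !(mulrBl, mulrBr) !E iotE_lieE J -!mulrA.
by abel.
Qed.

Lemma dE_lieE X : dE * lieE X = lieE X * dE.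
Proof.
apply/eqP; rewrite -subr_eq0; apply/eqP.
apply: (@lend_form_eq0 _ (-1)) => [w|Z].
  by rewrite lendD lendN formD formN !lendM dE_nil lieE_nil dE_nil vfield0 subrr.
have E1 : iotE Z * (dE * lieE X) =
    lieE Z * lieE X - (dE * lieE X * iotE Z - dE * iotE (lie X Z)).
  by rewrite [LHS]mulrA iotE_dE mulrBl -[dE * iotE Z * _]mulrA iotE_lieE mulrBr mulrA.
have E2 : iotE Z * (lieE X * dE) =
    lieE X * lieE Z - lieE X * dE * iotE Z - iotE (lie X Z) * dE.
  by rewrite [LHS]mulrA iotE_lieE mulrBl -[_ * iotE Z * dE]mulrA iotE_dE mulrBr mulrA.
by rewrite scaleN1r mulrBr E1 E2 mulrBl dE_iotE -lieE_br; abel.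
Qed.

Lemma dE_dE : dE * dE = 0.
Proof.
apply: (@lend_form_eq0 _ 1) => [w|Z]; first by rewrite lendM dE_nil.
rewrite scale1r [LHS]mulrA iotE_dE mulrBl -[dE * iotE Z * _]mulrA iotE_dE.
by rewrite mulrBr -dE_lieE -mulrA; abel.
Qed.

Section Truncation.
Variable r : nat.

Lemma trunc_subproof w : (fun s => if (size s < r)%N then w s else 0) \in
  form_pred (M := M).
Proof.
have [wl wa] := formP w; apply: form_in; split=> [s t f X Y|s t u X].
  by rewrite !size_cat /=; case: ifP => _; rewrite ?wl // mulr0 addr0.
by case: ifP => _; rewrite ?wa.
Qed.

(** The projection to forms of degree less than [r], for forms evaluated on lists
    of all lengths. *)
Definition trunc w : W := MkForm (trunc_subproof w).

Lemma truncE w s : trunc w s = if (size s < r)%N then w s else 0.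
Proof. by []. Qed.

Lemma trunc_linear : linear trunc.
Proof.
move=> a w v; apply: form_ext => s; rewrite formD formZ !truncE.
by case: ifP => _; rewrite ?formD ?formZ ?scaler0 ?addr0.
Qed.

Definition truncL : lend W := mk_lend trunc_linear.

Lemma size_omit i s : (i < size s)%N -> (size (omit i s)).+1 = size s.
Proof. by move=> si; rewrite /omit size_cat size_takel ?size_drop ?(ltnW si)//;
  lia. Qed.

(** The value of [d w] on [s] depends only on the component of [w] of degree one
    less than the length of [s]. *)
Lemma eq_extd_size (w v : seq V -> Cinf M) s :
  (forall u, (size u).+1 = size s -> w u = v u) -> extd_fun w s = extd_fun v s.
Proof.
move=> wv; rewrite /extd_fun; congr (_ + _); apply: eq_bigr => i _.
  by rewrite wv // size_omit.
apply: eq_bigr => j _; rewrite wv //=.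
have oj := size_omit (ltn_ord i).
by rewrite size_omit ?oj // -ltnS oj (leq_ltn_trans (ltn_ord j)).
Qed.

Lemma truncL_truncL : truncL * truncL = truncL.
Proof.
apply: lendP => w; apply: form_ext => s.
by rewrite lendM !truncE; case: ifP => // ->.
Qed.

Lemma truncL_lieE X : truncL * lieE X = lieE X * truncL.
Proof.
apply: lendP => w; apply: form_ext => s; rewrite !lendM.
rewrite truncE -[lieE X w s]/(lieD_fun X w s).
rewrite -[RHS]/(lieD_fun X (trunc w) s) /lieD_fun truncE.
case: ifP => sr; last first.
  rewrite vfield0 big1 ?subr0 // => i _; rewrite truncE ifF //.
  by rewrite size_cat /= size_takel ?size_drop ?(ltnW (ltn_ord i)) //; have :=
    ltn_ord i; lia.
congr (_ - _); apply: eq_bigr => i _; rewrite truncE ifT //.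
by rewrite size_cat /= size_takel ?size_drop ?(ltnW (ltn_ord i)) //; have :=
  ltn_ord i; lia.
Qed.

Lemma truncL_dE : truncL * dE * truncL = truncL * dE.
Proof.
apply: lendP => w; apply: form_ext => s; rewrite !lendM !truncE.
case: ifP => // sr; apply: eq_extd_size => u us.
by rewrite truncE ifT //; lia.
Qed.

Lemma truncL_iotE X : truncL * iotE X * truncL = iotE X * truncL.
Proof.
apply: lendP => w; apply: form_ext => s; rewrite !lendM truncE.
rewrite -[iotE X _ s]/(trunc w (X :: s)) truncE /=.
by case: ifP => // sr; rewrite ifF //; lia.
Qed.

Lemma dE_iotE_truncL X : (1 - truncL) * dE * iotE X * truncL = 0.
Proof.
apply: lendP => w; apply: form_ext => s; rewrite !lendM lendD lendN lend1 formD formN.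
rewrite truncE; case: ifP => sr; first exact: subrr.
rewrite oppr0 addr0 -[RHS](extd_fun0 s); apply: eq_extd_size => u us.
by rewrite -[iotE X _ u]/(trunc w (X :: u)) truncE ifF //=; lia.
Qed.

End Truncation.

End FormOperators.

Section Degrees.
Context {R : realType} {m : nat} {M : manifold R m}.
Notation V := (vfield M).
Notation W := (form M).
Notation C := (cochain V W).
Implicit Types (X Y Z : V) (w v : W) (s t u : seq V) (k : int) (F G : C).

Lemma has_degreeD k w v : has_degree k w -> has_degree k v -> has_degree k (w + v).
Proof. by move=> hw hv s sk; rewrite formD hw ?hv ?addr0. Qed.

Lemma has_degreeZ k a w : has_degree k w -> has_degree k (a *: w).
Proof. by move=> hw s sk; rewrite formZ hw ?scaler0. Qed.

Lemma has_degreeN k w : has_degree k w -> has_degree k (- w).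
Proof. by move=> hw s sk; rewrite formN hw ?oppr0. Qed.

Lemma has_degree0 k : has_degree k (0 : W). Proof. by []. Qed.

Lemma has_degree_contract k X w : has_degree k w -> has_degree (k - 1) (contract X w).
Proof. by move=> hw s sk; apply: hw => /=; lia. Qed.

Lemma has_degree_lieD k X w : has_degree k w -> has_degree k (lieD X w).
Proof.
move=> hw s sk; rewrite /= /lieD_fun hw // vfield0 big1 ?subr0 // => i _.
apply: hw; rewrite size_cat /= size_takel ?size_drop ?(ltnW (ltn_ord i)) //.
by have := ltn_ord i; lia.
Qed.

Lemma has_degree_extd k w : has_degree k w -> has_degree (k + 1) (extd w).
Proof.
move=> hw s sk; rewrite -[RHS](extd_fun0 s); apply: eq_extd_size => u us.
by apply: hw; lia.
Qed.

Lemma has_degree_trunc r k w : has_degree k w -> has_degree k (trunc r w).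
Proof. by move=> hw s sk; rewrite truncE hw //; case: ifP. Qed.

Lemma trunc_id r k w : has_degree k w -> k < r%:Z -> trunc r w = w.
Proof.
move=> hw kr; apply: form_ext => s; rewrite truncE; case: ifP => // sr.
by rewrite hw //; lia.
Qed.

Lemma trunc_0 r k w : has_degree k w -> r%:Z <= k -> trunc r w = 0.
Proof.
move=> hw kr; apply: form_ext => s; rewrite truncE; case: ifP => // sr.
by rewrite hw //; lia.
Qed.

(** [p] is the degree by which a cochain raises the total degree, where each
    vector field argument has degree 1; this grading is additive under
    products. *)
Definition raises (p : int) F := forall s k w, has_degree k w ->
  has_degree (k + p - (size s)%:Z) (F s w).

Lemma raisesD p F G : raises p F -> raises p G -> raises p (F + G).
Proof. by move=> rF rG s k w hw; apply: has_degreeD; [exact: rF|exact: rG]. Qed.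

Lemma raisesN p F : raises p F -> raises p (- F).
Proof. by move=> rF s k w hw; apply: has_degreeN; exact: rF. Qed.

Lemma raises_twist p F : raises p F -> raises p (twist F).
Proof. by move=> rF s k w hw; apply: has_degreeZ; exact: rF. Qed.

Lemma raises_shift p X F : raises p F -> raises (p - 1) (shift X F).
Proof.
move=> rF s k w hw; have := rF (X :: s) k w hw; rewrite /= /shift.
by congr has_degree; lia.
Qed.

Lemma raisesM p q F G : raises p F -> raises q G -> raises (p + q) (F * G).
Proof.
move=> rF rG s; elim: s p q F G rF rG => [|X s IHs] p q F G rF rG k w hw.
  have := rF [::] _ _ (rG [::] _ _ hw); rewrite cochainM_nil lendM /=.
  by congr has_degree; lia.
rewrite cochainM_cons; apply: has_degreeD.
  have := IHs _ _ _ _ (raises_shift X rF) rG k w hw.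
  by congr has_degree; rewrite /=; lia.
have := IHs _ _ _ _ (raises_twist rF) (raises_shift X rG) k w hw.
by congr has_degree; rewrite /=; lia.
Qed.

Lemma raises_arity0 p (e : lend W) :
  (forall k w, has_degree k w -> has_degree (k + p) (e w)) -> raises p (arity0 e).
Proof.
move=> he [|X s] k w hw; last exact: has_degree0.
by have := he k w hw; congr has_degree; rewrite /=; lia.
Qed.

Lemma raises_arity1 p (e : V -> lend W) :
  (forall X k w, has_degree k w -> has_degree (k + p) (e X w)) ->
  raises (p + 1) (arity1 e).
Proof.
move=> he [|X [|Y s]] k w hw; try exact: has_degree0.
by have := he X k w hw; congr has_degree; rewrite /=; lia.
Qed.

Lemma raises_arity2 p (e : V -> V -> lend W) :
  (forall X Y k w, has_degree k w -> has_degree (k + p) (e X Y w)) ->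
  raises (p + 2) (arity2 e).
Proof.
move=> he [|X [|Y [|Z s]]] k w hw; try exact: has_degree0.
by have := he X Y k w hw; congr has_degree; rewrite /=; lia.
Qed.

Lemma raises_ser b : raises 0 (ser iotE b : C).
Proof.
move=> s k w hw; rewrite /ser lendZ; apply: has_degreeZ.
rewrite addr0; elim: s => [|X s IHs]; first by rewrite big_nil subr0.
rewrite big_cons lendM.
have := has_degree_contract X IHs.
by congr has_degree; rewrite /=; lia.
Qed.

End Degrees.

(** * The cochain of the Courant bracket *)

Section CourantCochain.
Context {R : realType} {m : nat} {M : manifold R m} (r : nat).
Notation V := (vfield M).
Notation W := (form M).
Notation C := (cochain V W).
Implicit Types (X Y Z : V) (w v : W) (s t u : seq V).
Local Notation P := (truncL r : lend W).
Local Notation top := ((1 - P) * dE).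

(** The gauge transform of the strict action by [(e^x - 1) / x]; its values on
    forms of degree less than [r] are the brackets to be constructed. *)
Definition courant_cochain : C :=
  gauged (@lie _ _ M) iotE lieE dE P inv_succ (bernoulli R).
Local Notation Phi := courant_cochain.

Lemma courant_maurer_cartan : twist Phi * Phi + ce (@lie _ _ M) Phi = 0.
Proof.
apply: gauged_maurer_cartan.
- exact: iotE_linear.
- exact: lie_jacobi.
- exact: iotE_anti.
- exact: lieE_br.
- exact: dE_dE.
- exact: dE_lieE.
- exact: truncL_lieE.
- exact: truncL_dE.
- by rewrite binconvC bernoulli_inv.
Qed.

Lemma ser_alternating b : alternating (ser iotE b : C).
Proof.
by split; [exact: ser_multilinear iotE_linear _|exact: ser_skew iotE_anti _].
Qed.

Lemma iot_lie_alternating : alternating (arity2 (fun X Y => iotE (lie X Y)) : C).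
Proof.
apply: alternating_arity2 => [Z a X Y|X Y]; first by rewrite lie_linr iotE_linear.
by rewrite lie_anti (iotN iotE_linear).
Qed.

(** In the definition the differential of a series occurs; [ce_ser] replaces it
    by a product of alternating cochains. *)
Lemma courant_alternating : alternating Phi.
Proof.
rewrite /courant_cochain /gauged (ce_ser _ iotE_anti) opprK.
apply: alternatingM; first exact/alternating_twist/ser_alternating.
apply: alternatingD; last first.
  apply: alternatingM; last exact: iot_lie_alternating.
  exact/alternating_twist/ser_alternating.
apply: alternatingM; last exact: ser_alternating.
apply: alternatingD; first exact: alternating_arity0.
apply/alternatingN/alternating_arity1 => a X Y; exact: lieE_linear.
Qed.

(** The last term vanishes on forms of degree less than [r - 1].  On forms of
    degree [r - 1] it turns the formula for lower forms into the cyclic sum of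
    pairings with Courant brackets. *)
Definition trinary_pair X Y : lend W := - 6^-1 *:
  (2^-1 *: (iotE X * lieE Y - iotE Y * lieE X) + iotE (lie X Y)
   + iotE X * iotE Y * top).

Lemma trinaryE : trinary (@lie _ _ M) iotE lieE dE P = arity2 trinary_pair.
Proof.
rewrite /trinary !arity1M -[arity2 _ * _]/(arity2 _ * arity0 _).
apply: cochainP => s.
rewrite cochainZ !cochainD !cochainZ Marity0_apply.
case: s => [|X [|Y [|Z s]]] /=; rewrite ?mul0r ?scaler0 ?addr0 ?scaler0 //.
rewrite /trinary_pair (iotE_anti Y X) opprK mulrDl -!mulrA.
by congr (_ *: (_ + _)); rewrite scalerDr half_sum.
Qed.

Lemma courantE s w : trunc r w = w -> Phi s w =
  (arity0 (P * dE) s - 2^-1 *: arity1 lieE s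
   - 2^-1 *: (arity1 iotE s * top) +
     (ser iotE nary_weight * arity2 trinary_pair : C) s) w.
Proof.
move=> rw; have E : (Phi * arity0 P) s w =
    (gauged_bracket (@lie _ _ M) iotE lieE dE P inv_succ (bernoulli R) * arity0
      P) s w.
  congr ((_ : cochain V W) s w); apply: gaugedE.
  - exact: iotE_linear.
  - move=> X Y; exact: lie_anti.
  - exact: iotE_anti.
  - exact: lieE_iotE.
  - exact: dE_iotE.
  - exact: truncL_truncL.
  - exact: truncL_iotE.
  - exact: dE_iotE_truncL.
  - exact: invr1.
  - by rewrite binconvC bernoulli_inv.
move: E; rewrite !Marity0_apply !lendM -[P w]/(trunc r w) rw => ->.
rewrite gauged_bracketE ?trinaryE; last exact: iotE_anti.
by rewrite !cochainD !cochainN !cochainZ Marity0_apply.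
Qed.

Lemma nary_weight0 : nary_weight 0 = 1 :> R.
Proof.
rewrite /nary_weight bernoulliS !big_ord_recl big_ord0 /= bernoulli0 bernoulli1.
by rewrite bin0 bin1; field.
Qed.

Lemma courant_pair X Y w : trunc r w = w -> Phi [:: X; Y] w = trinary_pair X Y w.
Proof.
move=> rw; rewrite courantE // ser_arity2_pair.
rewrite nary_weight0 scale1r -[arity0 _ _]/(0 : lend W).
rewrite -[arity1 lieE _]/(0 : lend W) -[arity1 iotE _]/(0 : lend W).
by rewrite mul0r scaler0 !subr0 add0r.
Qed.

(** Reversing the order of interior products costs the sign of the reversal. *)
Lemma contract_omitE n i j (X : nat -> V) w : (i < j)%N -> (j < n.-1)%N ->
  contract_omit n i.+1 j.+1 X w = (-1) ^+ 'C(n - 3, 2) *: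
    (\prod_(Y <- remove_nth i (remove_nth j [seq X k | k <- index_iota 1 n]))
      iotE Y) w.
Proof.
move=> ij jn; rewrite /contract_omit -remove_two_index_iota // -!remove_nth_map.
have fE (l : seq nat) v : foldl (fun w k => contract (X k) w) v l =
    (\prod_(Y <- rev (map X l)) iotE Y) v.
  elim: l v => [|k l IHl] v; first by rewrite big_nil.
  by rewrite /= IHl rev_cons -cats1 big_cat big_seq1.
rewrite fE (prod_iot_rev iotE_anti) lendZ; congr (_ ^+ 'C(_, 2) *: _).
have sL : size (index_iota 1 n) = n.-1 by rewrite size_iota subn1.
have sj : (size (remove_nth j (index_iota 1 n))).+1 =
  n.-1 by rewrite size_remove_nth sL.
have si := @size_remove_nth _ i (remove_nth j (index_iota 1 n)).
by rewrite size_map; lia.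
Qed.

(** The terms of arity at most 1 vanish for length reasons, and in arity
    [n - 1] the product of the series with the trinary cochain is a sum over the
    pairs of arguments that the trinary bracket takes. *)
Lemma courant_nary n (X : nat -> V) w : odd n -> (3 <= n)%N -> trunc r w = w ->
  Phi [seq X k | k <- index_iota 1 n] w =
  nary_bracket n X (fun i j => Phi [:: X i; X j] w).
Proof.
move=> on n3 rw; have [k nk] : exists k, n = k.*2.+3.
  by exists (n - 3)./2; rewrite -[LHS]odd_double_half; lia.
have sL : size [seq X k | k <- index_iota 1 n] = n.-1.
  by rewrite size_map size_iota subn1.
rewrite courantE // (ser_arity2E _ _ _ _ (X 0%N)) sL /nary_bracket.
have -> : arity0 (P * dE) [seq X k | k <- index_iota 1 n] = 0 :> lend W.
  by case: (map _ _) sL => //=; lia.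
have -> : arity1 lieE [seq X k | k <- index_iota 1 n] = 0 :> lend W.
  by case: (map _ _) sL => [|? []] //=; lia.
have -> : arity1 iotE [seq X k | k <- index_iota 1 n] = 0 :> lend W.
  by case: (map _ _) sL => [|? []] //=; lia.
rewrite mul0r scaler0 !subr0 add0r big_add1 big_mkord scaler_sumr.
have sumE I (l : seq I) (f : I -> lend W) :
    (\sum_(a <- l) f a) w = \sum_(a <- l) f a w.
  exact: (big_morph (fun f : lend W => f w) (fun f g => lendD f g w) (lend0 w)).
(* As n = 2 k + 3, the sign (-1)^(k (2 k - 1)) of the reversal equals (-1)^k and
   cancels the sign (-1)^((n + 1) / 2) of the coefficient. *)
have sign_bin : (-1) ^+ 'C(n - 3, 2) = (-1) ^+ k :> R.
  rewrite (_ : (n - 3)%N = k.*2); last by lia.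
  rewrite bin2 -doubleMl doubleK -signr_odd oddM.
  case: k {nk} => [|k]; first by [].
  by rewrite -[RHS]signr_odd doubleS /= odd_double andbT.
rewrite sumE; apply: eq_bigr => j _; rewrite sumE big_add1 big_mkord scaler_sumr.
apply: eq_bigr => i _; have ij := ltn_ord i; have jn := ltn_ord j.
rewrite contract_omitE // courant_pair // sign_bin.
rewrite !(nth_map 0%N) ?size_iota ?subn1 // ?(ltn_trans ij) //.
rewrite !nth_iota ?subn1 // ?(ltn_trans ij) // !add1n.
rewrite lendZ lendM !scalerA; congr (_ *: _).
move: (nat_of_ord i) => a {i ij}; move: (nat_of_ord j) => b {j jn}.
rewrite /nary_coef /nary_weight nk -[k.*2.+3.-1.-2]/k.*2 -[k.*2.+3.-1]/k.*2.+2
  -[k.*2.+2.-1]/k.*2.+1.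
have -> : (k.*2.+4./2 = k.+2)%N by rewrite -!doubleS doubleK.
rewrite !addSn !addnS addn0 !exprS !mulN1r !opprK.
have ss : (-1) ^+ k * (-1) ^+ k = 1 :> R.
  by rewrite -exprD addnn -signr_odd odd_double.
rewrite -[LHS]mul1r -[X in X * _ = _]ss.
by move: (_ ^+ k) (_ ^+ (a + b)) (_%:R^-1) => c1 c2 c3; ring.
Qed.

Lemma courant_raises : raises 1 (courant_cochain : C).
Proof.
rewrite /courant_cochain /gauged (ce_ser _ iotE_anti) opprK -[1]add0r.
have tb b := raises_twist (raises_ser b).
apply: raisesM => //; apply: raisesD; last first.
  rewrite -[1]add0r; apply: raisesM => //.
  apply: (raises_arity2 (p := -1)) => X Y k w; exact: has_degree_contract.
rewrite -[1]addr0; apply: raisesM; last exact: raises_ser.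
apply: raisesD.
  apply: raises_arity0 => k w hw; apply: has_degree_trunc; exact: has_degree_extd.
apply: raisesN; rewrite -[1]add0r; apply: raises_arity1 => X k w hw.
by rewrite addr0; exact: has_degree_lieD.
Qed.

End CourantCochain.

(** * The Lie r-algebra *)

Section CourantBracket.
Context {R : realType} {m : nat} {M : manifold R m} (r : nat).
Notation V := (vfield M).
Notation W := (form M).
Notation cpx := (courant_complex M r).
Notation H := (homog (courant_complex M r)).
Implicit Types (x y : H) (s t u v : seq H).
Local Notation Phi := (courant_cochain r : cochain V W).

(** Homogeneous elements of all degrees are seen in the one space where the
    semidirect bracket lives; an element of nonzero degree has no vector
    component. *)
Definition entry x : V * W := component_val (tagged x : component M r (tag x)).

Lemma entryP x : in_component r (tag x) (entry x).
Proof. by case: x => i [e he] /=; apply/asboolP. Qed.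

Lemma entry_novec x : tag x != 0 -> novec (entry x).
Proof.
move=> x0; have := entryP x; rewrite /in_component (negPf x0) /novec.
by case: ifP => _ => [[-> _]|->]; rewrite eqxx.
Qed.

Lemma entry_degree x : has_degree (r%:Z - 1 + tag x) (entry x).2.
Proof.
have := entryP x; rewrite /in_component; case: eqP => [->|_]; first by rewrite addr0.
by case: ifP => _ => [[]//|->]; exact: has_degree0.
Qed.

Arguments entry_degree : clear implicits.

Lemma entry_pos x : 0 < tag x -> entry x = 0.
Proof.
by move=> x0; have := entryP x; rewrite /in_component gt_eqF // lt_gtF.
Qed.

Lemma entry_trunc x : trunc r (entry x).2 = (entry x).2.
Proof.
have [x0|x0] := ltP 0 (tag x).
  by rewrite entry_pos //; apply: form_ext => s; rewrite truncE; case: ifP.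
by apply: (trunc_id (entry_degree x)); lia.
Qed.

Definition bracket_value s : V * W := sbr (@lie _ _ M) Phi (map entry s).

Definition tag_sum s : int := \sum_(x <- s) tag x.

Lemma tag_sum_cons x s : tag_sum (x :: s) = tag x + tag_sum s.
Proof. exact: big_cons. Qed.

Lemma tag_sum0 s : ~~ has (fun x => tag x != 0) s -> tag_sum s = 0.
Proof.
move=> /hasPn h; rewrite /tag_sum big_seq big1 // => x /h.
by rewrite negbK => /eqP.
Qed.

Lemma has_entry_novec s : has (fun x => tag x != 0) s -> has novec (map entry s).
Proof. by rewrite has_map; apply: sub_has => x; exact: entry_novec. Qed.

(** A form entry of degree [k] has degree [k - r + 1] in the complex, and the
    terms with the wrong form entry vanish because entries of nonzero degree
    have no vector component; so the degrees of all entries add up. *)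
Lemma mbr_degree p (F : cochain V W) s : multilinear F -> raises p F ->
  has_degree (r%:Z + tag_sum s + p - (size s)%:Z) (mbr F (map entry s)).
Proof.
elim: s p F => [|x s IHs] p F mF rF; first exact: has_degree0.
rewrite [map _ _]/= mbr_cons; apply: has_degreeD; last first.
  apply: has_degreeN; have [x0|x0] := eqVneq (tag x) 0; last first.
    by move: (entry_novec x0) => /eqP ->; rewrite shift_0 // mbr0; exact: has_degree0.
  have := IHs _ _ (multilinear_shift (entry x).1 mF) (raises_shift (entry x).1 rF).
  by congr has_degree; rewrite tag_sum_cons x0 /=; lia.
have [h|h] := boolP (has (fun x => tag x != 0) s).
  rewrite (multilinear_zero mF); first exact: has_degree0.
  have := has_entry_novec h; rewrite !has_map; exact.
have := rF (unzip1 (map entry s)) _ _ (entry_degree x).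
by congr has_degree; rewrite tag_sum_cons tag_sum0 // !size_map /=; lia.
Qed.

Lemma courant_multilinear : multilinear Phi.
Proof. exact: (courant_alternating r).1. Qed.

Lemma courant_skew : skew Phi.
Proof. exact: (courant_alternating r).2. Qed.

Lemma courant_nil w : trunc r w = w -> Phi [::] w = trunc r (extd w).
Proof.
move=> rw; rewrite courantE // cochainM_nil mulr0 addr0.
rewrite -[arity1 lieE _]/(0 : lend W) -[arity1 iotE _]/(0 : lend W).
by rewrite mul0r scaler0 !subr0.
Qed.

Lemma courant_one X w : trunc r w = w -> Phi [:: X] w =
  - (2^-1 *: lieD X w) - 2^-1 *: contract X (extd w - trunc r (extd w)).
Proof.
move=> rw; rewrite courantE // cochainM_cons.
rewrite -[arity0 _ _]/(0 : lend W) -[arity1 lieE _]/(lieE X)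
  -[arity1 iotE _]/(iotE X).
rewrite shift_ser -mulrA arity0M_apply cochainM_nil mulr0 mulr0 add0r.
rewrite add0r cochainM_nil -[shift X _ _]/(0 : lend W) mulr0 addr0.
by [].
Qed.

Lemma lieC (X Y : V) : lie X Y = - lie Y X. Proof. exact: lie_anti. Qed.

Lemma vbr_value0 s : bracket_degree s != 0 -> vbr (@lie _ _ M) (map entry s) = 0.
Proof.
have [h _|h] := boolP (has novec (map entry s)).
  exact (vbr_zero lieC (@lie_linr _ _ M) h).
have ts : tag_sum s = 0.
  by apply: tag_sum0; apply: contra h; exact: has_entry_novec.
rewrite /bracket_degree -/(tag_sum s) ts.
by case: s {h ts} => [|x [|y [|z s]]].
Qed.

(** The bracket has the right form degree by [mbr_degree].  In negative degree its
    vector component vanishes, as some entry has nonzero degree or the arity is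
    not 2.  In positive degree everything vanishes: entries of positive degree
    are zero, and a bracket of entries of degree at most 0 has positive degree
    only for the differential of an element of degree 0, where the truncation
    makes it zero. *)
Lemma bracket_value_in s : bracket_value s \in component_pred (M := M) r
  (bracket_degree s).
Proof.
apply/asboolP; rewrite /in_component.
have dv : has_degree (r%:Z - 1 + bracket_degree s) (bracket_value s).2.
  have := mbr_degree (s := s) courant_multilinear (@courant_raises _ _ M r).
  by congr has_degree; rewrite /bracket_degree -/(tag_sum s); lia.
case: eqP => [e0|/eqP e0]; first by move: dv; rewrite e0 addr0.
case: ifP => [_|e1]; first by split=> //; exact: vbr_value0.
have {e1}e1 : 0 < bracket_degree s by rewrite lt_neqAle eq_sym e0 leNgt e1.
rewrite /bracket_value /sbr vbr_value0 //; congr pair.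
have [h|h] := boolP (has (fun x => 0 < tag x) s).
  move: h => /split_find[x s1 s2 x0 _]; rewrite cat_rcons map_cat /= entry_pos //.
  have := sbr_entry0 lieC (@lie_linr _ _ M) (map entry s1) (map entry s2)
    courant_multilinear.
  by move=> /(congr1 snd).
have le0 x : x \in s -> tag x <= 0 by move: h => /hasPn h /h; rewrite -leNgt.
have ts : tag_sum s <= 0 by rewrite /tag_sum big_seq sumr_le0.
move: e1 e0 ts le0; rewrite /bracket_degree -/(tag_sum s).
case: s {dv h} => [//|x [|y s]] e1 e0 ts le0; last by move: e1 ts; rewrite /=; lia.
have x0 : tag x = 0.
  have := le0 x (mem_head _ _); move: e1;
    rewrite tag_sum_cons /tag_sum big_nil /=; lia.
rewrite [LHS]mbr_cons -[mbr (shift _ _) _]/(0 : W) subr0 courant_nil ?entry_trunc //.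
apply: (trunc_0 (has_degree_extd (entry_degree x))).
by rewrite x0; lia.
Qed.

Definition component_of (e : int) (p : V * W) : component M r e :=
  insubd (0 : component M r e) p.

Lemma component_ofK e p : p \in component_pred (M := M) r e ->
  component_val (component_of e p) = p.
Proof. exact: insubdK. Qed.

(** Total in the degree [e]: zero outside the one degree that the bracket
    allows. *)
Definition courant_lbr s (e : int) : cpx e :=
  if e == bracket_degree s then component_of e (bracket_value s) else 0.

Lemma courant_lbrE s : component_val (courant_lbr s (bracket_degree s)) =
  bracket_value s.
Proof. by rewrite /courant_lbr eqxx component_ofK // bracket_value_in. Qed.

Lemma courant_lbr_degree s e : e != bracket_degree s -> courant_lbr s e = 0.
Proof. by rewrite /courant_lbr => /negPf ->. Qed.

End CourantBracket.
Arguments entry {R m M r} x.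
Arguments entry_degree {R m M r} x.

Section CourantLinfty.
Context {R : realType} {m : nat} {M : manifold R m} (r : nat).
Notation V := (vfield M).
Notation W := (form M).
Notation cpx := (courant_complex M r).
Notation H := (homog (courant_complex M r)).
Implicit Types (x y : H) (s t u v : seq H).
Local Notation Phi := (courant_cochain r : cochain V W).
Local Notation sbrP := (sbr (@lie _ _ M) Phi).

Lemma component_inj e : injective (@component_val R m M r e).
Proof. exact: val_inj. Qed.

Lemma courant_lbr_val s e : e = bracket_degree s ->
  component_val (courant_lbr s e) = bracket_value s.
Proof. by move=> ->; exact: courant_lbrE. Qed.

Lemma courant_lbr0 s e : bracket_value s = 0 -> courant_lbr s e = 0.
Proof.
move=> s0; have [ee|] := eqVneq e (bracket_degree s); last exact: courant_lbr_degree.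
by apply: component_inj; rewrite courant_lbr_val.
Qed.

Lemma bracket_degree_cat s t (x : H) :
  bracket_degree (s ++ x :: t) =
    tag_sum s + tag x + tag_sum t + 1 - (size s + size t)%:Z.
Proof.
rewrite /bracket_degree big_cat big_cons -/(tag_sum s) -/(tag_sum t) size_cat /=.
by lia.
Qed.

Lemma courant_lbr_linear s t (i : int) (a : R) (x y : cpx i) (e : int) :
  courant_lbr (s ++ Tagged cpx (a *: x + y) :: t) e =
  a *: courant_lbr (s ++ Tagged cpx x :: t) e + courant_lbr
    (s ++ Tagged cpx y :: t) e.
Proof.
have bd (z : cpx i) : bracket_degree (s ++ Tagged cpx z :: t) =
    tag_sum s + i + tag_sum t + 1 - (size s + size t)%:Z.
  exact: bracket_degree_cat.
have [ee|en] := eqVneq e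
  (tag_sum s + i + tag_sum t + 1 - (size s + size t)%:Z); last first.
  by rewrite !courant_lbr_degree ?bd // scaler0 addr0.
apply: component_inj; rewrite courant_lbr_val ?bd //.
rewrite -[RHS]/(a *: component_val _ + component_val _) !courant_lbr_val ?bd //.
rewrite /bracket_value !map_cat /=.
exact: (sbr_multilinear lieC (@lie_linr _ _ M) _ _ _ _ _
  (@courant_multilinear _ _ M r)).
Qed.

Lemma courant_lbr_skew s t x y (e : int) :
  courant_lbr (s ++ x :: y :: t) e =
  (- (-1) ^ (tag x * tag y)) *: courant_lbr (s ++ y :: x :: t) e.
Proof.
have bd x' y' : bracket_degree (s ++ x' :: y' :: t) =
    tag_sum s + (tag x' + tag y') + tag_sum t - (size s + size t)%:Z.
  by rewrite bracket_degree_cat tag_sum_cons /=; lia.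
have [ee|en] := eqVneq e
  (tag_sum s + (tag x + tag y) + tag_sum t - (size s + size t)%:Z);
    last first.
  by rewrite !courant_lbr_degree ?scaler0 ?bd // (addrC (tag y)).
apply: component_inj; rewrite -[RHS]/(_ *: component_val _).
rewrite !courant_lbr_val ?bd //; last by rewrite ee (addrC (tag x)).
(* Two entries of nonzero degree make both sides vanish, and otherwise the Koszul
   sign is trivial. *)
have [xy0|] := boolP ((tag x == 0) || (tag y == 0)); last first.
  rewrite negb_or => /andP[x0 y0].
  have z x' y' : novec (entry x') -> novec (entry y') ->
    bracket_value (s ++ x' :: y' :: t) = 0.
    move=> hx hy; apply: (sbr_zero lieC (@lie_linr _ _ M)
      (@courant_multilinear _ _ M r)).
    by rewrite map_cat count_cat /= hx hy; lia.
  by rewrite !z ?scaler0 //; exact: entry_novec.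
have -> : tag x * tag y = 0 by apply/eqP; rewrite mulf_eq0.
rewrite expr0z scaleN1r /bracket_value !map_cat /=.
exact (sbr_skew lieC _ _ _ _ (@courant_skew _ _ M r)).
Qed.

Lemma courant_lbr_nil e : courant_lbr [::] e = 0 :> cpx e.
Proof. exact: courant_lbr0. Qed.

Lemma component_sum e (I : Type) (l : seq I) (P : pred I) (f : I -> component M r e) :
  component_val (\sum_(i <- l | P i) f i) = \sum_(i <- l | P i) component_val (f i).
Proof. by apply: (big_morph (@component_val _ _ M r e)). Qed.

(** If at most one entry has nonzero degree the Koszul signs are trivial, and the
    identity is [sbr_jacobi] by [sum_shuffles].  Otherwise every term vanishes by
    [sbr_sbr_zero]. *)
Lemma courant_lbr_jacobi s (e : int) : (0 < size s)%N ->
  \sum_(1 <= i < (size s).+1) \sum_(sigma : 'S_(size s) | shuffle i sigma)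
      (let j := ((size s).+1 - i)%N in
       let u := take i (permuted sigma) in
       (antisym_sign sigma * (-1) ^+ (i * (j - 1))) *:
         courant_lbr (Tagged cpx (courant_lbr u (bracket_degree u)) ::
                      drop i (permuted sigma)) e)
    = 0.
Proof.
move=> s0.
have size_p (sigma : 'S_(size s)) : size (permuted sigma) =
  size s by exact: size_permute.
have bd i (sigma : 'S_(size s)) : (i <= size s)%N ->
    let u := take i (permuted sigma) in
    bracket_degree (Tagged cpx (courant_lbr u (bracket_degree u)) ::
       drop i (permuted sigma)) = tag_sum s + 3 - (size s)%:Z.
  move=> i_s u; rewrite -[_ :: _]cat0s bracket_degree_cat [tag_sum [::]]big_nil /=.
  have <- : tag_sum u + tag_sum (drop i (permuted sigma)) = tag_sum s.
    rewrite /tag_sum -big_cat cat_take_drop; exact: big_permute.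
  rewrite /bracket_degree -/(tag_sum u) -/(tag_sum (drop i (permuted sigma))).
  by rewrite /u size_takel ?size_p // size_drop size_p; lia.
have [ee|en] := eqVneq e (tag_sum s + 3 - (size s)%:Z); last first.
  rewrite big_nat big1 // => i /andP[_ i_s]; rewrite big1 // => sigma _ /=.
  by rewrite courant_lbr_degree ?bd // scaler0.
apply: component_inj; rewrite component_sum -[RHS]/(0 : V * W).
pose G u v : V * W :=
  (-1) ^+ (size u * size v) *: sbrP (sbrP (map entry u) :: map entry v).
have GE : shsum G s = 0.
  have := sbr_jacobi (@lie_jacobi _ _ M) lieC (@lie_linr _ _ M) (map entry s)
    (@courant_multilinear _ _ M r) (@courant_skew _ _ M r) (courant_maurer_cartan r).
  rewrite -shsum_map => E; rewrite -[RHS]E; apply: eq_shsum => u v _.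
  by rewrite /G !size_map.
(* The sum over all decompositions also contains those with an empty inner
   bracket, whose outer bracket has a zero entry. *)
rewrite -[RHS]GE -sum_shuffles big_ord_recl [X in _ = X + _]big1
  ?add0r => [|sigma _]; last first.
  rewrite take0 /G /=.
  by rewrite (sbr_entry0 lieC (@lie_linr _ _ M) [::]) ?scaler0 //;
    exact: courant_multilinear.
rewrite big_add1 /= big_mkord; apply: eq_bigr => i _.
rewrite component_sum; apply: eq_bigr => sigma _.
have i_s : (i.+1 <= size s)%N by exact: ltn_ord.
rewrite -[LHS]/((_ * _) *: component_val _) courant_lbr_val
  ?bd // /bracket_value [map _ _]/=.
rewrite -[entry _]/(component_val _) courant_lbrE.
rewrite /bump add1n -/(permute s sigma).
have su : size (take i.+1 (permute s sigma)) = i.+1.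
  by rewrite size_takel // size_permute.
have sv : size (drop i.+1 (permute s sigma)) = (size s - i.+1)%N.
  by rewrite size_drop size_permute.
have [c|c] := leqP (count (fun x : H => tag x != 0%R) s) 1.
  rewrite antisym_sign_le1 // -scalerA /G su sv /bracket_value.
  by congr (_ *: (_ ^+ (_ * _) *: _)); lia.
rewrite /G /bracket_value (sbr_sbr_zero lieC (@lie_linr _ _ M)) ?scaler0 //.
  exact: courant_multilinear.
rewrite -map_cat cat_take_drop count_map.
apply: leq_trans c _; rewrite -(count_permute _ sigma).
by apply: sub_count => x; exact: entry_novec.
Qed.

Definition courant_Linfty : Linfty_algebra cpx := LinftyAlgebra
  courant_lbr_nil (@courant_lbr_degree _ _ M r) courant_lbr_linear courant_lbr_skew
  courant_lbr_jacobi.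

Hypothesis r_gt0 : (0 < r)%N.

Lemma courant_concentrated (i : int) (x : cpx i) : ~~ (1 - r%:Z <= i <= 0) -> x = 0.
Proof.
move=> hi; apply: component_inj; have := entryP (Tagged cpx x).
rewrite /in_component /= -/(entry (Tagged cpx x)); case: eqP => [i0|/eqP i0].
  by move: hi i0; lia.
case: ifP => [i1|_ ->] // [x1 x2]; rewrite -[LHS]/(entry (Tagged cpx x)).
rewrite [LHS]surjective_pairing x1; congr pair; apply: form_ext => s.
by rewrite x2 //; lia.
Qed.

Definition courant_Lie_algebra : Lie_algebra cpx r :=
  @LieAlgebra _ _ _ courant_Linfty courant_concentrated.

End CourantLinfty.

(** * The formulas of the brackets *)

Section Formulas.
Context {R : realType} {m : nat} {M : manifold R m} (r : nat).
Notation V := (vfield M).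
Notation W := (form M).
Notation H := (homog (courant_complex M r)).
Implicit Types (x y : H) (s t u v : seq H) (w a b c : W) (X Y Z : V).
Local Notation Phi := (courant_cochain r : cochain V W).

(** An odd number of vector field arguments picks a Bernoulli number of odd index
    at least 3. *)
Lemma courant_odd (s : seq V) w : odd (size s) -> (3 <= size s)%N -> trunc r w = w ->
  Phi s w = 0.
Proof.
case: s => [|X [|Y [|Z s]]] // os _ rw; rewrite courantE //.
rewrite (ser_arity2E _ _ _ _ X) big1 => [|j _]; last first.
  rewrite big1 // => i _; rewrite nary_weight_odd ?mulr0 ?scale0r //.
  by move: os; rewrite /= !negbK.
rewrite -[arity0 _ _]/(0 : lend W) -[arity1 lieE _]/(0 : lend W).
by rewrite -[arity1 iotE _]/(0 : lend W) mul0r scaler0 !subr0 addr0.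
Qed.

(** For a form of degree at most [r - 2] the truncation keeps [d w], so that the
    correction terms with [(1 - P) * d] disappear. *)
Lemma courant_below_top w : trunc r w = w -> trunc r (extd w) = extd w ->
  forall X Y, (Phi [:: X] w = - (2^-1 *: lieD X w)) /\
  (Phi [:: X; Y] w =
    - 6^-1 *: (2^-1 *: (contract X (lieD Y w) - contract Y (lieD X w))
     + contract (lie X Y) w)).
Proof.
move=> rw rd X Y; rewrite courant_one // courant_pair // rd subrr; split.
  by rewrite -[contract X 0]/(iotE X 0) linear0 scaler0 subr0.
rewrite /trinary_pair lendZ !lendD lendZ !lendD !lendN !lendM.
rewrite -[X in _ + iotE _ (iotE _ X)]/(extd w - trunc r (extd w)).
rewrite rd subrr !linear0 addr0.
by [].
Qed.

(** For a form of degree [r - 1] the truncation kills [d w], so that the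
    correction terms with [(1 - P) * d] contain the full differential. *)
Lemma courant_at_top w : trunc r w = w -> trunc r (extd w) = 0 ->
  forall X Y, (Phi [:: X] w = - (2^-1 *: lieD X w) - 2^-1 *: contract X (extd w)) /\
  (Phi [:: X; Y] w =
    - 6^-1 *: (2^-1 *: (contract X (lieD Y w) - contract Y (lieD X w))
     + contract (lie X Y) w + contract X (contract Y (extd w)))).
Proof.
move=> rw rd X Y; rewrite courant_one // courant_pair // rd subr0; split=> //.
rewrite /trinary_pair lendZ !lendD lendZ !lendD !lendN !lendM.
rewrite -[X in _ + iotE _ (iotE _ X)]/(extd w - trunc r (extd w)).
by rewrite rd subr0.
Qed.

Lemma bracket_value_allowed s : ~~ allowed_entries s -> bracket_value s = 0.
Proof.
have [c|c] := leqP (count (fun x : H => tag x != 0%R) s) 1; last first.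
  move=> _; apply: (sbr_zero lieC (@lie_linr _ _ M));
    first exact: courant_multilinear.
  rewrite count_map; apply: leq_trans c _.
  by apply: sub_count => x; exact: entry_novec.
rewrite /allowed_entries c !andbT.
case: s c => [//|x [|y [|z s]]] c /=.
- move=> x0.
  have {x0}x0 : tag x = 0 by apply/eqP; move: x0; case: (tag x == 0).
  congr pair; rewrite [LHS]mbr_cons -[mbr (shift _ _) _]/(0 : W) subr0.
  rewrite courant_nil ?entry_trunc // (trunc_0 (has_degree_extd (entry_degree x))) //.
  by rewrite x0; lia.
- by [].
rewrite (_ : (2 < (size s).+3)%N = true) // andbT !negbK => os; congr pair.
apply: eq_mbr0 => t p; rewrite size_map => -[ts] /mapP[q _ ->].
apply: courant_odd (entry_trunc q); rewrite ts //= ?negbK //.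
by case: (s) os.
Qed.

Lemma contractC X Y w : contract X (contract Y w) = - contract Y (contract X w).
Proof. by have /(congr1 (fun f : lend W => f w)) := iotE_anti X Y. Qed.

Lemma extd_contract X w : extd (contract X w) = lieD X w - contract X (extd w).
Proof. by have /(congr1 (fun f : lend W => f w)) := dE_iotE X. Qed.

Lemma contractNl X w : contract (- X) w = - contract X w.
Proof. by have /(congr1 (fun f : lend W => f w)) := iotN iotE_linear X. Qed.
Lemma contractD X w c : contract X (w + c) = contract X w + contract X c.
Proof. exact: form_ext. Qed.
Lemma contractN X w : contract X (- w) = - contract X w.
Proof. exact: form_ext. Qed.
Lemma contractZ X (k : R) w : contract X (k *: w) = k *: contract X w.
Proof. exact: form_ext. Qed.

(** Cartan's formula splits half of each Lie derivative of the Courant bracket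
    against the exact term, which leaves a sum of a contribution of each form
    entry, as the semidirect bracket requires. *)
Lemma courant_snd (e1 e2 : V * W) : (courant e1 e2).2 =
  2^-1 *: lieD e1.1 e2.2 + 2^-1 *: contract e1.1 (extd e2.2)
  - (2^-1 *: lieD e2.1 e1.2 + 2^-1 *: contract e2.1 (extd e1.2)).
Proof.
rewrite /courant /= -[extd (_ - _)]/(dE _) linearB /= !extd_contract.
rewrite -{1}(half_sum (lieD e1.1 e2.2)) -{1}(half_sum (lieD e2.1 e1.2)).
by rewrite !(scalerDr, scalerN, opprD, opprK); abel.
Qed.

Lemma mbr_novec F (p : V * W) s : multilinear F -> p.1 = 0 ->
  mbr F (p :: map entry s) = F (unzip1 (map entry s)) p.2.
Proof. by move=> mF p0; rewrite mbr_cons p0 shift_0 // mbr0 subr0. Qed.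

Lemma bracket_value3 s : (3 <= size s)%N -> bracket_value s =
  (0, mbr Phi (map entry s)).
Proof. by case: s => [|? [|? [|? ?]]]. Qed.

Section Components.
Implicit Types e : component M r 0.

Lemma trunc_form e : trunc r e.2 = e.2. Proof. exact: (entry_trunc (elt e)). Qed.
Lemma trunc_extd_form e : trunc r (extd e.2) = 0.
Proof.
apply: (trunc_0 (has_degree_extd (entry_degree (elt e)))).
by rewrite /=; lia.
Qed.

Variables (i : int) (xi : component M r i).
Hypothesis i0 : i < 0.

Lemma neg_novec : xi.1 = 0.
Proof. by apply/eqP; apply: (@entry_novec _ _ _ _ (elt xi)); rewrite lt_eqF. Qed.
Lemma neg_trunc : trunc r xi.2 = xi.2. Proof. exact: (entry_trunc (elt xi)). Qed.
Lemma neg_trunc_extd : trunc r (extd xi.2) = extd xi.2.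
Proof.
apply: (trunc_id (has_degree_extd (entry_degree (elt xi)))).
by rewrite /=; lia.
Qed.

Lemma bracket_value_unary : bracket_value [:: elt xi] = (0, extd xi.2).
Proof.
congr pair; rewrite [LHS]mbr_cons -[mbr (shift _ _) _]/(0 : W) subr0.
by rewrite -[(entry _).2]/(xi.2) courant_nil ?neg_trunc_extd // neg_trunc.
Qed.

Lemma bracket_value_neg e : bracket_value [:: elt e; elt xi] =
  (0, 2^-1 *: lieD e.1 xi.2).
Proof.
congr pair; first by rewrite /= neg_novec (br0r lieC (@lie_linr _ _ M)).
rewrite [LHS]mbr_cons mbr_cons -[mbr (shift _ _) [::]]/(0 : W) subr0.
rewrite -[unzip1 _]/[:: xi.1] neg_novec.
rewrite (multilinear0 [::] [::] (@courant_multilinear _ _ M r)) lend0 sub0r.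
have [-> _] := courant_below_top neg_trunc neg_trunc_extd e.1 0.
exact: opprK.
Qed.

Lemma bracket_value_neg_trinary e1 e2 : bracket_value [:: elt xi; elt e1; elt e2] =
  (0, Phi [:: e1.1; e2.1] xi.2).
Proof.
rewrite bracket_value3 //; congr pair.
exact: (mbr_novec [:: elt e1; elt e2] (@courant_multilinear _ _ M r) neg_novec).
Qed.

End Components.

Lemma bracket_value_courant (e1 e2 : component M r 0) :
  bracket_value [:: elt e1; elt e2] = courant e1 e2.
Proof.
rewrite [RHS]surjective_pairing courant_snd; congr pair.
rewrite [LHS]mbr_cons mbr_cons -[mbr (shift _ _) [::]]/(0 : W) subr0.
have [-> _] := courant_at_top (trunc_form e1) (trunc_extd_form e1) e2.1 0.
have [-> _] := courant_at_top (trunc_form e2) (trunc_extd_form e2) e1.1 0.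
by abel.
Qed.

(** Both sides are sums of contractions and Lie derivatives of the three forms;
    they agree once the contractions are brought to a common order and each term
    with a differential is split into halves. *)
Lemma bracket_value_trinary (e0 e1 e2 : component M r 0) :
  bracket_value [:: elt e0; elt e1; elt e2] =
  (0, - 6^-1 *: (pairing (courant e0 e1) e2 + pairing (courant e1 e2) e0
                 + pairing (courant e2 e0) e1)).
Proof.
rewrite bracket_value3 //; congr pair.
rewrite [LHS]mbr_cons !mbr_cons -[mbr _ [::]]/(0 : W) subr0.
have [_ E0] := courant_at_top (trunc_form e0) (trunc_extd_form e0) e1.1 e2.1.
have [_ E1] := courant_at_top (trunc_form e1) (trunc_extd_form e1) e0.1 e2.1.
have [_ E2] := courant_at_top (trunc_form e2) (trunc_extd_form e2) e0.1 e1.1.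
rewrite -[LHS]/(Phi [:: e1.1; e2.1] e0.2 -
  (Phi [:: e0.1; e2.1] e1.2 - Phi [:: e0.1; e1.1] e2.2)) {}E0 {}E1 {}E2.
rewrite -!scalerBr; congr (_ *: _).
rewrite /pairing !courant_snd -![(courant _ _).1]/(lie _ _).
move: (e0.1) (e1.1) (e2.1) (e0.2) (e1.2) (e2.2) => X Y Z a b c.
rewrite -(half_sum (contract Y (contract Z (extd a)))).
rewrite -(half_sum (contract X (contract Z (extd b)))).
rewrite -(half_sum (contract X (contract Y (extd c)))).
rewrite (lieC Z X) contractNl !(contractD, contractN, contractZ).
rewrite (contractC Z X) (contractC Z Y) (contractC Y X).
by rewrite !(scalerDr, scalerN, scalerBr); abel.
Qed.

Lemma bracket_degree_elts (f : nat -> component M r 0) l :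
  bracket_degree [seq elt (f k) | k <- l] = 2 - (size l)%:Z.
Proof. by rewrite /bracket_degree big_map big1 // add0r size_map. Qed.

Lemma bracket_degree_cons_elts d (xi : component M r d) (f : nat ->
  component M r 0) l :
  bracket_degree (elt xi :: [seq elt (f k) | k <- l]) = d + 1 - (size l)%:Z.
Proof.
by rewrite /bracket_degree big_cons big_map big1 // /= size_map; lia.
Qed.

Lemma bracket_value_cons_elts d (xi : component M r d) (f : nat ->
  component M r 0) l :
  xi.1 = 0 -> (2 <= size l)%N ->
  bracket_value (elt xi :: [seq elt (f k) | k <- l]) =
    (0, Phi [seq (f k).1 | k <- l] xi.2).
Proof.
move=> xi0 l2; rewrite bracket_value3; last by rewrite /= size_map.
congr pair; rewrite [LHS]mbr_novec //; last exact: courant_multilinear.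
by rewrite /unzip1 -!map_comp.
Qed.

(** The bracket takes the form component of exactly one entry and the vector
    component of all others. *)
Lemma mbr_form_entries (F : cochain V W) n (e : nat -> component M r 0) :
  mbr F (map entry [seq elt (e k) | k <- iota 0 n]) =
  \sum_(i < n) mbr F (map entry
    [seq elt (if k == i :> nat then form_part (e k) else vec_part (e k)) | k <-
      iota 0 n]).
Proof.
have E (f : nat -> component M r 0) :
  mbr F (map entry [seq elt (f k) | k <- iota 0 n]) =
    \sum_(p < n) (-1) ^+ p *: F [seq (f k).1 | k <- remove_nth p (iota 0 n)] (f p).2.
  have sn : size (map entry [seq elt (f k) | k <- iota 0 n]) = n.
    by rewrite !size_map size_iota.
  rewrite (mbrE _ _ 0) -(big_mkord xpredT (fun p => (-1) ^+ p *:
    F (unzip1 (remove_nth p (map entry [seq elt (f k) | k <- iota 0 n])))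
      (nth 0 (map entry [seq elt (f k) | k <- iota 0 n]) p).2)).
  rewrite sn big_mkord; apply: eq_bigr => p _.
  rewrite -map_comp (nth_map 0%N) ?size_iota // nth_iota // add0n.
  by rewrite -remove_nth_map /unzip1 -map_comp.
rewrite E; apply: eq_bigr => i _; rewrite E (bigD1 i) //= eqxx big1 ?addr0 => [|p pi].
  congr (_ *: F _ _); apply/eq_in_map => k.
  rewrite (remove_nth_filter 0%N) ?iota_uniq ?size_iota // mem_filter
    nth_iota // add0n.
  by move=> /andP[/negPf -> _].
by rewrite -val_eqE in pi; rewrite (negPf pi) /= linear0 scaler0.
Qed.

End Formulas.

Theorem proposition8p1 (R : realType) (m : nat) (M : manifold R m) (r : nat)
    (hr : (2 <= r)%N) :
  exists L : Lie_algebra (courant_complex M r) r,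
  [/\ (forall (s : seq (homog (courant_complex M r))) (e : int),
         ~~ allowed_entries s -> lbr L s e = 0),
      (forall (i : int) (xi : component M r i), i < 0 ->
         bracket L [:: elt xi] (i + 1) = (0, extd xi.2)),
      (forall e1 e2 : component M r 0,
         bracket L [:: elt e1; elt e2] 0 = courant e1 e2) /\
      (forall (e : component M r 0) (i : int) (xi : component M r i), i < 0 ->
         bracket L [:: elt e; elt xi] i = (0, 2^-1 *: lieD e.1 xi.2)),
      (forall e0 e1 e2 : component M r 0,
         bracket L [:: elt e0; elt e1; elt e2] (-1) =
         (0, - 6^-1 *: (pairing (courant e0 e1) e2 + pairing (courant e1 e2) e0
                        + pairing (courant e2 e0) e1))) /\
      (forall (i : int) (xi : component M r i) (e1 e2 : component M r 0),
         i < 0 ->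
         bracket L [:: elt xi; elt e1; elt e2] (i - 1) =
         (0, - 6^-1 *:
             (2^-1 *: (contract e1.1 (lieD e2.1 xi.2)
                       - contract e2.1 (lieD e1.1 xi.2))
              + contract (lie e1.1 e2.1) xi.2)))
    & forall n : nat, odd n -> (3 <= n)%N ->
      [/\ (forall e : nat -> component M r 0,
             lbr L [seq elt (e k) | k <- iota 0 n] (2 - n%:Z) =
             \sum_(i < n)
               lbr L [seq elt (if k == i :> nat then form_part (e k)
                               else vec_part (e k)) | k <- iota 0 n]
                     (2 - n%:Z)),
          (forall (alpha : component M r 0) (e : nat -> component M r 0),
             bracket L (elt (form_part alpha) ::
                        [seq elt (vec_part (e k)) | k <- index_iota 1 n])
                     (2 - n%:Z) =
             (0, nary_bracket n (fun k => (e k).1) (fun i j =>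
                   (bracket L [:: elt (form_part alpha); elt (vec_part (e i));
                                  elt (vec_part (e j))] (-1)).2)))
        & (forall (d : int) (xi : component M r d)
                  (e : nat -> component M r 0), d < 0 ->
             bracket L (elt xi :: [seq elt (e k) | k <- index_iota 1 n])
                     (d + 2 - n%:Z) =
             (0, nary_bracket n (fun k => (e k).1) (fun i j =>
                   (bracket L [:: elt xi; elt (vec_part (e i));
                                  elt (vec_part (e j))] (d - 1)).2)))]].
Proof.
have r0 : (0 < r)%N by exact: ltnW.
exists (courant_Lie_algebra (M := M) r0).
have bv s e : e = bracket_degree s -> bracket (courant_Lie_algebra (M := M) r0)
  s e = bracket_value s.
  exact: courant_lbr_val.
have lv s e : lbr (courant_Lie_algebra (M := M) r0) s e = courant_lbr s e by [].
split.
- move=> s e h; rewrite lv; apply: courant_lbr0; exact: bracket_value_allowed.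
- move=> i xi i0; rewrite bv; last by rewrite /bracket_degree big_seq1 /=; lia.
  exact: bracket_value_unary.
- split.
    move=> e1 e2; rewrite bv; last by rewrite /bracket_degree !big_cons big_nil.
    exact: bracket_value_courant.
  move=> e i xi i0; rewrite bv; last by rewrite /bracket_degree !big_cons
    big_nil /=; lia.
  exact: bracket_value_neg.
- split.
    move=> e0 e1 e2; rewrite bv; last by rewrite /bracket_degree !big_cons big_nil.
    exact: bracket_value_trinary.
  move=> i xi e1 e2 i0; rewrite bv; last by rewrite /bracket_degree !big_cons
    big_nil /=; lia.
  rewrite bracket_value_neg_trinary //; congr pair.
  by have [_] := courant_below_top (neg_trunc xi) (neg_trunc_extd xi i0) e1.1 e2.1.
move=> n on n3; have n12 : (2 <= size (index_iota 1 n))%N.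
  by rewrite size_iota; lia.
have n1 : (size (index_iota 1 n))%:Z = n%:Z - 1 by rewrite size_iota; lia.
have pairE d (xi : component M r d) (e1 e2 : component M r 0) : xi.1 = 0 ->
    (bracket (courant_Lie_algebra (M := M) r0) [:: elt xi; elt e1; elt e2]
      (d - 1)).2 =
    courant_cochain r [:: e1.1; e2.1] xi.2.
  move=> xi0; rewrite bv; last by rewrite /bracket_degree !big_cons big_nil /=; lia.
  by have /(congr1 snd) :=
    bracket_value_cons_elts (fun k => nth e1 [:: e1; e2] k) (l := [:: 0; 1]%N)
    xi0 isT.
split.
- move=> e; rewrite lv; apply: component_inj; rewrite component_sum.
  have E (f : nat -> component M r 0) :
      component_val (courant_lbr [seq elt (f k) | k <- iota 0 n] (2 - n%:Z)) =
      (0, mbr (courant_cochain r) (map entry [seq elt (f k) | k <- iota 0 n])).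
    rewrite courant_lbr_val ?bracket_degree_elts ?size_iota // bracket_value3 //.
    by rewrite size_map size_iota.
  rewrite E mbr_form_entries.
  rewrite (big_morph (fun w : form M => (0, w) : vfield M * form M)
    (op1 := +%R) (id1 := 0)) => [|w v|//]; last first.
    by rewrite -[RHS]/((0 + 0), (w + v)) addr0.
  by apply: eq_bigr => i _; rewrite -E.
- move=> alpha e; rewrite bv; last by rewrite bracket_degree_cons_elts n1; lia.
  rewrite bracket_value_cons_elts // courant_nary //; last exact: trunc_form.
  congr (_, nary_bracket _ _ _); apply/funext => i; apply/funext => j.
  exact/esym/(pairE 0 (form_part alpha)).
- move=> d xi e d0; rewrite bv; last by rewrite bracket_degree_cons_elts n1; lia.
  rewrite bracket_value_cons_elts ?neg_novec // courant_nary //;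
    last exact: neg_trunc.
  congr (_, nary_bracket _ _ _); apply/funext => i; apply/funext => j.
  exact/esym/(pairE d xi)/neg_novec.
Qed.
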